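(* Let $D\subseteq\mathbb{C}$ be a domain equipped with a metric $\rho$ with corresponding distance $d=d_\rho$, such that (1) $C_\rho:=\inf_{\zeta\in D}\rho(\zeta)>0$; (2) $d(\zeta,\eta)\to\infty$ as $\zeta\to\partial D$, for every $\eta\in D$. Let $\mathcal{F}\subseteq\mathrm{Aut}(D)$ and assume that $D$ is $\mathcal{F}$-transitive and that $\rho$ is $\mathcal{F}$-invariant. Let $p\in[1,\infty)$ and $\alpha\in(0,1]$. If an analytic mapping $f:\mathbb{D}\to D$ on the unit disk $\mathbb{D}$ satisfies $f\in\rho H^p$ and $f_b\in\rho\Lambda^p_\alpha$, then $$m_p(r,f^\ast)=\mathcal{O}\big((1-r)^{\alpha-1}\big),\quad r\to1.$$
   Context: $\mathbb{D}$ is the open unit disk in $\mathbb{C}$. A metric $\rho$ on a domain $D\subseteq\mathbb{C}$ is a positive continuous function on $D$. The $\rho$-distance is $d_\rho(\zeta,\eta)=\inf_\gamma\int_\gamma\rho(\omega)\,|d\omega|$, the infimum being over all piecewise $\mathcal{C}^1$-smooth curves $\gamma$ in $D$ joining $\zeta$ and $\eta$. The boundary $\partial D$ is taken in the extended plane $\overline{\mathbb{C}}$. $\mathrm{Aut}(D)$ is the group of conformal (biholomorphic) self-maps of $D$. For a subset $\mathcal{F}\subseteq\mathrm{Aut}(D)$: the domain $D$ is $\mathcal{F}$-transitive if there exists a compact set $K\subseteq D$ such that for every $\zeta\in D$ there exists $\varphi\in\mathcal{F}$ with $\varphi(\zeta)\in K$; the metric $\rho$ is $\mathcal{F}$-invariant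 if $d_\rho(\varphi(\zeta),\varphi(\eta))=d_\rho(\zeta,\eta)$ for all $\zeta,\eta\in D$ and all $\varphi\in\mathcal{F}$. For an analytic mapping $f:\mathbb{D}\to D$, the $\rho$-derivative of $f$ is $f^\ast(z)=\lim_{w\to z}\frac{d_\rho(f(z),f(w))}{|z-w|}=\rho(f(z))\,|f'(z)|$, $z\in\mathbb{D}$. For a continuous nonnegative function $g$ on $\mathbb{D}$ and $r\in(0,1)$, $m_p(r,g)=\left(\int_{-\pi}^{\pi}g(re^{it})^p\,dt\right)^{1/p}$. $\rho H^p$ is the set of analytic mappings $f:\mathbb{D}\to D$ such that $\sup_{r\in(0,1)}\left(\int_{-\pi}^{\pi}d_\rho(f(re^{it}),f(0))^p\,dt\right)^{1/p}$ is finite. Under (1), $\rho H^p$ is contained in the classical Hardy space $H^p$, so for $f\in\rho H^p$ the radial limit $f_b(t)=\lim_{r\to1}f(re^{it})$ exists for a.e. $t$. $\rho\Lambda_\alpha^p$ is the class of all $2\pi$-periodic functions $\phi$ defined a.e. on $\mathbb{R}$ with values in $D$ such that $\sup_{s\in(0,h)}\left(\int_0^{2\pi}d_\rho(\phi(t+s),\phi(t))^p\,dt\right)^{1/p}=\mathcal{O}(h^\alpha)$ as $h\to0$ (so membership of $f_b$ includes $f_b(t)\in D$ for a.e. $t$). *)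

(* Defs.v *)
From HB Require Import structures.
From mathcomp Require Import all_boot all_order all_algebra complex.
From mathcomp Require Import all_classical all_reals all_analysis.

Set Implicit Arguments.
Unset Strict Implicit.
Unset Printing Implicit Defensive.

Import Order.TTheory GRing.Theory Num.Theory.
Import numFieldNormedType.Exports.

Local Open Scope classical_set_scope.
Local Open Scope ring_scope.

(* The complex numbers R[i] seen as a numClosedFieldType: through this alias
   they inherit the topology and the normed module structure (over themselves)
   that MathComp-Analysis puts on every numFieldType, which the bare type R[i]
   does not. *)
Definition cplx (R : realType) : numClosedFieldType := R[i].

Section RhoHardy.
Variable R : realType.
Local Notation C := (cplx R).
Local Notation mu := (@lebesgue_measure R).
Implicit Types (D : set C) (rho : C -> R) (F : set (C -> C)) (f : C -> C).

(* The R-valued modulus; the norm `|z| of MathComp is C-valued. *)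
Definition modulus (z : C) : R := ComplexField.Normc.normc z.

Definition polar (r t : R) : C := Complex (r * cos t) (r * sin t).

Definition unit_disk : set C := [set z | modulus z < 1].

Definition domain D : Prop := [/\ D !=set0, open D & connected D].

Definition holomorphic_on D f : Prop := forall z, D z -> derivable f z 1.

Definition analytic_map D f : Prop :=
  holomorphic_on unit_disk f /\ {homo f : z / unit_disk z >-> D z}.

Definition is_metric D rho : Prop :=
  {within D, continuous rho} /\ forall z, D z -> 0 < rho z.

Definition re_part (gamma : R -> C) (t : R) : R := complex.Re (gamma t).
Definition im_part (gamma : R -> C) (t : R) : R := complex.Im (gamma t).

(* u is C^1 on ]a, b[ and its derivative has a continuous extension to [a, b];
   for u continuous on [a, b] this is C^1-smoothness on [a, b] with one-sided
   derivatives at the endpoints. *)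
Definition C1_between (a b : R) (u : R -> R) : Prop :=
  {in `]a, b[, forall t, derivable u t 1} /\
  exists du : R -> R, {within `[a, b], continuous du} /\
    {in `]a, b[, forall t, derive1 u t = du t}.

Definition piecewise_C1 (a b : R) (gamma : R -> C) : Prop :=
  {within `[a, b], continuous gamma} /\
  exists2 s : seq R, itv_partition a b s &
    forall i, (i < size s)%N ->
      let c := nth b (a :: s) i in let d := nth b s i in
      C1_between c d (re_part gamma) /\ C1_between c d (im_part gamma).

(* The derivative of gamma is taken componentwise; at the finitely many
   breakpoints of the partition its value is irrelevant. *)
Definition speed (gamma : R -> C) (t : R) : R :=
  modulus (Complex (derive1 (re_part gamma) t) (derive1 (im_part gamma) t)).

Definition rho_length rho (a b : R) (gamma : R -> C) : R :=
  \int[mu]_(t in `[a, b]) (rho (gamma t) * speed gamma t).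

Definition joins D (a b : R) (gamma : R -> C) (z w : C) : Prop :=
  [/\ a < b, piecewise_C1 a b gamma,
      forall t, t \in `[a, b] -> D (gamma t), gamma a = z & gamma b = w].

(* Meaningful for z and w in a domain D: then some curve joins them, so that
   the infimum is over a nonempty set of nonnegative reals. *)
Definition rho_dist D rho (z w : C) : R :=
  inf [set L | exists a b gamma,
         joins D a b gamma z w /\ L = rho_length rho a b gamma].

(* The extended plane is the one-point compactification of C; its elements
   are the Some z, for z : C, and the point at infinity None. *)
Definition ext_boundary D : set (one_point_compactification C) :=
  let D' : set (one_point_compactification C) := Some @` D in
  closure D' `\` interior D'.

(* d_rho(z, w) --> +oo as z --> \partial D within D: set_nbhs is the filter of
   the neighborhoods of a set. *)
Definition dist_blowup D rho : Prop :=
  forall w, D w -> forall M : R,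
    set_nbhs (ext_boundary D)
      [set x | forall z, D z -> x = Some z -> M < rho_dist D rho z w].

(* The elements of Aut(D), and of its subsets, are represented by total
   functions; only their values on D matter. *)
Definition Aut D : set (C -> C) :=
  [set phi | holomorphic_on D phi /\ {homo phi : z / D z >-> D z} /\
     exists psi : C -> C,
       [/\ holomorphic_on D psi, {homo psi : z / D z >-> D z},
           forall z, D z -> psi (phi z) = z &
           forall z, D z -> phi (psi z) = z]].

Definition transitive_domain F D : Prop :=
  exists2 K : set C, compact K /\ K `<=` D &
    forall z, D z -> exists2 phi, F phi & K (phi z).

Definition invariant_metric F D rho : Prop :=
  forall phi, F phi -> forall z w, D z -> D w ->
    rho_dist D rho (phi z) (phi w) = rho_dist D rho z w.

Definition rho_derivative D rho f (z : C) : R :=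
  lim (rho_dist D rho (f z) (f w) / modulus (z - w) @[w --> z^']).

(* The norms are extended real numbers, so that a bound on one of them
   includes its finiteness. *)
Definition Lp_norm_on (a b p : R) (u : R -> R) : \bar R :=
  poweR (\int[mu]_(t in `[a, b]) (powR (u t) p)%:E)%E p^-1.

Definition mean_p (p r : R) (g : C -> R) : \bar R :=
  Lp_norm_on (- pi) pi p (fun t => g (polar r t)).

Definition rhoH D rho (p : R) : set (C -> C) :=
  [set f | analytic_map D f /\
    let m r := mean_p p r (fun z => rho_dist D rho (f z) (f 0)) in
    (ereal_sup (m @` `]0%R, 1%R[) < +oo)%E].

(* A function defined almost everywhere is given by its domain E of definition
   and a total function phi whose values outside E are irrelevant. The radial
   limit function f_b is thus the pair (radial_dom f, radial_lim f). *)
Definition radial_dom f : set R :=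
  [set t | cvg (f (polar r t) @[r --> 1^'-])].

Definition radial_lim f (t : R) : C := lim (f (polar r t) @[r --> 1^'-]).

Definition rhoLambda D rho (p alpha : R) (E : set R) (phi : R -> C) : Prop :=
  [/\ {ae mu, forall t, E t /\ D (phi t)},
      forall t, E (t + 2 * pi) <-> E t,
      forall t, E t -> phi (t + 2 * pi) = phi t &
      let m s := Lp_norm_on 0 (2 * pi) p
                   (fun t => rho_dist D rho (phi (t + s)) (phi t)) in
      exists M : R, \forall h \near 0^'+,
        (ereal_sup (m @` `]0%R, h[) <= (M * powR h alpha)%:E)%E].

End RhoHardy.

(* Main.v *)
(** Let [z = r e^(i th)] and [delta = 1 - r], and let [phi] in [F] move [f z] into
    the compact set [K]. Since [phi] is an isometry of [d_rho], the map
    [g = phi o f] has the same rho-derivative as [f], while [rho] is bounded at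
    [g z] and [|g_b t - g_b th| <= d_rho (f_b t) (f_b th) / C_rho]. A function of
    the Hardy space [H^1] is majorized by the Poisson integral of the modulus of
    its boundary values; for [(g w - g_b th) / (1 - conj z * w)] this bounds
    [g - g_b th] on the disc of radius [delta / 2] about [z], and Cauchy's estimate
    gives, for almost every [th],
      [f^* z <= C delta \int d_rho (f_b t) (f_b th) / |e^(i t) - z|^3 dt].
    By Jensen's inequality for the weight [delta / |e^(i s) - r|^2], whose mass is
    bounded, and by Tonelli's theorem, the mean of order [p] of [f^*] is then
    controlled by the integrals of [d_rho (f_b (th + s)) (f_b th) ^ p] in [th],
    which are [O(|s|^(alpha p))], and [|s| <= 3 |e^(i s) - r|]. *)
Require Import Defs.
From HB Require Import structures.
From mathcomp Require Import all_boot all_order all_algebra complex ring lra.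
From mathcomp Require Import all_classical all_reals all_analysis measurable_realfun.
Import Order.TTheory GRing.Theory Num.Theory.
Import numFieldNormedType.Exports.
Local Open Scope classical_set_scope.
Local Open Scope ring_scope.
Set Implicit Arguments.
Unset Strict Implicit.
Unset Printing Implicit Defensive.

(** * Complex differentiability *)

(** Since [rho] may be unbounded on [D], a bound for [f'] alone says nothing about
    [rho (f z) * |f' z|]; the derivative is therefore estimated for [phi o f], at a point where
    [rho] is bounded. The map [phi] changes with [z], so no constant may depend on it: the estimate
    uses only the bound of [rho] on [K], the lower bound of [rho] on [D], and distances, which [phi]
    preserves. Only [d_rho] is assumed invariant, not the density; what passes from [f] to [phi o f]
    is the limit of the difference quotients of [d_rho]. The value subtracted is the boundary value
    at the angle [th] of [z], and not [g z], because the Lipschitz condition compares boundary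
    values with one another. These exist almost everywhere only; for Tonelli's theorem their
    distance is represented by a limit superior along radii, which is jointly measurable. *)

Section complex_plane.
Variable R : realType.
Local Notation C := (cplx R).
Local Notation mod := (@modulus R).
Implicit Types (z w : C) (f g : C -> C).

Lemma ReD z w : complex.Re (z + w) = complex.Re z + complex.Re w.
Proof. by case: z w => a b [c d]. Qed.
Lemma ImD z w : complex.Im (z + w) = complex.Im z + complex.Im w.
Proof. by case: z w => a b [c d]. Qed.
Lemma ReN z : complex.Re (- z) = - complex.Re z.
Proof. by case: z. Qed.
Lemma ImN z : complex.Im (- z) = - complex.Im z.
Proof. by case: z. Qed.
Lemma ReM z w : complex.Re (z * w) =
  complex.Re z * complex.Re w - complex.Im z * complex.Im w.
Proof. by case: z w => a b [c d]. Qed.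
Lemma ImM z w : complex.Im (z * w) =
  complex.Re z * complex.Im w + complex.Im z * complex.Re w.
Proof. by case: z w => a b [c d]. Qed.

Lemma cplx_ext z w :
  complex.Re z = complex.Re w -> complex.Im z = complex.Im w -> z = w.
Proof. by case: z w => a b [c d] /= -> ->. Qed.

Lemma normE z : `|z| = (mod z)%:C%C.
Proof. by []. Qed.

Lemma modulus2 z : mod z ^+ 2 = complex.Re z ^+ 2 + complex.Im z ^+ 2.
Proof. by case: z => a b; rewrite /modulus /= sqr_sqrtr ?addr_ge0 ?sqr_ge0. Qed.

Lemma modulus_ge0 z : 0 <= mod z.
Proof. by case: z => a b; rewrite /modulus /= sqrtr_ge0. Qed.

Lemma modulus0 : mod 0 = 0.
Proof. exact: ComplexField.Normc.normc0. Qed.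
Lemma modulus1 : mod 1 = 1.
Proof. exact: ComplexField.Normc.normc1. Qed.
Lemma modulusM z w : mod (z * w) = mod z * mod w.
Proof. exact: ComplexField.Normc.normcM. Qed.
Lemma modulusV z : mod z^-1 = (mod z)^-1.
Proof. exact: ComplexField.Normc.normcV. Qed.
Lemma modulusN z : mod (- z) = mod z.
Proof. exact: normcN. Qed.
Lemma modulusD z w : mod (z + w) <= mod z + mod w.
Proof. exact: le_normcD. Qed.
Lemma modulus_eq0 z : mod z = 0 -> z = 0.
Proof. exact: ComplexField.Normc.eq0_normc. Qed.
Lemma modulus_gt0 z : (0 < mod z) = (z != 0).
Proof.
rewrite lt_def modulus_ge0 andbT; congr (~~ _).
by apply/eqP/eqP => [/modulus_eq0//|->]; rewrite modulus0.
Qed.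
Lemma modulusX z n : mod (z ^+ n) = mod z ^+ n.
Proof. by elim: n => [|n IH]; rewrite ?expr0 ?modulus1// !exprS modulusM IH. Qed.
Lemma modulusB z w : mod (z - w) = mod (w - z).
Proof. by rewrite -modulusN opprB. Qed.
Lemma modulusB_ge z w : mod z - mod w <= mod (z - w).
Proof. by rewrite lerBlDr -{1}(subrK w z) modulusD. Qed.
Lemma modulusB_tri u z w : mod (z - w) <= mod (z - u) + mod (u - w).
Proof. by rewrite -{1}(subrK u z) -addrA modulusD. Qed.
Lemma modulus_prod (I : Type) (s : seq I) (F : I -> C) :
  mod (\prod_(i <- s) F i) = \prod_(i <- s) mod (F i).
Proof. by elim: s => [|x s IH]; rewrite ?big_nil ?modulus1// !big_cons modulusM IH. Qed.

Definition cj z : C := (z^*)%C.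
Definition cr (x : R) : C := Complex x 0.

Lemma modulus_conj z : mod (cj z) = mod z.
Proof. by case: z => a b; rewrite /modulus /= sqrrN. Qed.

Lemma modulus_real (x : R) : mod (cr x) = `|x|.
Proof. by rewrite /modulus /= expr0n addr0 sqrtr_sqr. Qed.

Lemma crM (x y : R) : cr (x * y) = cr x * cr y.
Proof. by apply: cplx_ext; rewrite ?ReM ?ImM /=; ring. Qed.
Lemma crD (x y : R) : cr (x + y) = cr x + cr y.
Proof. by apply: cplx_ext; rewrite ?ReD ?ImD /= ?addr0. Qed.
Lemma crN (x : R) : cr (- x) = - cr x.
Proof. by apply: cplx_ext; rewrite ?ReN ?ImN /= ?oppr0. Qed.

Lemma conjM z w : cj (z * w) = cj z * cj w.
Proof. by case: z w => a b [c d]; apply: cplx_ext; rewrite ?ReM ?ImM /=; ring. Qed.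
Lemma conjB z w : cj (z - w) = cj z - cj w.
Proof. by case: z w => a b [c d]; apply: cplx_ext; rewrite ?ReD ?ImD /=; ring. Qed.
Lemma conjK z : cj (cj z) = z.
Proof. by case: z => a b; apply: cplx_ext => //=; rewrite opprK. Qed.
Lemma conj_real (x : R) : cj (cr x) = cr x.
Proof. by apply: cplx_ext => //=; rewrite oppr0. Qed.

Lemma conjV z : cj z^-1 = (cj z)^-1.
Proof.
have [->|z0] := eqVneq z 0; first by rewrite invr0 -[0 : C]/(cr 0) conj_real invr0.
have c0 : cj z != 0 by rewrite -modulus_gt0 modulus_conj modulus_gt0.
apply: (mulfI c0); rewrite -conjM !divff// -[1 : C]/(cr 1); exact: conj_real.
Qed.

Lemma mul_conj z : z * cj z = cr (mod z ^+ 2).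
Proof.
by rewrite modulus2; case: z => a b; apply: cplx_ext; rewrite ?ReM ?ImM /=; ring.
Qed.

Lemma norm_Re_le z : `|complex.Re z| <= mod z.
Proof.
rewrite -(ler_pXn2r (n:=2)) ?nnegrE ?modulus_ge0//.
rewrite modulus2 real_normK ?num_real//.
by rewrite lerDl sqr_ge0.
Qed.
Lemma norm_Im_le z : `|complex.Im z| <= mod z.
Proof.
rewrite -(ler_pXn2r (n:=2)) ?nnegrE ?modulus_ge0//.
rewrite modulus2 real_normK ?num_real//.
by rewrite lerDr sqr_ge0.
Qed.
Lemma Re_le_modulus z : complex.Re z <= mod z.
Proof. exact: le_trans (ler_norm _) (norm_Re_le z). Qed.
Lemma modulus_le z : mod z <= `|complex.Re z| + `|complex.Im z|.
Proof.
rewrite -(ler_pXn2r (n:=2)) ?nnegrE ?modulus_ge0 ?addr_ge0//.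
rewrite modulus2 sqrrD !real_normK ?num_real//.
by rewrite lerD2r lerDl mulrn_wge0// mulr_ge0.
Qed.

(** Bounds on the modulus of an integral, or of a chord, reduce to real integrals after a rotation
    that makes the quantity real and nonnegative. *)
Lemma unimodular_Re z : exists2 u : C, mod u = 1 & complex.Re (u * z) = mod z.
Proof.
have [->|z0] := eqVneq z 0.
  by exists 1; rewrite ?modulus1// mulr0 modulus0.
have m0 : mod z != 0 by rewrite gt_eqF// modulus_gt0.
exists (cr (mod z)^-1 * cj z).
  by rewrite modulusM modulus_conj modulus_real ger0_norm ?invr_ge0 ?modulus_ge0// mulVf.
by rewrite -mulrA [cj z * z]mulrC mul_conj -crM /= expr2 mulKf.
Qed.

(** The balls of [cplx R] have complex radii, positive meaning real and positive; from here on
    neighborhoods are handled with a real radius and [modulus]. *)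
Lemma nbhs_modP z (A : set C) :
  nbhs z A <-> exists2 e : R, 0 < e & forall w, mod (w - z) < e -> A w.
Proof.
split=> [/nbhs_ballP [e e0 eA]|[e e0 eA]].
  have e0' : 0 < complex.Re e.
    by case: (e) e0 => a b /=; rewrite ltcE /= => /andP[].
  exists (complex.Re e) => // w we; apply: eA; rewrite /ball /= normE.
  by case: (e) e0 e0' we => a b /=; rewrite !ltcE /= => /andP[/eqP <- _] _; rewrite modulusB eqxx => ->.
apply/nbhs_ballP; exists (e%:C)%C; first by rewrite /= ltcE /= eqxx.
move=> w; rewrite /ball /= normE ltcE /= eqxx /= => we; apply: eA.
by rewrite modulusB.
Qed.

Lemma open_modP (A : set C) : open A <->
  forall z, A z -> exists2 e : R, 0 < e & forall w, mod (w - z) < e -> A w.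
Proof.
rewrite openE; split=> [oA z /oA|oA z /oA]; rewrite /interior => /nbhs_modP//.
Qed.

Lemma continuous_modP (T : topologicalType) (f : T -> C) (x : T) :
  {for x, continuous f} <->
  forall e : R, 0 < e -> \forall y \near x, mod (f y - f x) < e.
Proof.
split=> [cf e e0|cf A /= /nbhs_modP[e e0 eA]].
  by apply: (cf [set w | mod (w - f x) < e]); apply/nbhs_modP; exists e.
by rewrite nbhs_nearE; near do apply: eA; exact: cf.
Unshelve. all: by end_near. Qed.

Lemma cvg_modP (T : Type) (F : set_system T) {FF : Filter F} (f : T -> C) l :
  f @ F --> l <-> forall e : R, 0 < e -> \forall y \near F, mod (f y - l) < e.
Proof.
split=> [cf e e0|cf A /= /nbhs_modP[e e0 eA]].
  by apply: (cf [set w | mod (w - l) < e]); apply/nbhs_modP; exists e.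
by apply: filterS (cf _ e0) => x; exact: eA.
Qed.

Lemma near_mod z (e : R) : 0 < e -> \forall w \near z, mod (w - z) < e.
Proof. by move=> e0; apply/nbhs_modP; exists e. Qed.

Lemma continuous_modulus : continuous mod.
Proof.
move=> z; apply/(@cvgrPdist_lt _ _ _ _ (nbhs_filter z)) => e e0.
apply: filterS (near_mod z e0) => w; rewrite modulusB.
apply: le_lt_trans; rewrite ler_norml modulusB_ge andbT lerNl opprB.
by rewrite modulusB modulusB_ge.
Qed.

Lemma continuous_Re : continuous (fun z : C => complex.Re z).
Proof.
move=> z; apply/(@cvgrPdist_lt _ _ _ _ (nbhs_filter z)) => e e0.
apply: filterS (near_mod z e0) => w; rewrite modulusB.
by apply: le_lt_trans; rewrite -ReN -ReD norm_Re_le.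
Qed.

Lemma continuous_Im : continuous (fun z : C => complex.Im z).
Proof.
move=> z; apply/(@cvgrPdist_lt _ _ _ _ (nbhs_filter z)) => e e0.
apply: filterS (near_mod z e0) => w; rewrite modulusB.
by apply: le_lt_trans; rewrite -ImN -ImD norm_Im_le.
Qed.

Lemma cvg_Complex (T : Type) (F : set_system T) {FF : Filter F} (u v : T -> R)
    (a b : R) :
  u @ F --> a -> v @ F --> b -> (fun x => Complex (u x) (v x) : C) @ F --> (Complex a b : C).
Proof.
move=> ua vb; apply/cvg_modP => e e0.
have e20 : 0 < e / 2 by rewrite divr_gt0.
move/cvgrPdist_lt : ua => /(_ _ e20) ua; move/cvgrPdist_lt : vb => /(_ _ e20) vb.
near=> x; apply: le_lt_trans (modulus_le _) _; rewrite /= (splitr e) ltrD//.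
  by rewrite distrC; near: x.
by rewrite distrC; near: x.
Unshelve. all: by end_near. Qed.

Lemma continuous_Complex (T : topologicalType) (u v : T -> R) x :
  {for x, continuous u} -> {for x, continuous v} ->
  {for x, continuous (fun x => Complex (u x) (v x) : C)}.
Proof. exact: cvg_Complex. Qed.

Lemma polar_continuous (T : topologicalType) (r t : T -> R) (x : T) :
  {for x, continuous r} -> {for x, continuous t} ->
  {for x, continuous (fun y => polar (r y) (t y))}.
Proof.
move=> cr ct; apply: continuous_Complex; apply: continuousM => //.
  by apply: continuous_comp => //; exact: continuous_cos.
by apply: continuous_comp => //; exact: continuous_sin.
Qed.

Lemma modulus_polar (r t : R) : mod (polar r t) = `|r|.
Proof.
rewrite /modulus /polar /= !exprMn -mulrDr cos2Dsin2 mulr1; exact: sqrtr_sqr.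
Qed.

Lemma polarM (r s t u : R) : polar r t * polar s u = polar (r * s) (t + u).
Proof. by apply: cplx_ext; rewrite ?ReM ?ImM /= ?cosD ?sinD; ring. Qed.

Lemma polar0 (t : R) : polar 0 t = 0.
Proof. by rewrite /polar !mul0r. Qed.

Lemma polarE (r t : R) : polar r t = cr r * polar 1 t.
Proof. by apply: cplx_ext; rewrite ?ReM ?ImM /=; ring. Qed.

Lemma polarD2pi (r t : R) : polar r (t + 2 * pi) = polar r t.
Proof. by rewrite /polar (mulrC 2 pi) mulr_natr sinD2pi cosD2pi. Qed.

Lemma polar_neq0 (r t : R) : 0 < r -> polar r t != 0.
Proof. by move=> r0; rewrite -modulus_gt0 modulus_polar ger0_norm ?ltW. Qed.

(** First-order expansion with derivative [l], without division and with [w = z] allowed, so that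
    composition needs no case distinction on [f w = f z]. *)
Definition cdiff f z (l : C) := forall e : R, 0 < e ->
  exists2 d : R, 0 < d &
    forall w, mod (w - z) < d -> mod (f w - f z - l * (w - z)) <= e * mod (w - z).

Lemma derivable_cdiff f z : derivable f z 1 -> exists l, cdiff f z l.
Proof.
rewrite /derivable => /cvg_ex[/= l fl]; exists l => e e0.
move/cvg_modP : fl => /(_ _ e0) /nbhs_modP[d d0 de]; exists d => // w wd.
have [->|wz] := eqVneq w z; first by rewrite !subrr mulr0 subr0 modulus0 mulr0.
have wz0 : w - z != 0 by rewrite subr_eq0.
have := de (w - z); rewrite subr0 => /(_ wd wz0) /=.
rewrite [_%:A]mulr1 subrK /= => H.
have -> : f w - f z - l * (w - z) = ((w - z)^-1 *: (f w - f z) - l) * (w - z).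
  by rewrite mulrBl [_ *: _]mulrC mulfVK.
by rewrite modulusM ler_wpM2r ?modulus_ge0// ltW.
Qed.

Lemma cdiff_lip f z l : cdiff f z l -> exists2 d : R, 0 < d &
  forall w, mod (w - z) < d -> mod (f w - f z) <= (mod l + 1) * mod (w - z).
Proof.
move=> /(_ 1 ltr01)[d d0 fd]; exists d => // w /fd.
rewrite mul1r => H; rewrite -(subrK (l * (w - z)) (f w - f z)) mulrDl mul1r.
by apply: le_trans (modulusD _ _) _; rewrite addrC modulusM lerD2l.
Qed.

Lemma cdiff_continuous f z l : cdiff f z l -> {for z, continuous f}.
Proof.
move=> /cdiff_lip[d d0 fd]; apply/continuous_modP => e e0; apply/nbhs_modP.
have k0 : 0 < mod l + 1 by rewrite ltr_wpDl ?modulus_ge0.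
exists (Num.min d (e / (mod l + 1))); first by rewrite lt_min d0 divr_gt0.
move=> w; rewrite lt_min => /andP[wd we]; apply: le_lt_trans (fd _ wd) _.
by rewrite mulrC -ltr_pdivlMr.
Qed.

Lemma cdiff_eq f g z l : (exists2 d : R, 0 < d & forall w, mod (w - z) < d -> f w = g w) ->
  cdiff f z l -> cdiff g z l.
Proof.
move=> [d d0 fg] df e e0; have [d' d'0 H] := df e e0.
exists (Num.min d d'); first by rewrite lt_min d0.
move=> w; rewrite lt_min => /andP[/fg <- wd]; rewrite -(fg z) ?subrr ?modulus0//.
exact: H.
Qed.

Lemma cdiff_cst (c : C) z : cdiff (fun=> c) z 0.
Proof.
by move=> e e0; exists 1 => // w _; rewrite subrr mul0r subrr modulus0 mulr_ge0 ?modulus_ge0 ?ltW.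
Qed.

Lemma cdiff_id z : cdiff id z 1.
Proof.
by move=> e e0; exists 1 => // w _; rewrite mul1r subrr modulus0 mulr_ge0 ?modulus_ge0 ?ltW.
Qed.

Lemma cdiffD f g z l m : cdiff f z l -> cdiff g z m -> cdiff (fun w => f w + g w) z (l + m).
Proof.
move=> df dg e e0; have e20 : 0 < e / 2 by rewrite divr_gt0.
have [d d0 H] := df _ e20; have [d' d'0 H'] := dg _ e20.
exists (Num.min d d'); first by rewrite lt_min d0.
move=> w; rewrite lt_min => /andP[/H {}H /H' {}H'].
rewrite (_ : _ - _ = (f w - f z - l * (w - z)) + (g w - g z - m * (w - z))); last by ring.
apply: le_trans (modulusD _ _) _.
by rewrite (splitr e) mulrDl lerD.
Qed.

Lemma cdiff_comp f g z l m : cdiff f z l -> cdiff g (f z) m ->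
  cdiff (g \o f) z (m * l).
Proof.
move=> df dg e e0; have [d1 d10 flip] := cdiff_lip df.
have k0 : 0 < mod l + 1 by rewrite ltr_wpDl ?modulus_ge0.
have n0 : 0 < mod m + 1 by rewrite ltr_wpDl ?modulus_ge0.
have e1 : 0 < e / 2 / (mod l + 1) by rewrite !divr_gt0.
have e2 : 0 < e / 2 / (mod m + 1) by rewrite !divr_gt0.
have [dg0 dg00 G] := dg _ e1; have [df0 df00 F] := df _ e2.
exists (Num.min (Num.min d1 df0) (dg0 / (mod l + 1))).
  by rewrite !lt_min d10 df00 divr_gt0.
move=> w; rewrite !lt_min => /andP[/andP[w1 wf]]; rewrite ltr_pdivlMr// => wg /=.
have L := flip _ w1; have {}F := F _ wf.
have {}G := G (f w); have {}G : mod (g (f w) - g (f z) - m * (f w - f z))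
    <= e / 2 / (mod l + 1) * mod (f w - f z).
  by apply: G; apply: le_lt_trans L _; rewrite mulrC.
rewrite (_ : _ - _ = (g (f w) - g (f z) - m * (f w - f z)) +
   m * (f w - f z - l * (w - z))); last by ring.
apply: le_trans (modulusD _ _) _; rewrite [e in leRHS](splitr e) mulrDl lerD//.
  apply: le_trans G _; apply: le_trans (ler_wpM2l (ltW e1) L) _.
  by rewrite mulrA mulfVK ?gt_eqF.
rewrite modulusM; apply: le_trans (ler_wpM2l (modulus_ge0 _) F) _.
rewrite mulrA ler_wpM2r ?modulus_ge0// mulrCA ler_piMr ?divr_ge0 ?ltW//.
by rewrite ltr_pdivrMr// mul1r ltrDl.
Qed.

Lemma cdiffM f g z l m : cdiff f z l -> cdiff g z m ->
  cdiff (fun w => f w * g w) z (l * g z + f z * m).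
Proof.
move=> df dg e e0; have [d1 d10 flip] := cdiff_lip df.
have [d2 d20 glip] := cdiff_lip dg.
set K := mod (f z) + mod (g z) + (mod l + 1) * (mod m + 1).
have K0 : 0 < K + 1.
  by rewrite ltr_wpDl// !addr_ge0 ?mulr_ge0 ?addr_ge0 ?modulus_ge0.
have e1 : 0 < e / (K + 1) by rewrite divr_gt0.
have [d3 d30 F] := df _ e1; have [d4 d40 G] := dg _ e1.
exists (Num.min (Num.min d1 d2) (Num.min (Num.min d3 d4) (e / (K + 1)))).
  by rewrite !lt_min d10 d20 d30 d40 e1.
move=> w; rewrite !lt_min => /andP[/andP[w1 w2] /andP[/andP[w3 w4] we]].
have := flip _ w1; have := glip _ w2; have {F} := F _ w3; have {G} := G _ w4.
set x := mod (w - z) in we *.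
have x0 : 0 <= x by exact: modulus_ge0.
rewrite (_ : f w * g w - _ - _ = (f w - f z - l * (w - z)) * g z +
   f z * (g w - g z - m * (w - z)) + (f w - f z) * (g w - g z)); last by ring.
move=> G F gl fl; apply: le_trans (modulusD _ _) _; apply: le_trans (lerD (modulusD _ _) (lexx _)) _.
rewrite !modulusM.
have -> : e * x = e / (K + 1) * (K + 1) * x by rewrite mulfVK// gt_eqF.
apply: (@le_trans _ _ (e / (K + 1) * x * mod (g z) + mod (f z) * (e / (K + 1) * x) +
   ((mod l + 1) * x) * ((mod m + 1) * x))).
  by rewrite !lerD// ?ler_wpM2r ?ler_wpM2l ?ler_pM ?modulus_ge0.
have : (mod l + 1) * x * ((mod m + 1) * x) <= (mod l + 1) * (mod m + 1) * (e / (K + 1)) * x.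
  rewrite mulrACA mulrA -!mulrA ler_wpM2l ?addr_ge0 ?modulus_ge0//.
  by rewrite ler_wpM2l ?addr_ge0 ?modulus_ge0// mulrA ler_wpM2r// ltW.
move: (e / (K + 1)) e1 => E E0 H.
apply: le_trans (lerD (lexx _) H) _.
rewrite -subr_ge0 /K (_ : _ - _ = E * x); first by rewrite mulr_ge0// ltW.
ring.
Qed.

Lemma cdiffV z : z != 0 -> cdiff (fun w => w^-1) z (- z ^- 2).
Proof.
move=> z0 e e0; have m0 : 0 < mod z by rewrite modulus_gt0.
(* The first radius keeps [mod w] above [mod z / 2]; the second absorbs the factor [2 / mod z ^+ 3]
   that then bounds the coefficient of [(w - z) ^+ 2] in the remainder. *)
exists (Num.min (mod z / 2) (e * mod z ^+ 3 / 2)).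
  by rewrite lt_min divr_gt0//= divr_gt0// mulr_gt0// exprn_gt0.
move=> w; rewrite lt_min => /andP[wz we].
have mw : mod z / 2 < mod w.
  have := modulusB_ge z w; rewrite modulusB => H; have := le_lt_trans H wz.
  by move: (mod z) (mod w) => a b; lra.
have w0 : w != 0 by rewrite -modulus_gt0 (lt_trans _ mw)// divr_gt0.
rewrite (_ : _ - _ = (w - z) * (w - z) * (w^-1 * z ^- 2)); last by field; apply/andP.
rewrite !modulusM !modulusV modulusX [leRHS]mulrC -mulrA ler_wpM2l ?modulus_ge0//.
rewrite mulrA ler_pdivrMr ?exprn_gt0// ler_pdivrMr ?(lt_trans _ mw) ?divr_gt0//.
apply: le_trans (ltW we) _.
have -> : e * mod z ^+ 3 / 2 = e * mod z ^+ 2 * (mod z / 2) by ring.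
by rewrite ler_wpM2l ?mulr_ge0 ?exprn_ge0 ?modulus_ge0 ?ltW.
Qed.

Lemma cdiffX z n : exists l, cdiff (fun w => w ^+ n) z l.
Proof.
elim: n => [|n [l IH]]; first by exists 0; exact: cdiff_cst.
eexists; under eq_fun do rewrite exprS; exact: (cdiffM (cdiff_id z) IH).
Qed.

Definition cdiff_at f z := exists l, cdiff f z l.

Lemma cdiff_atD f g z : cdiff_at f z -> cdiff_at g z -> cdiff_at (fun w => f w + g w) z.
Proof. by move=> [l fl] [m gm]; eexists; exact: cdiffD fl gm. Qed.
Lemma cdiff_atM f g z : cdiff_at f z -> cdiff_at g z -> cdiff_at (fun w => f w * g w) z.
Proof. by move=> [l fl] [m gm]; eexists; exact: cdiffM fl gm. Qed.
Lemma cdiff_at_cst (c : C) z : cdiff_at (fun=> c) z.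
Proof. by eexists; exact: cdiff_cst. Qed.
Lemma cdiff_at_id z : cdiff_at (fun w => w) z.
Proof. by eexists; exact: cdiff_id. Qed.
Lemma cdiff_atN f z : cdiff_at f z -> cdiff_at (fun w => - f w) z.
Proof.
move=> [l fl]; exists (-1 * l).
have H : cdiff (fun w => (-1) * w) (f z) (-1).
  have := cdiffM (cdiff_cst (-1) (f z)) (cdiff_id (f z)).
  by rewrite mul0r add0r mulr1.
have := cdiff_comp fl H; congr cdiff; apply/funext => w /=; exact: mulN1r.
Qed.
Lemma cdiff_atB f g z : cdiff_at f z -> cdiff_at g z -> cdiff_at (fun w => f w - g w) z.
Proof. by move=> fz gz; apply: cdiff_atD => //; exact: cdiff_atN. Qed.
Lemma cdiff_atV f z : cdiff_at f z -> f z != 0 -> cdiff_at (fun w => (f w)^-1) z.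
Proof. by move=> [l fl] fz; eexists; exact: (cdiff_comp fl (cdiffV fz)). Qed.
Lemma cdiff_at_continuous f z : cdiff_at f z -> {for z, continuous f}.
Proof. by move=> [l]; exact: cdiff_continuous. Qed.

End complex_plane.

(** * Goursat's theorem on rectangles *)

Section segment_integrals.
Variable R : realType.
Local Notation mu := (@lebesgue_measure R).
Local Notation integ a b f := (mu.-integrable `[a, b] (EFin \o f)).
Local Notation rint a b f := (\int[mu]_(x in `[a, b]) f x).
Implicit Types (a b c : R) (f g : R -> R).

Lemma within_continuous_integrable a b f :
  {within `[a, b], continuous f} -> integ a b f.
Proof.
by move=> cf; apply: continuous_compact_integrable => //; exact: segment_compact.
Qed.

Lemma pointwise_continuous_within a b f :
  (forall x, a <= x <= b -> {for x, continuous f}) ->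
  {within `[a, b], continuous f}.
Proof.
move=> cf; apply: continuous_in_subspaceT => x.
by rewrite inE /= in_itv /=; exact: cf.
Qed.

Lemma pointwise_continuous_integrable a b f :
  (forall x, a <= x <= b -> {for x, continuous f}) -> integ a b f.
Proof. by move=> cf; apply: within_continuous_integrable; exact: pointwise_continuous_within. Qed.

Lemma integrable_subitv a b c d f : a <= c -> d <= b -> integ a b f -> integ c d f.
Proof.
move=> ac db; apply: integrableS => //; apply: subset_itv; rewrite bnd_simp//.
Qed.

Lemma integD a b f g : integ a b f -> integ a b g -> integ a b (fun x => f x + g x).
Proof.
move=> If Ig; rewrite (_ : EFin \o _ = ((EFin \o f) \+ (EFin \o g))%E)//.
exact: integrableD.
Qed.

Lemma integB a b f g : integ a b f -> integ a b g -> integ a b (fun x => f x - g x).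
Proof.
move=> If Ig; rewrite (_ : EFin \o _ = ((EFin \o f) \- (EFin \o g))%E)//.
exact: integrableB.
Qed.

Lemma integZ a b f (k : R) : integ a b f -> integ a b (fun x => k * f x).
Proof.
move=> If; rewrite (_ : EFin \o _ = (fun x => k%:E * (EFin \o f) x)%E)//.
exact: integrableZl.
Qed.

Lemma integ_norm a b f : integ a b f -> integ a b (fun x => `|f x|).
Proof.
move=> If; rewrite (_ : EFin \o _ = (abse \o (EFin \o f))%E)//.
exact: integrable_abse.
Qed.

Lemma fine_mu_itv a b : a <= b -> fine (mu `[a, b]) = b - a.
Proof.
move=> ab; rewrite lebesgue_measure_itv/= lte_fin; case: ltP => //.
by move=> ba; rewrite (le_anti (_ : a <= b <= a)) ?ab// subrr.
Qed.

Lemma rint_cst a b (k : R) : a <= b -> rint a b (fun=> k) = k * (b - a).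
Proof. by move=> ab; rewrite Rintegral_cst// fine_mu_itv. Qed.

Lemma rint_chasles a c b f : a <= c -> c <= b -> integ a b f ->
  rint a b f = rint a c f + rint c b f.
Proof.
move=> ac cb If.
have := @Rintegral_itvB _ f (BLeft a) (BRight b) c If; rewrite !bnd_simp => /(_ ac cb) H.
apply/eqP; rewrite -subr_eq0 opprD addrA H.
rewrite Rintegral_itv_obnd_cbnd ?subrr//.
apply: integrableS If => //; apply: subset_itv; rewrite bnd_simp//.
Qed.

Lemma rint_near_cst a b f (k e : R) : a <= b -> integ a b f ->
  (forall x, a <= x <= b -> `|f x - k| <= e) -> `|rint a b f - k * (b - a)| <= e * (b - a).
Proof.
move=> ab If H; rewrite -rint_cst//.
have Ik : integ a b (fun=> k).
  by apply: pointwise_continuous_integrable => x _; exact: cvg_cst.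
have Ie : integ a b (fun=> e).
  by apply: pointwise_continuous_integrable => x _; exact: cvg_cst.
rewrite -RintegralB//.
apply: le_trans (le_normr_Rintegral _ _) _ => //; first exact: integB.
rewrite -(rint_cst e ab); apply: le_Rintegral => //.
  by apply: integ_norm; apply: integB.
Qed.

Lemma rint_ftc a b (f F : R -> R) : a <= b ->
  {within `[a, b], continuous f} -> {within `[a, b], continuous F} ->
  {in `]a, b[, forall t, derivable F t 1} ->
  {in `]a, b[, forall t, derive1 F t = f t} ->
  rint a b f = F b - F a.
Proof.
rewrite le_eqVlt => /predU1P[->|ab] cf cF dF Ff.
  by rewrite set_itv1 Rintegral_set1 subrr.
have [_ Fa Fb] := (continuous_within_itvP F ab).1 cF.
rewrite /Rintegral (@continuous_FTC2 _ f F)//.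
Qed.

End segment_integrals.

Section goursat.
Variable R : realType.
Local Notation mu := (@lebesgue_measure R).
Local Notation rint a b f := (\int[mu]_(x in `[a, b]) f x).

(** Total differentiability at [(s0, t0)], with partial derivatives [us] and [ut]. Nothing is asked
    of the partial derivatives as functions of the point: the setting is that of Goursat, not of
    Green. *)
Definition diff2 (u : R -> R -> R) (s0 t0 us ut : R) := forall e : R, 0 < e ->
  exists2 d : R, 0 < d & forall s t, `|s - s0| < d -> `|t - t0| < d ->
    `|u s t - (u s0 t0 + us * (s - s0) + ut * (t - t0))| <= e * (`|s - s0| + `|t - t0|).

Lemma diff2_continuous u s0 t0 us ut : diff2 u s0 t0 us ut ->
  forall e : R, 0 < e -> exists2 d : R, 0 < d & forall s t, `|s - s0| < d -> `|t - t0| < d ->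
    `|u s t - u s0 t0| < e.
Proof.
move=> /(_ 1 ltr01)[d d0 H] e e0.
set K := (1 + `|us| + `|ut|) * 2.
have K0 : 0 < K by rewrite mulr_gt0// -addrA ltr_pwDl// addr_ge0.
exists (Num.min d (e / K)); first by rewrite lt_min d0 divr_gt0.
move=> s t; rewrite !lt_min => /andP[sd se] /andP[td te].
have {}H := H _ _ sd td; rewrite mul1r in H.
have -> : u s t - u s0 t0 = (u s t - (u s0 t0 + us * (s - s0) + ut * (t - t0))) +
  (us * (s - s0) + ut * (t - t0)) by ring.
apply: le_lt_trans (ler_normD _ _) _.
apply: le_lt_trans (lerD H (ler_normD _ _)) _; rewrite !normrM.
move: se te; rewrite !ltr_pdivlMr// => se te.
apply: le_lt_trans (_ : (`|s - s0| + `|t - t0|) * (1 + `|us| + `|ut|) < e).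
  rewrite -subr_ge0 (_ : _ - _ = `|s - s0| * `|ut| + `|t - t0| * `|us|); last by ring.
  by rewrite addr_ge0 ?mulr_ge0.
move: se te; rewrite /K => se te.
have : (`|s - s0| + `|t - t0|) * (1 + `|us| + `|ut|) * 2 < e * 2.
  by rewrite (_ : e * 2 = e + e); [rewrite -mulrA mulrDl; exact: ltrD|ring].
by rewrite ltr_pM2r.
Qed.

Lemma diff2_cont1 u s0 t0 us ut : diff2 u s0 t0 us ut -> {for s0, continuous (u^~ t0)}.
Proof.
move=> du; apply/cvgrPdist_lt => e e0.
have [d d0 H] := diff2_continuous du e0.
apply: filterS (nbhsx_ballx s0 d d0) => s sd.
by rewrite distrC; apply: H; rewrite ?subrr ?normr0// distrC.
Qed.

Lemma diff2_cont2 u s0 t0 us ut : diff2 u s0 t0 us ut -> {for t0, continuous (u s0)}.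
Proof.
move=> du; apply/cvgrPdist_lt => e e0.
have [d d0 H] := diff2_continuous du e0.
apply: filterS (nbhsx_ballx t0 d d0) => t td.
by rewrite distrC; apply: H; rewrite ?subrr ?normr0// distrC.
Qed.

Variables (a b : R -> R -> R) (S T ws wt : R).
Hypothesis ws0 : 0 <= ws.
Hypothesis wt0 : 0 <= wt.
Hypothesis diff_ab : forall s t, S <= s <= S + ws -> T <= t <= T + wt ->
  exists as_ at_ bt : R, diff2 a s t as_ at_ /\ diff2 b s t at_ bt.

(** Circulation of the form [a ds + b dt] along the boundary of the rectangle with lower left corner
    [(s, t)] and sides [u], [v]. By [diff_ab] the form is closed: [at_] is both the [t]-derivative
    of [a] and the [s]-derivative of [b]. *)
Let J s t u v :=
  rint s (s + u) (fun x => a x t) - rint s (s + u) (fun x => a x (t + v)) +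
  (rint t (t + v) (b (s + u)) - rint t (t + v) (b s)).

Let Ia s u t : S <= s -> 0 <= u -> s + u <= S + ws -> T <= t <= T + wt ->
  mu.-integrable `[s, s + u] (EFin \o (fun x => a x t)).
Proof.
move=> Ss u0 su tT; apply: pointwise_continuous_integrable => x /andP[sx xu].
have [|as_ [at_ [bt [da _]]]] := @diff_ab x t _ tT.
  by rewrite (le_trans Ss)// (le_trans xu).
exact: diff2_cont1 da.
Qed.

Let Ib t v s : T <= t -> 0 <= v -> t + v <= T + wt -> S <= s <= S + ws ->
  mu.-integrable `[t, t + v] (EFin \o b s).
Proof.
move=> Tt v0 tv sS; apply: pointwise_continuous_integrable => x /andP[tx xv].
have [|as_ [at_ [bt [_ db]]]] := @diff_ab s x sS.
  by rewrite (le_trans Tt)// (le_trans xv).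
exact: diff2_cont2 db.
Qed.

Let J_split s t u v : S <= s -> 0 <= u -> s + (u + u) <= S + ws ->
    T <= t -> 0 <= v -> t + (v + v) <= T + wt ->
  J s t (u + u) (v + v) =
  J s t u v + J (s + u) t u v + (J s (t + v) u v + J (s + u) (t + v) u v).
Proof.
move=> Ss u0 su Tt v0 tv; rewrite /J.
have sS : S <= s <= S + ws by rewrite Ss (le_trans _ su)// lerDl addr_ge0.
have tT : T <= t <= T + wt by rewrite Tt (le_trans _ tv)// lerDl addr_ge0.
have suS : S <= s + (u + u) <= S + ws by rewrite su (le_trans Ss)// lerDl addr_ge0.
have tvT : T <= t + (v + v) <= T + wt by rewrite tv (le_trans Tt)// lerDl addr_ge0.
have ha x : T <= x <= T + wt -> rint s (s + (u + u)) (fun s => a s x) =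
    rint s (s + u) (fun s => a s x) + rint (s + u) (s + (u + u)) (fun s => a s x).
  move=> xT; apply: rint_chasles; rewrite ?lerD2l ?lerDl//.
  by apply: Ia => //; rewrite addr_ge0.
have hb x : S <= x <= S + ws -> rint t (t + (v + v)) (b x) =
    rint t (t + v) (b x) + rint (t + v) (t + (v + v)) (b x).
  move=> xS; apply: rint_chasles; rewrite ?lerD2l ?lerDl//.
  by apply: Ib => //; rewrite addr_ge0.
rewrite !ha// !hb// -!addrA.
ring.
Qed.

(** A closed form with affine coefficients has zero circulation: the horizontal sides give
    [- at_ * v * u], the vertical ones [at_ * u * v]. Only the deviations from the affine parts
    remain, each at most [h]. *)
Let J_bound s t u v s0 t0 as_ at_ bt h : S <= s -> 0 <= u -> s + u <= S + ws ->
    T <= t -> 0 <= v -> t + v <= T + wt ->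
  (forall x y, s <= x <= s + u -> t <= y <= t + v ->
    `|a x y - (a s0 t0 + as_ * (x - s0) + at_ * (y - t0))| <= h /\
    `|b x y - (b s0 t0 + at_ * (x - s0) + bt * (y - t0))| <= h) ->
  `|J s t u v| <= (h + h) * (u + v).
Proof.
move=> Ss u0 su Tt v0 tv H; rewrite /J.
have sS : S <= s <= S + ws by rewrite Ss (le_trans _ su)// lerDl.
have tT : T <= t <= T + wt by rewrite Tt (le_trans _ tv)// lerDl.
have suS : S <= s + u <= S + ws by rewrite su (le_trans Ss)// lerDl.
have tvT : T <= t + v <= T + wt by rewrite tv (le_trans Tt)// lerDl.
have xs : s <= s + u by rewrite lerDl.
have xt : t <= t + v by rewrite lerDl.
have sIl : s <= s <= s + u by rewrite lexx.
have sIr : s <= s + u <= s + u by rewrite lexx andbT.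
have tIl : t <= t <= t + v by rewrite lexx.
have tIr : t <= t + v <= t + v by rewrite lexx andbT.
have Ha : `|rint s (s + u) (fun x => a x t) - rint s (s + u) (fun x => a x (t + v))
    - (- (at_ * v)) * u| <= (h + h) * u.
  have Ia1 := Ia Ss u0 su tT; have Ia2 := Ia Ss u0 su tvT.
  rewrite -RintegralB//.
  have E : u = s + u - s by rewrite addrAC subrr add0r.
  rewrite [in leRHS]E [X in _ - _ * X]E.
  apply: rint_near_cst => //.
    exact: integB.
  move=> x xsu; have [h1 _] := H _ t xsu tIl.
  have [h2 _] := H _ (t + v) xsu tIr.
  rewrite (_ : _ - _ = (a x t - (a s0 t0 + as_ * (x - s0) + at_ * (t - t0))) -
   (a x (t + v) - (a s0 t0 + as_ * (x - s0) + at_ * (t + v - t0)))); last by ring.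
  exact: le_trans (ler_normB _ _) (lerD h1 h2).
have Hb : `|rint t (t + v) (b (s + u)) - rint t (t + v) (b s)
    - (at_ * u) * v| <= (h + h) * v.
  have Ib1 := Ib Tt v0 tv sS; have Ib2 := Ib Tt v0 tv suS.
  rewrite -RintegralB//.
  have E : v = t + v - t by rewrite addrAC subrr add0r.
  rewrite [in leRHS]E [X in _ - _ * X]E.
  apply: rint_near_cst => //.
    exact: integB.
  move=> x xtv; have [_ h1] := H s x sIl xtv.
  have [_ h2] := H (s + u) x sIr xtv.
  rewrite (_ : _ - _ = (b (s + u) x - (b s0 t0 + at_ * (s + u - s0) + bt * (x - t0))) -
   (b s x - (b s0 t0 + at_ * (s - s0) + bt * (x - t0)))); last by ring.
  exact: le_trans (ler_normB _ _) (lerD h2 h1).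
rewrite mulrDr.
apply: le_trans (lerD Ha Hb); apply: le_trans (ler_normD _ _); rewrite le_eqVlt; apply/orP; left.
by apply/eqP; congr `|_|; ring.
Qed.

(** Bisection: one of the four quarters carries at least a quarter of the circulation. Near the
    common point of the nested rectangles, differentiability bounds the circulation by a multiple of
    [e] times the square of the side, and this square compensates the factor [4 ^+ n]. *)
Lemma goursat_rectangle : J S T ws wt = 0.
Proof.
pose W n := ws / 2 ^+ n; pose V n := wt / 2 ^+ n.
have WS n : W n = W n.+1 + W n.+1.
  by rewrite /W exprS invfM; field; rewrite expf_neq0.
have VS n : V n = V n.+1 + V n.+1.
  by rewrite /V exprS invfM; field; rewrite expf_neq0.
have W0 n : 0 <= W n by rewrite divr_ge0 ?exprn_ge0.
have V0 n : 0 <= V n by rewrite divr_ge0 ?exprn_ge0.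
pose ok n (p : R * R) := [/\ S <= p.1, p.1 + W n <= S + ws, T <= p.2 & p.2 + V n <= T + wt].
pose sub n (p q : R * R) := [/\ p.1 <= q.1, q.1 + W n.+1 <= p.1 + W n,
   p.2 <= q.2, q.2 + V n.+1 <= p.2 + V n &
   `|J p.1 p.2 (W n) (V n)| <= 4 * `|J q.1 q.2 (W n.+1) (V n.+1)| ].
have step n p : ok n p -> exists q, sub n p q.
  move=> [k1x k2x k3x k4x]; rewrite /sub; apply: contrapT => Hn.
  have Hq q : p.1 <= q.1 -> q.1 + W n.+1 <= p.1 + W n -> p.2 <= q.2 ->
      q.2 + V n.+1 <= p.2 + V n ->
      4 * `|J q.1 q.2 (W n.+1) (V n.+1)| < `|J p.1 p.2 (W n) (V n)|.
    move=> h1 h2 h3 h4; rewrite ltNge; apply/negP => h5; apply: Hn.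
    by exists q.
  have := WS n; have := VS n; have := W0 n.+1; have := V0 n.+1.
  move: k2x k4x Hq; set w := W n.+1; set v := V n.+1 => k2x k4x Hq v0 w0 EV EW.
  move: Hq k2x k4x; rewrite EV EW => Hq k2x k4x.
  have := J_split k1x w0 k2x k3x v0 k4x => E.
  have k1 := Hq (p.1, p.2); have k2 := Hq (p.1 + w, p.2).
  have k3 := Hq (p.1, p.2 + v); have k4 := Hq (p.1 + w, p.2 + v).
  move: k1 k2 k3 k4 => /=.
  rewrite ?lexx ?lerDl ?lerD2l ?addrA ?lexx ?w0 ?v0 => k1 k2 k3 k4.
  have {}k1 : 4 * `|J p.1 p.2 w v| < `|J p.1 p.2 (w + w) (v + v)|.
    by apply: k1; rewrite // lerDl.
  have {}k2 : 4 * `|J (p.1 + w) p.2 w v| < `|J p.1 p.2 (w + w) (v + v)|.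
    by apply: k2; rewrite // lerDl.
  have {}k3 : 4 * `|J p.1 (p.2 + v) w v| < `|J p.1 p.2 (w + w) (v + v)|.
    by apply: k3; rewrite // lerDl.
  have {}k4 : 4 * `|J (p.1 + w) (p.2 + v) w v| < `|J p.1 p.2 (w + w) (v + v)|.
    by apply: k4.
  have := ler_normD (J p.1 p.2 w v + J (p.1 + w) p.2 w v) (J p.1 (p.2 + v) w v + J (p.1 + w) (p.2 + v) w v).
  have := ler_normD (J p.1 p.2 w v) (J (p.1 + w) p.2 w v).
  have := ler_normD (J p.1 (p.2 + v) w v) (J (p.1 + w) (p.2 + v) w v).
  rewrite -E; move: k1 k2 k3 k4; lra.
(* The default [p] is never taken along the sequence [P], by [step]. *)
pose nxt n p := match pselect (exists q, sub n p q) with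
  | left h => projT1 (cid h) | right _ => p end.
pose P := fix P n := if n is m.+1 then nxt m (P m) else (S, T).
have PS n : ok n (P n) -> sub n (P n) (P n.+1).
  move=> /step h /=; rewrite /nxt; case: pselect => // h'; exact: (projT2 (cid h')).
have okP n : ok n (P n).
  elim: n => [|n IH]; first by rewrite /ok /= /W /V expr0 !divr1.
  have [h1 h2 h3 h4 _] := PS _ IH; case: IH => k1x k2x k3x k4x; split.
  - exact: le_trans k1x h1.
  - exact: le_trans h2 k2x.
  - exact: le_trans k3x h3.
  - exact: le_trans h4 k4x.
have subP n := PS n (okP n).
have JP n : `|J S T ws wt| <= 4 ^+ n * `|J (P n).1 (P n).2 (W n) (V n)|.
  elim: n => [|n IH]; first by rewrite /W /V expr0 !divr1 mul1r.
  have [_ _ _ _ h] := subP n; apply: le_trans IH _.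
  by rewrite exprSr -mulrA ler_wpM2l ?exprn_ge0.
have mono1 m n : (m <= n)%N -> (P m).1 <= (P n).1 /\ (P n).1 + W n <= (P m).1 + W m.
  move=> /subnK <-; elim: (n - m)%N => [|k [IH1 IH2]]; first by rewrite add0n.
  have [h1 h2 _ _ _] := subP (k + m)%N; rewrite addSn.
  by split; [exact: le_trans IH1 h1|exact: le_trans h2 IH2].
have mono2 m n : (m <= n)%N -> (P m).2 <= (P n).2 /\ (P n).2 + V n <= (P m).2 + V m.
  move=> /subnK <-; elim: (n - m)%N => [|k [IH1 IH2]]; first by rewrite add0n.
  have [_ _ h1 h2 _] := subP (k + m)%N; rewrite addSn.
  by split; [exact: le_trans IH1 h1|exact: le_trans h2 IH2].
have cross1 m n : (P m).1 <= (P n).1 + W n.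
  have [mn|nm] := leqP m n.
    by apply: le_trans (mono1 _ _ mn).1 _; rewrite lerDl.
  by apply: le_trans (mono1 _ _ (ltnW nm)).2; rewrite lerDl.
have cross2 m n : (P m).2 <= (P n).2 + V n.
  have [mn|nm] := leqP m n.
    by apply: le_trans (mono2 _ _ mn).1 _; rewrite lerDl.
  by apply: le_trans (mono2 _ _ (ltnW nm)).2; rewrite lerDl.
pose s0 := sup (range (fun n => (P n).1)); pose t0 := sup (range (fun n => (P n).2)).
have s0P n : (P n).1 <= s0 <= (P n).1 + W n.
  apply/andP; split.
    apply: ub_le_sup; last by exists n.
    by exists ((P 0%N).1 + W 0%N) => _ [m _ <-]; exact: cross1.
  apply: ge_sup; first by exists (P 0%N).1; exists 0%N.
  by move=> _ [m _ <-]; exact: cross1.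
have t0P n : (P n).2 <= t0 <= (P n).2 + V n.
  apply/andP; split.
    apply: ub_le_sup; last by exists n.
    by exists ((P 0%N).2 + V 0%N) => _ [m _ <-]; exact: cross2.
  apply: ge_sup; first by exists (P 0%N).2; exists 0%N.
  by move=> _ [m _ <-]; exact: cross2.
have s0S : S <= s0 <= S + ws by have := s0P 0%N; rewrite /= /W expr0 divr1.
have t0T : T <= t0 <= T + wt by have := t0P 0%N; rewrite /= /V expr0 divr1.
have [as_ [at_ [bt [da db]]]] := diff_ab s0S t0T.
suff Hle e : 0 < e -> `|J S T ws wt| <= e * (2 * (ws + wt) ^+ 2 + 1).
  apply/normr0_eq0/le_anti; rewrite normr_ge0 andbT leNgt; apply/negP => J0.
  have K0 : 0 < 2 * (ws + wt) ^+ 2 + 1 by rewrite ltr_wpDl// mulr_ge0// sqr_ge0.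
  have := Hle (`|J S T ws wt| / 2 / (2 * (ws + wt) ^+ 2 + 1)).
  rewrite !divr_gt0// => /(_ isT); rewrite mulfVK ?gt_eqF//.
  by rewrite leNgt ltr_pdivrMr// ltr_pMr// ltr1n.
move=> e0; have [d d0 dA] := da _ e0; have [d' d'0 dB] := db _ e0.
have [n Hn] : exists n, (ws + wt) / 2 ^+ n < Num.min d d'.
  set m := Num.min d d'; have m0 : 0 < m by rewrite lt_min d0.
  exists (Num.trunc ((ws + wt) / m)).+1.
  rewrite ltr_pdivrMr ?exprn_gt0// -ltr_pdivrMl// mulrC.
  apply: lt_le_trans (truncnS_gt _) _.
  by rewrite -natrX ler_nat ltnW// ltn_expl.
apply: le_trans (JP n) _.
have sW : W n + V n = (ws + wt) / 2 ^+ n by rewrite /W /V -mulrDl.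
have := okP n; have := s0P n; have := t0P n; have := W0 n; have := V0 n.
move: (P n) sW Hn => [s t] /=; set w := W n; set v := V n => sW Hn v0 w0 tP sP [/= k1x k2x k3x k4x].
have Jb : `|J s t w v| <= (e * (w + v) + e * (w + v)) * (w + v).
  apply: (@J_bound s t w v s0 t0 as_ at_ bt) => // x y xs yt.
  have xs0 : `|x - s0| <= w by move: xs sP; rewrite ler_norml; lra.
  have yt0 : `|y - t0| <= v by move: yt tP; rewrite ler_norml; lra.
  have xd : `|x - s0| < Num.min d d'.
    by apply: le_lt_trans xs0 (le_lt_trans _ Hn); rewrite -sW lerDl.
  have yd : `|y - t0| < Num.min d d'.
    by apply: le_lt_trans yt0 (le_lt_trans _ Hn); rewrite -sW lerDr.
  move: xd yd; rewrite !lt_min => /andP[x1 x2] /andP[y1 y2].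
  have L : e * (`|x - s0| + `|y - t0|) <= e * (w + v).
    by apply: ler_wpM2l; [exact: ltW|exact: lerD].
  split; first exact: le_trans (dA _ _ x1 y1) L.
  exact: le_trans (dB _ _ x2 y2) L.
apply: le_trans (ler_wpM2l _ Jb) _; first by rewrite exprn_ge0.
rewrite sW; have -> : 4 ^+ n = 2 ^+ n * 2 ^+ n :> R by rewrite -exprMn; congr (_ ^+ _); ring.
have n0 : 2 ^+ n != 0 :> R by rewrite expf_neq0.
have -> : 2 ^+ n * 2 ^+ n * ((e * ((ws + wt) / 2 ^+ n) + e * ((ws + wt) / 2 ^+ n)) * ((ws + wt) / 2 ^+ n)) = e * (2 * (ws + wt) ^+ 2).
  by move: (2 ^+ n) n0 => k k0; field.
by rewrite ler_wpM2l ?ltW// ltrDl.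
Qed.

End goursat.

(** * The mean value property on circles about 0 *)

Section mean_value.
Variable R : realType.
Local Notation C := (cplx R).
Local Notation mu := (@lebesgue_measure R).
Local Notation mod := (@modulus R).
Local Notation rint a b f := (\int[mu]_(x in `[a, b]) f x).

Lemma derive_expand (f : R -> R) (x l : R) : is_derive x 1 f l ->
  forall e : R, 0 < e -> exists2 d : R, 0 < d &
    forall y, `|y - x| < d -> `|f y - f x - l * (y - x)| <= e * `|y - x|.
Proof.
move=> [df fl] e e0.
have : (h^-1 *: (f (h + x) - f x)) @[h --> 0^'] --> l.
  have := df; rewrite -fl /derivable /derive => H.
  rewrite (_ : (fun h : R => _) = (fun h : R => h^-1 *: ((f \o shift x) (h *: 1) - f x))) //.
  by apply/funext => h /=; rewrite [h%:A]mulr1.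
move=> /cvgrPdist_lt /(_ _ e0) /nbhs_ballP[d /= d0 H]; exists d => // y yd.
have [->|yx] := eqVneq y x; first by rewrite !subrr mulr0 subrr normr0 mulr0.
have yx0 : y - x != 0 by rewrite subr_eq0.
have := H (y - x); rewrite /ball /= sub0r normrN => /(_ yd yx0).
rewrite subrK => {}H.
have -> : f y - f x - l * (y - x) = - ((l - (y - x)^-1 *: (f y - f x)) * (y - x)).
  by rewrite mulrBl [_ *: _]mulrC mulfVK// opprB.
by rewrite normrN normrM ler_wpM2r// ltW.
Qed.

(** [polar (expR x) y] is the complex exponential of [x + i y]; this is its first-order expansion at
    0, assembled from those of [expR], [cos] and [sin]. *)
Lemma polar_exp_expand (e : R) : 0 < e -> exists2 d : R, 0 < d &
  forall x y, `|x| < d -> `|y| < d ->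
    mod (polar (expR x) y - 1 - Complex x y) <= e * (`|x| + `|y|).
Proof.
move=> e0; have e80 : 0 < e / 8 by rewrite divr_gt0.
have [d1 d10 E] := derive_expand (is_derive_expR 0) e80.
have [d2 d20 Cc] := derive_expand (is_derive_cos 0) e80.
have [d3 d30 Ss] := derive_expand (is_derive_sin 0) e80.
have [d4 d40 E1] := derive_expand (is_derive_expR 0) (ltr01 : 0 < 1 :> R).
exists (Num.min (Num.min (Num.min d1 d2) (Num.min d3 d4)) (Num.min (1 / 2) (e / 8))).
  by rewrite !lt_min d10 d20 d30 d40 e80 divr_gt0.
move=> x y; rewrite !lt_min => /andP[/andP[/andP[x1 x2] /andP[x3 x4]] /andP[x5 x6]].
move=> /andP[/andP[/andP[y1 y2] /andP[y3 y4]] /andP[y5 y6]].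
move: (E x) (Cc y) (Ss y) (E1 x); rewrite !subr0 expR0 sin0 cos0 oppr0 !mul0r ?subr0 ?addr0 !mul1r.
move=> /(_ x1) {}E /(_ y2) {}Cc /(_ y3) {}Ss /(_ x4) {}E1.
have xx : `|expR x - 1| <= 2 * `|x|.
  rewrite (_ : expR x - 1 = (expR x - 1 - x) + x); last by ring.
  by apply: le_trans (ler_normD _ _) _; rewrite mulr2n mulrDl mul1r lerD2r.
have ex : `|expR x| <= 2.
  rewrite (_ : expR x = (expR x - 1) + 1); last by ring.
  apply: le_trans (ler_normD _ _) _; rewrite normr1.
  by move: xx x5; lra.
apply: le_trans (modulus_le _) _; rewrite /polar !ReD !ImD !ReN !ImN /=.
rewrite (_ : expR x * cos y - 1 - x = (expR x - 1 - x) + expR x * (cos y - 1)); last by ring.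
rewrite (_ : expR x * sin y - 0 - y = expR x * (sin y - y) + (expR x - 1) * y); last by ring.
apply: le_trans (lerD (ler_normD _ _) (ler_normD _ _)) _; rewrite !normrM.
have h1 : `|expR x| * `|cos y - 1| <= 2 * (e / 8 * `|y|) by rewrite ler_pM.
have h2 : `|expR x| * `|sin y - y| <= 2 * (e / 8 * `|y|) by rewrite ler_pM.
have h3 : `|expR x - 1| * `|y| <= 2 * `|x| * (e / 8) by rewrite ler_pM// ltW.
apply: le_trans (lerD (lerD E h1) (lerD h2 h3)) _.
have := normr_ge0 x; have := normr_ge0 y; nra.
Qed.

(** In the logarithmic coordinate [s + i t] the form [F dz / z] becomes [F (ds + i dt)], whose
    imaginary part is [Im F ds + Re F dt]. The shared coefficient [at_] is a Cauchy-Riemann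
    equation, and it makes this form closed. *)
Lemma cdiff_polar (F : C -> C) (s0 t0 : R) : cdiff_at F (polar (expR s0) t0) ->
  exists as_ at_ bt : R,
    diff2 (fun s t => complex.Im (F (polar (expR s) t))) s0 t0 as_ at_ /\
    diff2 (fun s t => complex.Re (F (polar (expR s) t))) s0 t0 at_ bt.
Proof.
set z0 := polar _ _ => -[l Fl].
set k := l * z0.
suff H e : 0 < e -> exists2 d : R, 0 < d & forall s t, `|s - s0| < d -> `|t - t0| < d ->
    mod (F (polar (expR s) t) - (F z0 + k * Complex (s - s0) (t - t0))) <= e * (`|s - s0| + `|t - t0|).
  exists (complex.Im k), (complex.Re k), (- complex.Im k); split=> e e0;
    have [d d0 {}H] := H _ e0; exists d => // s t sd td; apply: le_trans (H _ _ sd td).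
    apply: le_trans (norm_Im_le _); rewrite ImD ImN ImD ImM /=.
    by rewrite le_eqVlt; apply/orP; left; apply/eqP; congr `|_|; rewrite /z0; ring.
  apply: le_trans (norm_Re_le _); rewrite ReD ReN ReD ReM /=.
  by rewrite le_eqVlt; apply/orP; left; apply/eqP; congr `|_|; rewrite /z0; ring.
move=> e0.
have z00 : 0 < mod z0 by rewrite modulus_polar ger0_norm ?expR_ge0// expR_gt0.
have L0 : 0 < mod l + 1 by rewrite ltr_wpDl ?modulus_ge0.
have e10 : 0 < e / (4 * mod z0) by rewrite divr_gt0// mulr_gt0.
have e20 : 0 < Num.min 1 (e / (2 * mod z0 * (mod l + 1))).
  by rewrite lt_min ltr01 divr_gt0// !mulr_gt0.
have [d d0 H] := Fl _ e10; have [d' d'0 H'] := polar_exp_expand e20.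
exists (Num.min d' (d / (4 * mod z0))); first by rewrite lt_min d'0 divr_gt0// mulr_gt0.
move=> s t; rewrite !lt_min => /andP[s1 s2] /andP[t1 t2].
set x := s - s0 in s1 s2 *; set y := t - t0 in t1 t2 *.
have zE : polar (expR s) t - z0 = z0 * (polar (expR x) y - 1).
  rewrite mulrBr mulr1 /z0 polarM -expRD /x /y; congr (polar (expR _) _ - _); ring.
have := H' _ _ s1 t1; set q := polar (expR x) y - 1 - Complex x y => qb.
have q1 : mod q <= `|x| + `|y|.
  by apply: le_trans qb _; rewrite ler_piMl ?addr_ge0// ge_min lexx.
have xy : mod (Complex x y) <= `|x| + `|y| := modulus_le _.
have p2 : mod (polar (expR x) y - 1) <= 2 * (`|x| + `|y|).
  rewrite (_ : _ - 1 = q + Complex x y); last by rewrite /q; ring.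
  by apply: le_trans (modulusD _ _) _; rewrite mulr2n mulrDl mul1r lerD.
have zd : mod (polar (expR s) t - z0) < d.
  rewrite zE modulusM; apply: le_lt_trans (ler_wpM2l (ltW z00) p2) _.
  move: s2 t2; rewrite !ltr_pdivlMr ?mulr_gt0//; lra.
have := H _ zd; set Rm := _ - _ - _ => Rb.
have -> : F (polar (expR s) t) - (F z0 + k * Complex x y) = Rm + k * q.
  by rewrite /Rm zE /k /q; ring.
apply: le_trans (modulusD _ _) _.
rewrite (splitr e) mulrDl; apply: lerD.
  apply: le_trans Rb _; rewrite zE modulusM.
  apply: le_trans (ler_wpM2l (ltW e10) (ler_wpM2l (ltW z00) p2)) _.
  rewrite le_eqVlt; apply/orP; left; apply/eqP; field; exact: lt0r_neq0.
rewrite /k !modulusM.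
have : mod q <= e / (2 * mod z0 * (mod l + 1)) * (`|x| + `|y|).
  by apply: le_trans qb _; rewrite ler_wpM2r ?addr_ge0// ge_min lexx orbT.
move=> /(ler_wpM2l (ltW z00)); move=> /(ler_wpM2l (ltW L0)) h.
apply: le_trans (_ : (mod l + 1) * (mod z0 * mod q) <= _).
  by rewrite -mulrA ler_wpM2r ?mulr_ge0 ?modulus_ge0// lerDl.
apply: le_trans h _.
rewrite le_eqVlt; apply/orP; left; apply/eqP; field.
by rewrite !lt0r_neq0.
Qed.

Section exceptional_point.
Variables (F : C -> C) (rho : R) (w : C).
Hypothesis Fd : forall z, mod z < rho -> z != w -> cdiff_at F z.
Hypothesis Fc : forall z, mod z < rho -> {for z, continuous F}.
Let h r t := complex.Re (F (polar r t)).
Let V r := rint (- pi) pi (h r).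

Let h_cont (r : R) (t : R) : `|r| < rho -> {for t, continuous (h r)}.
Proof.
move=> rr; apply: continuous_comp; last exact: continuous_Re.
apply: (@continuous_comp _ _ _ (polar r) F).
  by apply: polar_continuous; [exact: cvg_cst|exact: cvg_id].
by apply: Fc; rewrite modulus_polar.
Qed.

(** Goursat on the rectangle [[ln r1, ln r2] x [- pi, pi]]: the sides [t = - pi] and [t = pi] cancel
    by periodicity, and the other two are the circles of radii [r1] and [r2]. *)
Let V_annulus (r1 r2 : R) : 0 < r1 -> r1 <= r2 -> r2 < rho ->
  ~~ (r1 <= mod w <= r2) -> V r1 = V r2.
Proof.
move=> r10 r12 r2rho wr.
have r20 : 0 < r2 := lt_le_trans r10 r12.
have ln12 : ln r1 <= ln r2 by rewrite ler_ln.
have ws0 : 0 <= ln r2 - ln r1 by rewrite subr_ge0.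
have wt0 : 0 <= 2 * pi :> R by rewrite mulr_ge0// pi_ge0.
have := @goursat_rectangle R (fun s t => complex.Im (F (polar (expR s) t)))
  (fun s t => complex.Re (F (polar (expR s) t))) (ln r1) (- pi) (ln r2 - ln r1) (2 * pi) ws0 wt0.
rewrite subrKC (_ : - pi + 2 * pi = pi :> R); last by ring.
have -> : (fun x => complex.Im (F (polar (expR x) pi))) = (fun x => complex.Im (F (polar (expR x) (- pi)))).
  by apply/funext => x; rewrite -(polarD2pi _ (- pi)); congr (complex.Im (F (polar _ _))); ring.
rewrite subrr add0r !lnK// => H; apply/esym/eqP; rewrite -subr_eq0; apply/eqP; apply: H.
move=> s t /andP[s1 s2] _; apply: cdiff_polar.
have e1 : r1 <= expR s by rewrite -(lnK r10) ler_expR.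
have e2 : expR s <= r2 by rewrite -(lnK r20) ler_expR.
apply: Fd; first by rewrite modulus_polar ger0_norm ?expR_ge0// (le_lt_trans e2).
apply/negP => /eqP zw; move: wr; rewrite -zw modulus_polar ger0_norm ?expR_ge0//.
by rewrite e1 e2.
Qed.

Let V_continuous (r0 e : R) : 0 <= r0 -> r0 < rho -> 0 < e ->
  exists2 d : R, 0 < d & forall r, `|r - r0| < d -> 0 <= r < rho -> `|V r - V r0| <= e.
Proof.
move=> r00 r0rho e0.
have pi0 : 0 < 2 * pi :> R by rewrite mulr_gt0// pi_gt0.
have e10 : 0 < e / (2 * pi) by rewrite divr_gt0.
have e20 : 0 < e / (2 * pi) / 2 by rewrite divr_gt0.
have [+ _] := @compact_near_coveringP _ `[(- pi : R), pi]%classic.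
move=> /(_ (@segment_compact _ (- pi) pi) R (nbhs r0) (fun r t => `|h r t - h r0 t| < e / (2 * pi)) _).
case=> [t0 _|d /= d0 H].
  have r0r : `|r0| < rho by rewrite ger0_norm.
  have c1 : {for (t0, r0), continuous (fun p : R * R => h p.2 p.1 - h r0 p.1)}.
    apply: continuousB; last first.
      by apply: (@continuous_comp _ _ _ fst (h r0)); [exact: cvg_fst|exact: h_cont].
    apply: continuous_comp; last exact: continuous_Re.
    apply: (@continuous_comp _ _ _ (fun p : R * R => polar p.2 p.1) F).
      by apply: polar_continuous; [exact: cvg_snd|exact: cvg_fst].
    by apply: Fc; rewrite modulus_polar.
  have := c1 => /cvgrPdist_lt /(_ _ e10); apply: filterS => -[t r] /=.
  by rewrite subrr sub0r normrN.
exists d => // r rd rrho.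
have rr : `|r| < rho by case/andP: rrho => r0' r1; rewrite ger0_norm.
have r0r : `|r0| < rho by rewrite ger0_norm.
have pp : - pi <= pi :> R by rewrite (le_trans _ (pi_ge0 R))// oppr_le0 pi_ge0.
have I1 : mu.-integrable `[- pi, pi] (EFin \o h r).
  by apply: pointwise_continuous_integrable => x _; exact: h_cont.
have I2 : mu.-integrable `[- pi, pi] (EFin \o h r0).
  by apply: pointwise_continuous_integrable => x _; exact: h_cont.
rewrite /V -RintegralB//.
have := @rint_near_cst R (- pi) pi (fun t => h r t - h r0 t) 0 (e / (2 * pi)) pp (integB I1 I2).
rewrite mul0r subr0 opprK (_ : pi + pi = 2 * pi :> R); last by ring.
rewrite mulfVK ?gt_eqF//; apply=> x xpi; rewrite subr0 ltW//.
by apply: H => //; rewrite /ball /= distrC.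
Qed.

Let V0 : V 0 = 2 * pi * complex.Re (F 0).
Proof.
rewrite /V /h; under eq_Rintegral do rewrite polar0.
have pp : - pi <= pi :> R by rewrite (le_trans _ (pi_ge0 R))// oppr_le0 pi_ge0.
by rewrite rint_cst//; ring.
Qed.

(** [V] is constant on the radii below [mod w] and on those above it. Continuity of [V] carries the
    value across [mod w] and down to the radius 0, so that [F] need only be continuous at [w]. *)
Lemma mean_value_Re (r : R) : 0 < r -> r < rho ->
  rint (- pi) pi (fun t => complex.Re (F (polar r t))) = 2 * pi * complex.Re (F 0).
Proof.
move=> r0 rrho; rewrite -V0 -/(V r).
have rho0 := lt_trans r0 rrho.
(* Radii tending to [a] suffice, by continuity of [V]; this is used at [0] and from either side at
   [mod w]. *)
have limit a b : 0 <= a -> a < rho ->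
    (forall d, 0 < d -> exists2 r', `|r' - a| < d & 0 <= r' < rho /\ V r' = b) -> V a = b.
  move=> a0 arho H; apply/eqP; rewrite -subr_eq0 -normr_le0; apply/ler_addgt0Pl => e e0.
  rewrite addr0; have [d d0 He] := V_continuous a0 arho e0.
  have [r' r'a [r'rho <-]] := H _ d0; rewrite distrC; exact: He.
have below r1 : 0 < r1 -> r1 < rho -> (mod w = 0 \/ r1 < mod w) -> V r1 = V 0.
  move=> r10 r1rho wr; apply/esym/limit => // d d0.
  exists (Num.min r1 (d / 2)).
    rewrite subr0 ger0_norm; last by rewrite le_min ltW//= ltW// divr_gt0.
    by rewrite gt_min; apply/orP; right; rewrite ltr_pdivrMr// ltr_pMr// ltr1n.
  have m0 : 0 < Num.min r1 (d / 2) by rewrite lt_min r10 divr_gt0.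
  have m1 : Num.min r1 (d / 2) <= r1 by rewrite ge_min lexx.
  split; first by rewrite ltW//= (le_lt_trans m1).
  apply: V_annulus => //; apply/negP => /andP[w1 w2].
  by case: wr => [w0|]; [move: w1; rewrite w0 leNgt m0|rewrite ltNge w2].
have [w0|w0] := eqVneq (mod w) 0; first by apply: below => //; left.
have wp : 0 < mod w by rewrite lt_def w0 modulus_ge0.
have at_w : mod w < rho -> V (mod w) = V 0.
  move=> wrho; apply: limit => // [|d d0]; first exact: modulus_ge0.
  pose q := mod w - Num.min (mod w) d / 2.
  have m0 : 0 < Num.min (mod w) d by rewrite lt_min wp.
  have m1 : Num.min (mod w) d <= mod w by rewrite ge_min lexx.
  have m2 : Num.min (mod w) d <= d by rewrite ge_min lexx orbT.
  have q0 : 0 < q by rewrite /q; lra.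
  have qw : q < mod w by rewrite /q; lra.
  exists q; first by rewrite /q addrAC subrr sub0r normrN ger0_norm; lra.
  have qr := lt_trans qw wrho.
  by split; [rewrite ltW|apply: below => //; right].
have [rw|rw|rw] := ltgtP r (mod w).
- by apply: below => //; right.
- have wrho := lt_trans rw rrho.
  rewrite -at_w//; apply/esym/limit => // [|d d0]; first exact: modulus_ge0.
  pose q := mod w + Num.min (r - mod w) d / 2.
  have s0 : 0 < r - mod w by rewrite subr_gt0.
  have m0 : 0 < Num.min (r - mod w) d by rewrite lt_min s0.
  have m1 : Num.min (r - mod w) d <= r - mod w by rewrite ge_min lexx.
  have m2 : Num.min (r - mod w) d <= d by rewrite ge_min lexx orbT.
  have qw : mod w < q by rewrite /q; lra.
  have qr : q <= r by rewrite /q; lra.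
  exists q; first by rewrite /q addrAC subrr add0r ger0_norm; lra.
  split; first by rewrite (le_lt_trans qr)// andbT ltW// (lt_trans wp).
  apply: V_annulus => //; first exact: lt_trans qw.
  by apply/negP => /andP[]; rewrite leNgt qw.
- by move: rrho; rewrite rw; exact: at_w.
Qed.

End exceptional_point.
End mean_value.

(** * Cauchy's estimate and the Poisson formula *)

Section circle_integrals.
Variable R : realType.
Local Notation C := (cplx R).
Local Notation mu := (@lebesgue_measure R).
Local Notation mod := (@modulus R).
Local Notation I f := (\int[mu]_(x in `[- pi, pi]) f x).
Implicit Types (h k : R -> C) (c w z : C).

Lemma oppi_lepi : - pi <= pi :> R.
Proof. by rewrite (le_trans _ (pi_ge0 R))// oppr_le0 pi_ge0. Qed.

Lemma subpi : pi - - pi = 2 * pi :> R.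
Proof. by rewrite opprK; ring. Qed.

Lemma pi2_gt0 : 0 < 2 * pi :> R.
Proof. by rewrite mulr_gt0// pi_gt0. Qed.

Definition cint h : C := Complex (I (fun t => complex.Re (h t))) (I (fun t => complex.Im (h t))).

Definition circ_cont h := forall t, - pi <= t <= pi -> {for t, continuous h}.

Lemma circ_integ (f : R -> R) : (forall t, - pi <= t <= pi -> {for t, continuous f}) ->
  mu.-integrable `[- pi, pi] (EFin \o f).
Proof. exact: pointwise_continuous_integrable. Qed.

Lemma circ_integ_Re h : circ_cont h -> mu.-integrable `[- pi, pi] (EFin \o (fun t => complex.Re (h t))).
Proof.
move=> ch; apply: circ_integ => t tpi.
by apply: continuous_comp; [exact: ch|exact: continuous_Re].
Qed.

Lemma circ_integ_Im h : circ_cont h -> mu.-integrable `[- pi, pi] (EFin \o (fun t => complex.Im (h t))).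
Proof.
move=> ch; apply: circ_integ => t tpi.
by apply: continuous_comp; [exact: ch|exact: continuous_Im].
Qed.

Lemma circ_integ_mod h : circ_cont h -> mu.-integrable `[- pi, pi] (EFin \o (fun t => mod (h t))).
Proof.
move=> ch; apply: circ_integ => t tpi.
by apply: continuous_comp; [exact: ch|exact: continuous_modulus].
Qed.

Lemma circ_contM h k : circ_cont h -> circ_cont k -> circ_cont (fun t => h t * k t).
Proof. by move=> ch ck t tpi; apply: continuousM; [exact: ch|exact: ck]. Qed.

Lemma circ_contD h k : circ_cont h -> circ_cont k -> circ_cont (fun t => h t + k t).
Proof. by move=> ch ck t tpi; apply: continuousD; [exact: ch|exact: ck]. Qed.

Lemma circ_cont_cst c : circ_cont (fun=> c).
Proof. by move=> t _; exact: cvg_cst. Qed.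

Lemma circ_contZ c h : circ_cont h -> circ_cont (fun t => c * h t).
Proof. by move=> ch; exact: (@circ_contM (fun=> c) h (@circ_cont_cst c) ch). Qed.

Lemma circ_cont_polar (f : C -> C) (r : R) :
  (forall t, {for polar r t, continuous f}) -> circ_cont (fun t => f (polar r t)).
Proof.
move=> cf t _; apply: (@continuous_comp _ _ _ (polar r) f); last exact: cf.
by apply: polar_continuous; [exact: cvg_cst|exact: cvg_id].
Qed.

Lemma cint_cst c : cint (fun=> c) = cr (2 * pi) * c.
Proof.
apply: cplx_ext; rewrite ?ReM ?ImM /= rint_cst ?oppi_lepi// subpi; ring.
Qed.

Lemma cintD h k : circ_cont h -> circ_cont k -> cint (fun t => h t + k t) = cint h + cint k.
Proof.
move=> ch ck; apply: cplx_ext; rewrite ?ReD ?ImD /= -RintegralD//.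
- by apply: eq_Rintegral => t _; rewrite ReD.
- exact: circ_integ_Re.
- exact: circ_integ_Re.
- by apply: eq_Rintegral => t _; rewrite ImD.
- exact: circ_integ_Im.
- exact: circ_integ_Im.
Qed.

Lemma cintM c h : circ_cont h -> cint (fun t => c * h t) = c * cint h.
Proof.
move=> ch; have IR := circ_integ_Re ch; have II := circ_integ_Im ch.
apply: cplx_ext; rewrite ?ReM ?ImM /= -!RintegralZl//.
  rewrite -RintegralB//; [|exact: integZ|exact: integZ].
  by apply: eq_Rintegral => t _; rewrite ReM.
rewrite -RintegralD//; [|exact: integZ|exact: integZ].
by apply: eq_Rintegral => t _; rewrite ImM.
Qed.

Lemma eq_cint h k : (forall t, - pi <= t <= pi -> h t = k t) -> cint h = cint k.
Proof.
move=> hk; rewrite /cint; congr Complex; apply: eq_Rintegral => t;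
  by rewrite inE /= in_itv /= => /hk ->.
Qed.

Lemma cint_conj h : circ_cont h -> cint (fun t => cj (h t)) = cj (cint h).
Proof.
move=> ch; apply: cplx_ext => /=.
  by apply: eq_Rintegral => t _; case: (h t).
rewrite -mulN1r -RintegralZl//; last exact: circ_integ_Im.
by apply: eq_Rintegral => t _; case: (h t) => a b /=; rewrite mulN1r.
Qed.

Lemma modulus_cint h : circ_cont h -> mod (cint h) <= I (fun t => mod (h t)).
Proof.
move=> ch; have [u u1 <-] := unimodular_Re (cint h).
have ck := @circ_contZ u h ch.
rewrite -(cintM u ch).
rewrite (_ : complex.Re (cint _) = I (fun t => complex.Re (u * h t))); last by [].
have I1 := circ_integ_Re ck.
have I2 := circ_integ_mod ch.
apply: le_Rintegral; [by []|exact: I1|exact: I2|].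
by move=> t _; apply: le_trans (Re_le_modulus _) _; rewrite modulusM u1 mul1r.
Qed.

Lemma modulus_cint_le h (B : R) : circ_cont h ->
  (forall t, - pi <= t <= pi -> mod (h t) <= B) -> mod (cint h) <= 2 * pi * B.
Proof.
move=> ch hB; apply: le_trans (modulus_cint ch) _.
rewrite mulrC -subpi -rint_cst ?oppi_lepi//; apply: le_Rintegral => //.
- exact: circ_integ_mod.
- by apply: circ_integ => t _; exact: cvg_cst.
Qed.

Lemma circ_cont_sum n (H : nat -> R -> C) : (forall i, circ_cont (H i)) ->
  circ_cont (fun t => \sum_(i < n) H i t).
Proof.
move=> cH; elim: n => [|n IH].
  rewrite (_ : (fun t => _) = fun=> 0); first exact: circ_cont_cst.
  by apply/funext => t; rewrite big_ord0.
rewrite (_ : (fun t => _) = fun t => \sum_(i < n) H i t + H n t).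
  exact: (@circ_contD (fun t => \sum_(i < n) H i t) (H n) IH (cH n)).
by apply/funext => t; rewrite big_ord_recr.
Qed.

Lemma cint_sum n (H : nat -> R -> C) : (forall i, circ_cont (H i)) ->
  cint (fun t => \sum_(i < n) H i t) = \sum_(i < n) cint (H i).
Proof.
move=> cH; elim: n => [|n IH].
  rewrite big_ord0 (@eq_cint _ (fun=> 0)) ?cint_cst ?mulr0// => t _.
  by rewrite big_ord0.
rewrite big_ord_recr /= -IH -cintD//; last exact: circ_cont_sum.
by apply: eq_cint => t _; rewrite big_ord_recr.
Qed.

Section mean_value_property.
Variables (F : C -> C) (rho : R) (w : C).
Hypothesis Fd : forall z, mod z < rho -> z != w -> cdiff_at F z.
Hypothesis Fc : forall z, mod z < rho -> {for z, continuous F}.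

Lemma mean_value (r : R) : 0 < r -> r < rho ->
  cint (fun t => F (polar r t)) = cr (2 * pi) * F 0.
Proof.
(* [i] is minus the imaginary unit, so that the real part of [i * F] is the imaginary part of
   [F]. *)
move=> r0 rrho; pose i : C := Complex 0 (-1).
have Fcc : circ_cont (fun t => F (polar r t)).
  by apply: circ_cont_polar => t; apply: Fc; rewrite modulus_polar ger0_norm ?ltW.
apply: cplx_ext.
  by rewrite ReM /= mul0r subr0; apply: (mean_value_Re Fd Fc).
have iFd z : mod z < rho -> z != w -> cdiff_at (fun z => i * F z) z.
  by move=> zr zw; apply: cdiff_atM; [exact: cdiff_at_cst|exact: Fd].
have iFc z : mod z < rho -> {for z, continuous (fun z => i * F z)}.
  move=> zr; apply: continuousM; last exact: Fc.
  exact: (cdiff_at_continuous (cdiff_at_cst i z)).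
have := mean_value_Re iFd iFc r0 rrho.
rewrite ImM /= mul0r addr0 ReM /= mul0r sub0r mulN1r opprK => <-.
by apply: eq_Rintegral => t _; rewrite ReM /= mul0r sub0r mulN1r opprK.
Qed.

End mean_value_property.

(** The difference quotient, extended by the derivative [l] at the base point,
    is the kind of function for which the exceptional point is needed. *)
Definition dquot (Q : C -> C) w (l : C) z := if z == w then l else (Q z - Q w) / (z - w).

Lemma cdiff_at_dquot (Q : C -> C) w l z : z != w -> cdiff_at Q z -> cdiff_at (dquot Q w l) z.
Proof.
move=> zw Qz.
have [m D] : cdiff_at (fun z => (Q z - Q w) / (z - w)) z.
  apply: cdiff_atM; first by apply: cdiff_atB => //; exact: cdiff_at_cst.
  apply: cdiff_atV; last by rewrite subr_eq0.
  by apply: cdiff_atB; [exact: cdiff_at_id|exact: cdiff_at_cst].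
exists m; apply: cdiff_eq D; exists (mod (z - w)); first by rewrite modulus_gt0 subr_eq0.
move=> y; rewrite /dquot; case: eqP => // ->; rewrite modulusB ltxx//.
Qed.

Lemma continuous_dquot (Q : C -> C) w l : cdiff Q w l -> {for w, continuous (dquot Q w l)}.
Proof.
move=> Qw; apply/continuous_modP => e e0.
have e20 : 0 < e / 2 by rewrite divr_gt0.
have [d d0 H] := Qw _ e20.
apply/nbhs_modP; exists d => // z zd; rewrite /dquot eqxx.
case: eqVneq => [_|zw]; first by rewrite subrr modulus0.
have zw0 : z - w != 0 by rewrite subr_eq0.
rewrite (_ : _ - l = (Q z - Q w - l * (z - w)) / (z - w)); last by field.
rewrite modulusM modulusV ltr_pdivrMr ?modulus_gt0//.
apply: le_lt_trans (H _ zd) _.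
by rewrite ltr_pM2r ?modulus_gt0// ltr_pdivrMr// ltr_pMr// ltr1n.
Qed.

(** [l] is the value at the centre of the difference quotient, hence its mean over the circle of
    radius [r], where the quotient is at most [B / r]. *)
Lemma cauchy_estimate (g : C -> C) z l (rho r B : R) : 0 < r -> r < rho ->
  (forall y, mod (y - z) < rho -> cdiff_at g y) -> cdiff g z l ->
  (forall t, mod (g (z + polar r t) - g z) <= B) -> r * mod l <= B.
Proof.
move=> r0 rrho gd gz gB.
pose Q y := g (z + y).
have shift y m : cdiff g (z + y) m -> cdiff Q y m.
  move=> gy e e0; have [d d0 H] := gy _ e0; exists d => // x xd.
  by have := H (z + x); rewrite (_ : z + x - (z + y) = x - y); [exact|ring].
have Q0 : cdiff Q 0 l by apply: shift; rewrite addr0.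
have Qd y : mod y < rho -> cdiff_at Q y.
  move=> yr; have [|m D] := gd (z + y); first by rewrite addrC addKr.
  by exists m; exact: shift.
have Dd y : mod y < rho -> y != 0 -> cdiff_at (dquot Q 0 l) y.
  by move=> yr y0; apply: cdiff_at_dquot => //; exact: Qd.
have Dc y : mod y < rho -> {for y, continuous (dquot Q 0 l)}.
  move=> yr; have [->|y0] := eqVneq y 0; first exact: continuous_dquot.
  exact/cdiff_at_continuous/Dd.
have := mean_value Dd Dc r0 rrho; rewrite {2}/dquot eqxx => /(congr1 mod).
rewrite modulusM modulus_real ger0_norm ?(ltW pi2_gt0)// => E.
rewrite mulrC -ler_pdivlMr// -(ler_pM2l pi2_gt0) -E; apply: modulus_cint_le.
  by apply: circ_cont_polar => t; apply: Dc; rewrite modulus_polar ger0_norm ?ltW.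
move=> t _; rewrite /dquot (negPf (polar_neq0 t r0)) subr0 modulusM modulusV.
rewrite modulus_polar ger0_norm ?(ltW r0)// ler_wpM2r ?invr_ge0 ?(ltW r0)//.
by rewrite /Q addr0.
Qed.

(** The Poisson kernel of the disc of radius [r], without the factor [1 / (2 * pi)]: its integral is
    [2 * pi]. *)
Definition poisson_ker (r : R) w (t : R) : R :=
  (r ^+ 2 - mod w ^+ 2) / mod (polar r t - w) ^+ 2.

Lemma mod_polarB_gt0 (r : R) w t : mod w < r -> 0 < mod (polar r t - w).
Proof.
move=> wr; rewrite modulus_gt0 subr_eq0; apply/eqP => pw; move: wr.
by rewrite -pw modulus_polar real_ltNge ?num_real// ler_norm.
Qed.

Lemma poisson_ker_ge0 (r : R) w t : mod w < r -> 0 <= poisson_ker r w t.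
Proof.
move=> wr; rewrite divr_ge0 ?exprn_ge0 ?modulus_ge0// subr_ge0.
by rewrite ler_pXn2r ?nnegrE ?modulus_ge0 ?(le_trans _ (ltW wr)) ?modulus_ge0// ltW.
Qed.

Lemma poisson_ker_continuous (r : R) w t : mod w < r -> {for t, continuous (poisson_ker r w)}.
Proof.
move=> wr; apply: continuousM; first exact: cvg_cst.
apply: continuousV; first by rewrite expf_neq0// gt_eqF// mod_polarB_gt0.
have c : {for t, continuous (fun t => mod (polar r t - w))}.
  apply: (@continuous_comp _ _ _ (fun t => polar r t - w) mod); last exact: continuous_modulus.
  apply: (@continuous_comp _ _ _ (fun t => polar r t) (fun z => z - w)).
    by apply: polar_continuous; [exact: cvg_cst|exact: cvg_id].
  apply: cdiff_at_continuous; apply: cdiff_atB; [exact: cdiff_at_id|exact: cdiff_at_cst].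
exact: (continuousM c c).
Qed.

Section cauchy_formula.
Variables (rho r : R) (w : C).
Hypothesis r0 : 0 < r.
Hypothesis rrho : r < rho.
Hypothesis wr : mod w < r.

Let polar_ne t : polar r t - w != 0.
Proof.
rewrite subr_eq0; apply/eqP => pw; move: wr; rewrite -pw modulus_polar.
by rewrite ger0_norm ?ltxx// ltW.
Qed.

(* A radius in ]r, rho] up to which the reflected pole r^2 / conj w is avoided. *)
Let rho' := Num.min rho (2 * r ^+ 2 / (r + mod w)).

Let rw0 : 0 < r + mod w.
Proof. by rewrite ltr_pwDl ?modulus_ge0. Qed.

Let rrho' : r < rho'.
Proof.
rewrite lt_min rrho ltr_pdivlMr// expr2 mulr_natl mulr2n mulrDr.
by rewrite ltrD2l ltr_pM2l.
Qed.

(** Up to a constant, the Szego kernel: the Cauchy kernel with its pole [w] reflected in the circle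
    of radius [r], hence holomorphic on a neighborhood of the closed disc. *)
Let S z : C := (cr (r ^+ 2) - cj w * z)^-1.

Let Sden z : mod z < rho' -> cr (r ^+ 2) - cj w * z != 0.
Proof.
rewrite lt_min => /andP[_]; rewrite ltr_pdivlMr// => H.
rewrite subr_eq0; apply/eqP => /(congr1 mod).
rewrite modulusM modulus_conj modulus_real ger0_norm ?exprn_ge0 ?ltW// => E.
move: H wr r0; rewrite mulrDr (mulrC (mod z) (mod w)) -E => H1 H2 H3.
have : mod z * r < r ^+ 2 by move: H1; lra.
rewrite expr2 ltr_pM2r// => zr.
have : mod w * mod z <= mod w * r by rewrite ler_wpM2l ?modulus_ge0// ltW.
have : mod w * r < r * r by rewrite ltr_pM2r.
by rewrite -E expr2; lra.
Qed.

Let Sd z : mod z < rho' -> cdiff_at S z.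
Proof.
move=> zr; apply: cdiff_atV; last exact: Sden.
apply: cdiff_atB; first exact: cdiff_at_cst.
by apply: cdiff_atM; [exact: cdiff_at_cst|exact: cdiff_at_id].
Qed.

Let polar_rho' t : mod (polar r t) < rho'.
Proof. by rewrite modulus_polar ger0_norm// ltW. Qed.

Let kernel_reflect t : polar r t / (polar r t - w) = cj (cr (r ^+ 2) * S (polar r t)).
Proof.
rewrite conjM conj_real conjV conjB conj_real conjM conjK.
have E : polar r t * cj (polar r t) = cr (r ^+ 2).
  by rewrite mul_conj modulus_polar ger0_norm// ltW.
have c0 : cj (polar r t) != 0 :> C.
  by rewrite -modulus_gt0 modulus_conj modulus_polar normr_gt0 gt_eqF.
by rewrite -E -mulrBl invfM mulrACA divff// mulr1.
Qed.

(** On the circle the Cauchy kernel is the conjugate of [r ^+ 2 * S], because [z * cj z = r ^+ 2]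
    there. The latter is holomorphic with value 1 at the centre, so the mean value property
    integrates it. *)
Let cint_kernel : cint (fun t => polar r t / (polar r t - w)) = cr (2 * pi).
Proof.
rewrite (eq_cint (fun t _ => kernel_reflect t)) cint_conj; last first.
  apply: circ_contZ.
  by apply: circ_cont_polar => t; apply/cdiff_at_continuous/Sd.
have SD z : mod z < rho' -> z != 0 -> cdiff_at (fun z => cr (r ^+ 2) * S z) z.
  by move=> zr _; apply: cdiff_atM; [exact: cdiff_at_cst|exact: Sd].
have SC z : mod z < rho' -> {for z, continuous (fun z => cr (r ^+ 2) * S z)}.
  by move=> zr; apply/cdiff_at_continuous/cdiff_atM; [exact: cdiff_at_cst|exact: Sd].
rewrite (mean_value SD SC r0 rrho') /S mulr0 subr0 divff; last first.
  by rewrite -modulus_gt0 modulus_real normr_gt0 gt_eqF// exprn_gt0.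
by rewrite mulr1 conj_real.
Qed.

(** The function [(Q y - Q w) / (y - w) * y], completed at [w], vanishes at 0, so its mean is 0;
    what remains is [Q w] times the integral of the kernel. *)
Lemma cauchy_circle (Q : C -> C) (rho1 : R) : r < rho1 ->
  (forall z, mod z < rho1 -> cdiff_at Q z) ->
  cint (fun t => Q (polar r t) * (polar r t / (polar r t - w))) = cr (2 * pi) * Q w.
Proof.
move=> rrho1 Qd; have [l Ql] := Qd w (lt_trans wr rrho1).
have Dd y : mod y < rho1 -> y != w -> cdiff_at (fun y => dquot Q w l y * y) y.
  move=> yr yw; apply: cdiff_atM; last exact: cdiff_at_id.
  by apply: cdiff_at_dquot => //; exact: Qd.
have Dc y : mod y < rho1 -> {for y, continuous (fun y => dquot Q w l y * y)}.
  move=> yr; apply: continuousM; last exact: (cdiff_at_continuous (cdiff_at_id y)).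
  have [->|y0] := eqVneq y w; first exact: continuous_dquot.
  by apply: cdiff_at_continuous; apply: cdiff_at_dquot => //; exact: Qd.
have := mean_value Dd Dc r0 rrho1; rewrite mulr0 mulr0 => E.
have pr t : mod (polar r t) < rho1 by rewrite modulus_polar ger0_norm// ltW.
have ck : circ_cont (fun t => polar r t / (polar r t - w)).
  apply: (@circ_cont_polar (fun z => z / (z - w))) => t; apply: cdiff_at_continuous.
  apply: cdiff_atM; first exact: cdiff_at_id.
  by apply: cdiff_atV => //; apply: cdiff_atB; [exact: cdiff_at_id|exact: cdiff_at_cst].
rewrite (@eq_cint _ (fun t => dquot Q w l (polar r t) * polar r t + Q w * (polar r t / (polar r t - w)))).
  rewrite cintD; [|exact: (circ_cont_polar (fun t => Dc _ (pr t)))|exact: circ_contZ].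
  by rewrite E add0r cintM// cint_kernel mulrC.
move=> t _; have pw := polar_ne t.
rewrite /dquot ifF; first by field.
by apply/negbTE; rewrite -subr_eq0.
Qed.

(** Cauchy's formula for [H * S]. On the circle [z / (z - w) * S z] equals [mod (z - w) ^- 2], and
    [k * S w = 1] for [k = r ^+ 2 - mod w ^+ 2], so multiplying by [k] turns the Cauchy kernel into
    the Poisson kernel. *)
Lemma poisson_circle (H : C -> C) : (forall z, mod z < rho -> cdiff_at H z) ->
  cint (fun t => cr (poisson_ker r w t) * H (polar r t))
  = cr (2 * pi) * H w.
Proof.
move=> Hd; have HSd z : mod z < rho' -> cdiff_at (fun z => H z * S z) z.
  move=> zr; apply: cdiff_atM; last exact: Sd.
  by apply: Hd; move: zr; rewrite lt_min => /andP[].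
have wrho' : mod w < rho' := lt_trans wr rrho'.
pose k : C := cr (r ^+ 2 - mod w ^+ 2).
have k0 : k != 0.
  by rewrite -modulus_gt0 modulus_real normr_gt0 gt_eqF// subr_gt0 ltr_pXn2r ?nnegrE ?modulus_ge0 ?ltW.
have kS : k * S w = 1.
  rewrite /S (_ : _ - _ = k) ?divff//.
  by rewrite [cj w * w]mulrC mul_conj -crN -crD.
have := cauchy_circle rrho' HSd => /(congr1 (fun x => k * x)).
rewrite -[in LHS]cintM; last first.
  have HH : forall z, mod z < rho' -> z - w != 0 -> cdiff_at (fun z => H z * S z * (z / (z - w))) z.
    move=> z zr zw; apply: cdiff_atM; first exact: HSd.
    apply: cdiff_atM; first exact: cdiff_at_id.
    by apply: cdiff_atV => //; apply: cdiff_atB; [exact: cdiff_at_id|exact: cdiff_at_cst].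
  exact: (circ_cont_polar (fun t => cdiff_at_continuous (HH _ (polar_rho' t) (polar_ne t)))).
rewrite (_ : k * _ = cr (2 * pi) * (H w * (k * S w))); last by ring.
rewrite kS mulr1 => <-; apply: eq_cint => t _.
have E : polar r t / (polar r t - w) * S (polar r t) = cr (mod (polar r t - w) ^- 2).
  rewrite kernel_reflect conjM conj_real.
  have R2 : cr (r ^+ 2) * (S (polar r t) * cj (S (polar r t))) = cr (mod (polar r t - w) ^- 2).
    rewrite mul_conj -crM; congr cr.
    have : mod (polar r t / (polar r t - w)) = r ^+ 2 * mod (S (polar r t)).
      rewrite kernel_reflect modulus_conj modulusM modulus_real ger0_norm//.
      by rewrite exprn_ge0// ltW.
    rewrite modulusM modulusV modulus_polar (ger0_norm (ltW r0)) => E.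
    have E' : mod (S (polar r t)) = (mod (polar r t - w))^-1 / r.
      apply: (mulfI (_ : r ^+ 2 != 0)); first by rewrite expf_neq0// gt_eqF.
      rewrite -E; field; rewrite (gt_eqF r0) ?andbT/= gt_eqF// modulus_gt0//.
    rewrite E' ; field; rewrite (gt_eqF r0) ?andbT/= gt_eqF// modulus_gt0//.
  by rewrite -R2; ring.
rewrite /poisson_ker crM -/k -E; ring.
Qed.

Lemma poisson_le (H : C -> C) : (forall z, mod z < rho -> cdiff_at H z) ->
  2 * pi * mod (H w) <=
  I (fun t => poisson_ker r w t * mod (H (polar r t))).
Proof.
move=> Hd; rewrite -[2 * pi](ger0_norm (ltW pi2_gt0)) -modulus_real -modulusM -poisson_circle//.
apply: le_trans (modulus_cint _) _.
  apply: circ_contM; last first.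
    apply: circ_cont_polar => t; apply/cdiff_at_continuous/Hd.
    by rewrite modulus_polar ger0_norm// ltW.
  move=> t _; apply: continuous_Complex; last exact: cvg_cst.
  exact: poisson_ker_continuous.
rewrite le_eqVlt; apply/orP; left; apply/eqP; apply: eq_Rintegral => t _.
by rewrite modulusM modulus_real ger0_norm// poisson_ker_ge0.
Qed.

End cauchy_formula.

Lemma poisson_kernel_int (r : R) w : 0 < r -> mod w < r ->
  I (poisson_ker r w) = 2 * pi.
Proof.
move=> r0 wr; have rr : r < r + 1 by rewrite ltrDl.
have := @poisson_circle _ _ _ r0 rr wr (fun=> 1) (fun z _ => cdiff_at_cst 1 z).
move=> /(congr1 (@complex.Re R)); rewrite mulr1 /= => <-.
by apply: eq_Rintegral => t _; rewrite mulr1 mul0r subr0.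
Qed.

End circle_integrals.

(** * The sub-Poisson inequality for the square root of the modulus *)

Section subharmonic_root.
Variable R : realType.
Local Notation C := (cplx R).
Local Notation mu := (@lebesgue_measure R).
Local Notation mod := (@modulus R).
Local Notation I f := (\int[mu]_(x in `[- pi, pi]) f x).
Implicit Types (z w a : C) (q : {poly C}).

Lemma continuous_circ_bounded (u : R -> R) :
  (forall t, - pi <= t <= pi -> {for t, continuous u}) ->
  exists B : R, forall t, - pi <= t <= pi -> u t <= B.
Proof.
move=> cu; have [c _ H] := EVT_max (oppi_lepi R) (pointwise_continuous_within cu).
by exists (u c) => t tpi; apply: H; rewrite in_itv.
Qed.

Lemma exists_expr_small (x B e : R) : 0 <= x < 1 -> 0 < e ->
  exists n, B * x ^+ n <= e.
Proof.
move=> /andP[x0 x1] e0.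
have : B * x ^+ n @[n --> \oo] --> B * 0.
  by apply: cvgMr; apply: cvg_expr; rewrite ger0_norm.
rewrite mulr0 => /cvgrPdist_le /(_ _ e0) [n _ H]; exists n.
have := H n (leqnn n); rewrite sub0r normrN; apply: le_trans; exact: ler_norm.
Qed.

(** The Cauchy kernel on a circle of radius [r > 1] is expanded in a geometric series cut after [n]
    terms; the remainder [E] is at most [B * (r / (r - 1)) * r^-1 ^+ n] on the closed unit disc.
    Polynomials are wanted because they factor over their finitely many zeros. *)
Lemma taylor_approx (g : C -> C) (rho e : R) : 1 < rho -> 0 < e ->
  (forall z, mod z < rho -> cdiff_at g z) ->
  exists q, forall z, mod z <= 1 -> mod (g z - q.[z]) <= e.
Proof.
move=> rho1 e0 gd.
have [r r1 rrho] : exists2 r : R, 1 < r & r < rho by exists ((1 + rho) / 2); lra.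
have r0 : 0 < r := lt_trans ltr01 r1.
have pr t : mod (polar r t) = r by rewrite modulus_polar ger0_norm// ltW.
have p0 t : polar r t != 0 := polar_neq0 t r0.
have gc : circ_cont (fun t => g (polar r t)).
  by apply: circ_cont_polar => t; apply/cdiff_at_continuous/gd; rewrite pr.
have ic : circ_cont (fun t => (polar r t)^-1).
  apply: (circ_cont_polar (f := fun z => z^-1)) => t.
  by apply/cdiff_at_continuous/cdiff_atV => //; exact: cdiff_at_id.
have [B HB] : exists B : R, forall t, - pi <= t <= pi -> mod (g (polar r t)) <= B.
  apply: continuous_circ_bounded => t tpi.
  by apply: (@continuous_comp _ _ _ (fun t => g (polar r t)) mod); [exact: gc|exact: continuous_modulus].
have [n Hn] : exists n, B * (r / (r - 1)) * r^-1 ^+ n <= e.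
  by apply: exists_expr_small => //; rewrite invr_ge0 ltW//= invf_lt1.
have kc k : circ_cont (fun t => g (polar r t) * (polar r t)^-1 ^+ k).
  elim: k => [|k IH].
    by rewrite (_ : (fun t => _) = (fun t => g (polar r t)))//; apply/funext => t; rewrite expr0 mulr1.
  rewrite (_ : (fun t => _) = (fun t => (g (polar r t) * (polar r t)^-1 ^+ k) * (polar r t)^-1)).
    exact: (@circ_contM _ (fun t => g (polar r t) * (polar r t)^-1 ^+ k) (fun t => (polar r t)^-1) IH ic).
  by apply/funext => t; rewrite exprSr mulrA.
pose c k := cint (fun t => g (polar r t) * (polar r t)^-1 ^+ k).
pose K : C := cr (2 * pi).
have K0 : K != 0 by rewrite -modulus_gt0 modulus_real normr_gt0 gt_eqF// pi2_gt0.
exists (\poly_(k < n) (K^-1 * c k)) => z z1.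
have zr : mod z < r := le_lt_trans z1 r1.
have zn t : polar r t - z != 0 by rewrite -modulus_gt0 mod_polarB_gt0.
pose E t := g (polar r t) * (z / polar r t) ^+ n * (polar r t / (polar r t - z)).
have Ec : circ_cont E.
  apply: (circ_cont_polar (f := fun y => g y * (z / y) ^+ n * (y / (y - z)))) => t.
  apply: cdiff_at_continuous; apply: cdiff_atM; last first.
    apply: cdiff_atM; first exact: cdiff_at_id.
    by apply: cdiff_atV => //; apply: cdiff_atB; [exact: cdiff_at_id|exact: cdiff_at_cst].
  apply: cdiff_atM; first by apply: gd; rewrite pr.
  have [l1 D1] : cdiff_at (fun y => z / y) (polar r t).
    apply: cdiff_atM; first exact: cdiff_at_cst.
    by apply: cdiff_atV => //; exact: cdiff_at_id.
  have [l2 D2] := cdiffX (z / polar r t) n.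
  by eexists; exact: cdiff_comp D1 D2.
suff H : K * (g z - (\poly_(k < n) (K^-1 * c k)).[z]) = cint E.
  have pi2 := pi2_gt0 R.
  rewrite -(ler_pM2l pi2) -[X in X * mod _ <= _](ger0_norm (ltW pi2)) -modulus_real -modulusM H.
  apply: modulus_cint_le => // t tpi.
  apply: le_trans Hn; rewrite /E !modulusM modulusX modulusM !modulusV pr [leRHS]mulrAC.
  have d0 : 0 < r - 1 by rewrite subr_gt0.
  have d1 : r - 1 <= mod (polar r t - z).
    by apply: le_trans (modulusB_ge _ _); rewrite pr lerD2l lerN2.
  have zr0 : 0 <= mod z / r by rewrite divr_ge0 ?modulus_ge0 ?ltW.
  have b1 : (mod z / r) ^+ n <= r^-1 ^+ n.
    apply: lerXn2r; rewrite ?nnegrE//; first by rewrite invr_ge0 ltW.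
    by rewrite ler_piMl ?invr_ge0 ?(ltW r0).
  have b2 : r / mod (polar r t - z) <= r / (r - 1).
    by rewrite ler_pM2l// lef_pV2 ?posrE// (lt_le_trans d0).
  apply: ler_pM b2; [|by rewrite divr_ge0 ?modulus_ge0 ?ltW|].
    by rewrite mulr_ge0 ?modulus_ge0 ?exprn_ge0.
  by apply: ler_pM (HB t tpi) b1; rewrite ?modulus_ge0 ?exprn_ge0.
have Q := cauchy_circle r0 rrho zr rrho gd.
rewrite mulrBr -Q horner_poly mulr_sumr.
pose H k t := z ^+ k * (g (polar r t) * (polar r t)^-1 ^+ k).
have Hc k : circ_cont (H k) by exact: (@circ_contZ _ (z ^+ k) _ (kc k)).
rewrite (@eq_cint _ _ (fun t => E t + \sum_(k < n) H k t)); last first.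
  move=> t _; rewrite /E /H.
  have -> : \sum_(k < n) z ^+ k * (g (polar r t) * (polar r t)^-1 ^+ k) =
     g (polar r t) * \sum_(k < n) (z / polar r t) ^+ k.
    rewrite mulr_sumr; apply: eq_bigr => k _; rewrite exprMn; ring.
  have x1 : 1 - z / polar r t != 0.
    by rewrite -(divff (p0 t)) -mulrBl mulf_neq0 ?invr_neq0.
  have G : (1 - z / polar r t) * \sum_(k < n) (z / polar r t) ^+ k = 1 - (z / polar r t) ^+ n.
    by rewrite -(opprB _ 1) mulNr -subrX1 opprB.
  have -> : \sum_(k < n) (z / polar r t) ^+ k = (1 - (z / polar r t) ^+ n) / (1 - z / polar r t).
    by rewrite -G [_ * \sum_(k < n) _]mulrC mulfK.
  have -> : polar r t / (polar r t - z) = (1 - z / polar r t)^-1.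
    by field; rewrite p0 zn.
  ring.
rewrite (@cintD _ E (fun t => \sum_(k < n) H k t) Ec (circ_cont_sum Hc)).
rewrite cint_sum// -addrA -[RHS]addr0; congr (_ + _); apply/eqP.
rewrite subr_eq0; apply/eqP; apply: eq_bigr => k _.
by rewrite (cintM (z ^+ k) (kc k)) -/(c k); field.
Qed.

(** The principal square root in closed form; it is used for [Re z > 0] only, where [u > 0]. *)
Definition csqrt z : C :=
  let u := Num.sqrt ((mod z + complex.Re z) / 2) in Complex u (complex.Im z / (2 * u)).

Lemma csqrt_Re_gt0 z : 0 < complex.Re z -> 0 < complex.Re (csqrt z).
Proof. by move=> z0; rewrite sqrtr_gt0 divr_gt0// ltr_wpDl ?modulus_ge0. Qed.

Lemma csqrtK z : 0 < complex.Re z -> csqrt z ^+ 2 = z.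
Proof.
move=> z0; have u0 := csqrt_Re_gt0 z0.
have u2 : complex.Re (csqrt z) ^+ 2 = (mod z + complex.Re z) / 2.
  by rewrite sqr_sqrtr// divr_ge0// addr_ge0 ?modulus_ge0// ltW.
have m2 := modulus2 z; move: u0 u2; rewrite /csqrt /=.
set u := Num.sqrt _ => u0 u2; rewrite expr2; apply: cplx_ext; rewrite ?ReM ?ImM /=.
  have E : u ^+ 2 * (u * u - complex.Im z / (2 * u) * (complex.Im z / (2 * u)))
     = u ^+ 2 * complex.Re z.
    transitivity (u ^+ 2 ^+ 2 - (mod z ^+ 2 - complex.Re z ^+ 2) / 4).
      by rewrite m2; field; rewrite gt_eqF.
    by rewrite u2; field.
  by apply: (mulfI _ E); rewrite expf_neq0// gt_eqF.
by field; rewrite gt_eqF.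
Qed.

Lemma csqrt_continuous z : 0 < complex.Re z -> {for z, continuous csqrt}.
Proof.
move=> z0; have cu : {for z, continuous (fun z => Num.sqrt ((mod z + complex.Re z) / 2))}.
  apply: (@continuous_comp _ _ _ (fun z => (mod z + complex.Re z) / 2) (@Num.sqrt R)); last exact: sqrt_continuous.
  apply: continuousM; last exact: cst_continuous.
  by apply: continuousD; [exact: continuous_modulus|exact: continuous_Re].
apply: continuous_Complex => //; apply: continuousM; first exact: continuous_Im.
apply: continuousV; first by rewrite mulf_neq0// gt_eqF//; exact: csqrt_Re_gt0.
by apply: continuousM => //; exact: cst_continuous.
Qed.

(** Caratheodory's criterion. It suits the square root, whose increment is [w - z] divided by
    [csqrt w + csqrt z]. *)
Lemma cdiff_quot (f phi : C -> C) z :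
  (\forall w \near z, f w - f z = phi w * (w - z)) -> {for z, continuous phi} ->
  cdiff f z (phi z).
Proof.
move=> /nbhs_modP[d d0 fd] /continuous_modP cphi e e0.
have /nbhs_modP[d' d'0 H] := cphi _ e0.
exists (Num.min d d'); first by rewrite lt_min d0.
move=> w; rewrite lt_min => /andP[/fd -> /H {}H].
by rewrite -mulrBl modulusM ler_wpM2r ?modulus_ge0// ltW.
Qed.

Lemma csqrt_cdiff z : 0 < complex.Re z -> cdiff_at csqrt z.
Proof.
move=> z0; have s0 : csqrt z + csqrt z != 0.
  rewrite -modulus_gt0; apply: lt_le_trans (Re_le_modulus _).
  by rewrite ReD addr_gt0// csqrt_Re_gt0.
exists ((csqrt z + csqrt z)^-1); apply: (@cdiff_quot _ (fun w => (csqrt w + csqrt z)^-1)).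
  apply/nbhs_modP; exists (complex.Re z) => // w wz.
  have w0 : 0 < complex.Re w.
    have := le_lt_trans (norm_Re_le _) wz; rewrite ReD ReN ltr_norml; lra.
  have sw : csqrt w + csqrt z != 0.
    rewrite -modulus_gt0; apply: lt_le_trans (Re_le_modulus _).
    by rewrite ReD addr_gt0// csqrt_Re_gt0.
  apply: (mulfI sw); rewrite mulrA divff// mul1r -[in RHS](csqrtK z0) -[in RHS](csqrtK w0).
  ring.
apply: continuousV => //; apply: continuousD; first exact: csqrt_continuous.
exact: (cdiff_at_continuous (cdiff_at_cst _ _)).
Qed.

(** On the unit circle [rootmod a z] is [|z - a|]; inside it is at least that,
    the zeros of the disc having been reflected, and it is the squared modulus
    of the zero-free holomorphic function [rootfun a]. *)
Definition rootmod a z : R := if mod a <= 1 then mod (1 - cj a * z) else mod (z - a).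

Definition rootfun a z : C :=
  if mod a <= 1 then csqrt (1 - cj a * z)
  else cr (Num.sqrt (mod a)) * csqrt (1 - a^-1 * z).

Lemma Re_1sub_gt0 z : mod z < 1 -> 0 < complex.Re (1 - z).
Proof. by move=> z1; rewrite ReD ReN /= subr_gt0 (le_lt_trans (Re_le_modulus _)). Qed.

Lemma modulusM_lt1 a z : mod a <= 1 -> mod z < 1 -> mod (a * z) < 1.
Proof.
by move=> a1; apply: le_lt_trans; rewrite modulusM ler_piMl ?modulus_ge0.
Qed.

Lemma modulusV_le1 a : 1 < mod a -> mod a^-1 <= 1.
Proof. by move=> a1; rewrite modulusV invf_le1 ?ltW// (lt_trans ltr01). Qed.

Lemma rootfun_cdiff a z : mod z < 1 -> cdiff_at (rootfun a) z.
Proof.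
have lin b y : mod (b * y) < 1 -> cdiff_at (fun y => csqrt (1 - b * y)) y.
  move=> /Re_1sub_gt0/csqrt_cdiff [l D].
  have [m D'] : cdiff_at (fun y => 1 - b * y) y.
    apply: cdiff_atB; first exact: cdiff_at_cst.
    by apply: cdiff_atM; [exact: cdiff_at_cst|exact: cdiff_at_id].
  by eexists; exact: cdiff_comp D' D.
move=> z1; rewrite /rootfun; case: leP => a1.
  by apply: lin; apply: modulusM_lt1; rewrite ?modulus_conj.
apply: cdiff_atM; first exact: cdiff_at_cst.
by apply: lin; apply: modulusM_lt1 => //; exact: modulusV_le1.
Qed.

Lemma rootfun_modulus a z : mod z < 1 -> mod (rootfun a z) ^+ 2 = rootmod a z.
Proof.
move=> z1; rewrite /rootfun /rootmod; case: leP => a1.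
  by rewrite -modulusX csqrtK// Re_1sub_gt0// modulusM_lt1 ?modulus_conj.
have a0 : a != 0 by rewrite -modulus_gt0 (lt_trans ltr01).
rewrite modulusM exprMn modulus_real ger0_norm ?sqrtr_ge0// sqr_sqrtr ?modulus_ge0//.
rewrite -modulusX csqrtK; last first.
  by rewrite Re_1sub_gt0// modulusM_lt1// modulusV_le1.
by rewrite -modulusM modulusB mulrBr mulr1 mulrA divff// mul1r.
Qed.

Lemma rootmod_circle a z : mod z = 1 -> rootmod a z = mod (z - a).
Proof.
move=> z1; rewrite /rootmod; case: ifP => // _.
rewrite -[LHS]mul1r -z1 -(modulus_conj z) -modulusM mulrBr mulr1 mulrCA [cj z * z]mulrC mul_conj z1.
by rewrite expr1n mulr1 -conjB modulus_conj.
Qed.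

Lemma rootmod_ge a z : mod z <= 1 -> mod (z - a) <= rootmod a z.
Proof.
move=> z1; rewrite /rootmod; case: ifP => [a1|//].
rewrite -(ler_pXn2r (n:=2)) ?nnegrE ?modulus_ge0//.
rewrite -subr_ge0 (_ : _ - _ = (1 - mod z ^+ 2) * (1 - mod a ^+ 2)).
  by rewrite mulr_ge0// subr_ge0 expr_le1 ?modulus_ge0.
rewrite !modulus2; case: z a {z1 a1} => [x y] [b c].
rewrite !(ReD, ImD, ReN, ImN, ReM, ImM) /=; ring.
Qed.

Lemma rootmod_continuous a z : {for z, continuous (rootmod a)}.
Proof.
rewrite /rootmod; case: (mod a <= 1).
  apply: (@continuous_comp _ _ _ (fun z => 1 - cj a * z) mod); last exact: continuous_modulus.
  apply: cdiff_at_continuous; apply: cdiff_atB; first exact: cdiff_at_cst.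
  by apply: cdiff_atM; [exact: cdiff_at_cst|exact: cdiff_at_id].
apply: (@continuous_comp _ _ _ (fun z => z - a) mod); last exact: continuous_modulus.
by apply: cdiff_at_continuous; apply: cdiff_atB; [exact: cdiff_at_id|exact: cdiff_at_cst].
Qed.

(** Joint continuity and compactness of the interval make [u r] uniformly close to [u r0]; this
    serves to let the radius tend to 1. *)
Lemma continuous_circle_param (u : R -> R -> R) (r0 : R) :
  (forall t, - pi <= t <= pi -> {for (r0, t), continuous (fun p : R * R => u p.1 p.2)}) ->
  (forall t, - pi <= t <= pi -> {for t, continuous (u r0)}) ->
  (\forall r \near r0, mu.-integrable `[- pi, pi] (EFin \o u r)) ->
  forall e : R, 0 < e -> \forall r \near r0, `|I (u r) - I (u r0)| <= e.
Proof.
move=> cu cu0 Iu e e0.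
have e10 : 0 < e / (2 * pi) by rewrite divr_gt0// pi2_gt0.
have [+ _] := @compact_near_coveringP _ `[(- pi : R), pi]%classic.
move=> /(_ (@segment_compact _ (- pi) pi) R (nbhs r0) (fun r t => `|u r t - u r0 t| < e / (2 * pi)) _).
have I2 := circ_integ cu0.
case=> [t0 /=|d /= d0 H].
  rewrite in_itv /= => t0pi.
  have c1 : {for (r0, t0), continuous (fun p : R * R => u p.1 p.2 - u r0 p.2)}.
    apply: continuousB; first exact: cu.
    by apply: (@continuous_comp _ _ _ snd (u r0)); [exact: cvg_snd|exact: cu0].
  have := c1 => /cvgrPdist_lt /(_ _ e10) [[A B] /= [A1 B1] AB].
  exists (B, A) => // -[t r] /= [Bt Ar]; have := AB (r, t) (conj Ar Bt).
  by rewrite /= subrr sub0r normrN.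
near=> r.
have I1 : mu.-integrable `[- pi, pi] (EFin \o u r) by near: r.
rewrite -RintegralB//.
have := @rint_near_cst R (- pi) pi (fun t => u r t - u r0 t) 0 (e / (2 * pi)) (oppi_lepi R) (integB I1 I2).
rewrite mul0r subr0 subpi.
rewrite mulfVK ?gt_eqF ?pi2_gt0//; apply=> x xpi; rewrite subr0 ltW//.
apply: H => //; rewrite /ball /=; near: r; exact: (nbhsx_ballx r0 d d0).
Unshelve. all: by end_near. Qed.

End subharmonic_root.

(** * From products over the zeros to analytic functions *)

Section poisson_majorization.
Variable R : realType.
Local Notation C := (cplx R).
Local Notation mu := (@lebesgue_measure R).
Local Notation mod := (@modulus R).
Local Notation I f := (\int[mu]_(x in `[- pi, pi]) f x).
Implicit Types (z w a : C) (q : {poly C}).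

Lemma mod_polarB_continuous2 (r0 t0 : R) w :
  {for (r0, t0), continuous (fun p : R * R => mod (polar p.1 p.2 - w))}.
Proof.
apply: (@continuous_comp _ _ _ (fun p : R * R => polar p.1 p.2 - w) mod); last exact: continuous_modulus.
apply: (@continuous_comp _ _ _ (fun p : R * R => polar p.1 p.2) (fun z => z - w)).
  by apply: polar_continuous; [exact: cvg_fst|exact: cvg_snd].
by apply: cdiff_at_continuous; apply: cdiff_atB; [exact: cdiff_at_id|exact: cdiff_at_cst].
Qed.

Lemma poisson_ker_continuous2 (r0 t0 : R) w : mod w < r0 ->
  {for (r0, t0), continuous (fun p : R * R => poisson_ker p.1 w p.2)}.
Proof.
move=> wr; have c1 : {for (r0, t0), continuous (fun p : R * R => p.1)} by exact: cvg_fst.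
apply: continuousM.
  apply: continuousB; last exact: cst_continuous.
  exact: (continuousM c1 c1).
apply: continuousV; first by rewrite expf_neq0// gt_eqF// mod_polarB_gt0.
have c := @mod_polarB_continuous2 r0 t0 w.
exact: (continuousM c c).
Qed.

(** Replacing each factor [mod (z - a)] by [rootmod a z] changes nothing on the unit circle, can
    only increase the value at [w], and turns the square root of the product into the modulus of the
    holomorphic function [H], to which the Poisson formula applies. *)
Lemma subpoisson_poly q w : mod w < 1 ->
  2 * pi * Num.sqrt (mod q.[w]) <=
  I (fun t => poisson_ker 1 w t * Num.sqrt (mod q.[polar 1 t])).
Proof.
move=> w1; have [s qE] := closed_field_poly_normal q.
set c := lead_coef q in qE.
have qm z : mod q.[z] = mod c * \prod_(a <- s) mod (z - a).
  rewrite qE hornerZ modulusM horner_prod modulus_prod; congr (_ * _).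
  by apply: eq_bigr => a _; rewrite hornerXsubC.
pose m z := mod c * \prod_(a <- s) rootmod a z.
pose H z : C := cr (Num.sqrt (mod c)) * \prod_(a <- s) rootfun a z.
have mc z : {for z, continuous m}.
  apply: continuousM; first exact: cst_continuous.
  elim: s {qE qm m H} => [|a s IH].
    rewrite (_ : (fun z => _) = fun=> 1); first exact: cst_continuous.
    by apply/funext => y; rewrite big_nil.
  rewrite (_ : (fun z => _) = fun z => rootmod a z * \prod_(a <- s) rootmod a z).
    by apply: continuousM => //; exact: rootmod_continuous.
  by apply/funext => y; rewrite big_cons.
have Hd z : mod z < 1 -> cdiff_at H z.
  move=> z1; apply: cdiff_atM; first exact: cdiff_at_cst.
  elim: s {qE qm m H mc} => [|a s IH].
    rewrite (_ : (fun z => _) = fun=> 1); first exact: cdiff_at_cst.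
    by apply/funext => y; rewrite big_nil.
  rewrite (_ : (fun z => _) = fun z => rootfun a z * \prod_(a <- s) rootfun a z).
    by apply: cdiff_atM => //; exact: rootfun_cdiff.
  by apply/funext => y; rewrite big_cons.
have Hm z : mod z < 1 -> mod (H z) = Num.sqrt (m z).
  move=> z1; rewrite -[LHS]ger0_norm ?modulus_ge0// -sqrtr_sqr; congr Num.sqrt.
  rewrite modulusM modulus_prod exprMn modulus_real ger0_norm ?sqrtr_ge0//.
  rewrite sqr_sqrtr ?modulus_ge0// -prodrXl; congr (_ * _).
  by apply: eq_bigr => a _; rewrite rootfun_modulus.
have m1 t : m (polar 1 t) = mod q.[polar 1 t].
  rewrite qm; congr (_ * _); apply: eq_bigr => a _; apply: rootmod_circle.
  by rewrite modulus_polar normr1.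
have mw : mod q.[w] <= m w.
  rewrite qm ler_wpM2l ?modulus_ge0//; elim: s {qE qm m H mc Hd Hm m1} => [|a s IH].
    by rewrite !big_nil.
  rewrite !big_cons ler_pM ?modulus_ge0//; last by rewrite rootmod_ge// ltW.
  by apply: prodr_ge0 => i _; exact: modulus_ge0.
pose u r t := poisson_ker r w t * Num.sqrt (m (polar r t)).
have u1 : u 1 = (fun t => poisson_ker 1 w t * Num.sqrt (mod q.[polar 1 t])).
  by apply/funext => t; rewrite /u m1.
rewrite -[X in _ <= X](_ : I (u 1) = _); last by rewrite u1.
have uc2 r t : mod w < r -> {for (r, t), continuous (fun p : R * R => u p.1 p.2)}.
  move=> wr; apply: continuousM; first exact: poisson_ker_continuous2.
  apply: (@continuous_comp _ _ _ (fun p : R * R => m (polar p.1 p.2)) (@Num.sqrt R)); last exact: sqrt_continuous.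
  apply: (@continuous_comp _ _ _ (fun p : R * R => polar p.1 p.2) m); last exact: mc.
  by apply: polar_continuous; [exact: cvg_fst|exact: cvg_snd].
have uc r t : mod w < r -> {for t, continuous (u r)}.
  move=> wr; apply: (@continuous_comp _ _ _ (fun t => (r, t)) (fun p : R * R => u p.1 p.2)); last exact: uc2.
  move=> A [[B D] [/= B1 D1] BD]; apply: filterS D1 => y Dy; apply: BD; split => //=.
  exact: nbhs_singleton B1.
(* [H] is holomorphic in the open disc only, so the Poisson formula is used on radii [r < 1]; the
   limit [r -> 1] is then taken under the integral. *)
have key r : mod w < r -> r < 1 -> 2 * pi * Num.sqrt (m w) <= I (u r).
  move=> wr r1; have r0 : 0 < r := le_lt_trans (modulus_ge0 w) wr.
  have := poisson_le r0 r1 wr Hd; rewrite Hm// => H1; apply: le_trans H1 _.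
  rewrite le_eqVlt; apply/orP; left; apply/eqP; apply: eq_Rintegral => t _.
  by rewrite /u Hm// modulus_polar ger0_norm// ltW.
apply: le_trans (_ : 2 * pi * Num.sqrt (m w) <= _).
  by rewrite ler_pM2l ?pi2_gt0// ler_wsqrtr.
apply/ler_addgt0Pr => e e0.
have Iu : \forall r \near (1 : R), mu.-integrable `[- pi, pi] (EFin \o u r).
  have : \forall r \near (1 : R), mod w < r by exact: lt_nbhsr.
  apply: filterS => r wr; apply: pointwise_continuous_integrable => t _; exact: uc.
have := continuous_circle_param (fun t _ => uc2 1 t w1) (fun t _ => uc 1 t w1) Iu e0.
move=> /nbhs_ballP[d /= d0 Hb].
have q0 : 0 < 1 - mod w by rewrite subr_gt0.
have m0 : 0 < Num.min (1 - mod w) d by rewrite lt_min q0.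
have n1 : Num.min (1 - mod w) d <= 1 - mod w by rewrite ge_min lexx.
have n2 : Num.min (1 - mod w) d <= d by rewrite ge_min lexx orbT.
have [r [wr r1 rd]] : exists r, [/\ mod w < r, r < 1 & `|1 - r| < d].
  exists (1 - Num.min (1 - mod w) d / 2); split; [lra|lra|].
  by rewrite opprB addrC subrK ger0_norm; lra.
apply: le_trans (key r wr r1) _; have := Hb r rd; rewrite ler_norml; lra.
Qed.

Lemma sqrtr_dist_le (x y : R) : 0 <= x -> 0 <= y -> Num.sqrt x <= Num.sqrt y + Num.sqrt `|x - y|.
Proof.
move=> x0 y0; rewrite -(ler_pXn2r (n:=2)) ?nnegrE ?addr_ge0 ?sqrtr_ge0//.
rewrite sqrrD !sqr_sqrtr//.
have : 0 <= Num.sqrt y * Num.sqrt `|x - y| *+ 2 by rewrite mulrn_wge0// mulr_ge0 ?sqrtr_ge0.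
have := ler_norm (x - y); lra.
Qed.

Lemma subpoisson_analytic (g : C -> C) (rho : R) w : 1 < rho ->
  (forall z, mod z < rho -> cdiff_at g z) -> mod w < 1 ->
  2 * pi * Num.sqrt (mod (g w)) <=
  I (fun t => poisson_ker 1 w t * Num.sqrt (mod (g (polar 1 t)))).
Proof.
move=> rho1 gd w1; apply/ler_addgt0Pr => e e0.
(* The square root is Hoelder of exponent 1/2, so approximating [g] within [h ^+ 2] costs [h]. This
   cost occurs twice with weight [2 * pi]: at [w] and under the kernel. *)
pose h := e / (4 * pi).
have pi0 : 0 < pi :> R := pi_gt0 R.
have h0 : 0 < h by rewrite divr_gt0// mulr_gt0.
have h20 : 0 < h ^+ 2 by rewrite exprn_gt0.
have [q Hq] := taylor_approx rho1 h20 gd.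
have close (x y : C) : mod (x - y) <= h ^+ 2 -> Num.sqrt (mod x) <= Num.sqrt (mod y) + h.
  move=> xy; apply: le_trans (sqrtr_dist_le (modulus_ge0 x) (modulus_ge0 y)) _.
  have E : h = Num.sqrt (h ^+ 2) by rewrite sqrtr_sqr ger0_norm// ltW.
  rewrite lerD2l [X in _ <= X]E; apply: ler_wsqrtr.
  apply: le_trans xy; rewrite ler_norml modulusB_ge andbT lerNl opprB modulusB.
  exact: modulusB_ge.
have sq : Num.sqrt (mod (g w)) <= Num.sqrt (mod q.[w]) + h by apply/close/Hq/ltW.
have p1 t : mod (polar 1 t) = 1 by rewrite modulus_polar normr1.
have sq' t : Num.sqrt (mod q.[polar 1 t]) <= Num.sqrt (mod (g (polar 1 t))) + h.
  by apply: close; rewrite modulusB; apply: Hq; rewrite p1.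
have Pc t : {for t, continuous (poisson_ker 1 w)} by exact: poisson_ker_continuous.
have sc (f : C -> C) : (forall t, {for polar 1 t, continuous f}) ->
    forall t, {for t, continuous (fun t => Num.sqrt (mod (f (polar 1 t))))}.
  move=> fc t; apply: (@continuous_comp _ _ _ (fun t => mod (f (polar 1 t))) (@Num.sqrt R)); last exact: sqrt_continuous.
  apply: (@continuous_comp _ _ _ (fun t => f (polar 1 t)) mod); last exact: continuous_modulus.
  apply: (@continuous_comp _ _ _ (fun t => polar 1 t) f); last exact: fc.
  by apply: polar_continuous; [exact: cvg_cst|exact: cvg_id].
have I0 : mu.-integrable `[- pi, pi] (EFin \o poisson_ker 1 w).
  by apply: pointwise_continuous_integrable => t _; exact: Pc.
have I1 : mu.-integrable `[- pi, pi] (EFin \o (fun t => poisson_ker 1 w t * Num.sqrt (mod (g (polar 1 t))))).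
  apply: pointwise_continuous_integrable => t _; apply: continuousM; first exact: Pc.
  by apply: sc => y; apply/cdiff_at_continuous/gd; rewrite p1.
have I2 : mu.-integrable `[- pi, pi] (EFin \o (fun t => poisson_ker 1 w t * Num.sqrt (mod q.[polar 1 t]))).
  apply: pointwise_continuous_integrable => t _; apply: continuousM; first exact: Pc.
  apply: (sc (horner q)) => y; apply: cdiff_at_continuous.
  elim/poly_ind: q {Hq sq sq'} => [|q c [l IH]].
    rewrite (_ : horner 0 = fun=> 0); first exact: cdiff_at_cst.
    by apply/funext => x; rewrite horner0.
  rewrite (_ : horner _ = fun x => q.[x] * x + c).
    apply: cdiff_atD; last exact: cdiff_at_cst.
    by apply: cdiff_atM; [exists l|exact: cdiff_at_id].
  by apply/funext => x; rewrite hornerMXaddC.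
have P0 t : 0 <= poisson_ker 1 w t by exact: poisson_ker_ge0.
apply: le_trans (_ : 2 * pi * (Num.sqrt (mod q.[w]) + h) <= _).
  by rewrite ler_pM2l ?pi2_gt0.
have := subpoisson_poly q w1.
have : I (fun t => poisson_ker 1 w t * Num.sqrt (mod q.[polar 1 t])) <=
   I (fun t => poisson_ker 1 w t * Num.sqrt (mod (g (polar 1 t))) + h * poisson_ker 1 w t).
  apply: le_Rintegral => //.
    by apply: integD => //; exact: integZ.
  by move=> t _; rewrite [h * _]mulrC -mulrDr ler_wpM2l.
rewrite RintegralD//; last exact: integZ.
rewrite RintegralZl// poisson_kernel_int//.
have -> : e = h * (4 * pi) by rewrite /h mulfVK// gt_eqF// mulr_gt0.
move=> h1 h2; rewrite mulrDr (_ : h * (4 * pi) = h * (2 * pi) + 2 * pi * h); last by ring.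
by rewrite addrA lerD2r; exact: le_trans h2 h1.
Qed.

End poisson_majorization.

(** * Majorization by boundary values *)

Section nonneg_integrals.
Variables (R : realType) (D : set R).
Hypothesis mD : measurable D.
Local Notation mu := (@lebesgue_measure R).
Local Notation E f := (\int[mu]_(t in D) (f t)%:E)%E.
Implicit Types f g : R -> R.

Lemma le_nnint f g : measurable_fun D f -> measurable_fun D g ->
  (forall t, D t -> 0 <= f t) -> (forall t, D t -> f t <= g t) -> (E f <= E g)%E.
Proof.
move=> mf mg f0 fg; apply: ge0_le_integral => //.
- exact/measurable_EFinP.
- exact/measurable_EFinP.
Qed.

Lemma nnintD f g : measurable_fun D f -> measurable_fun D g ->
  (forall t, D t -> 0 <= f t) -> (forall t, D t -> 0 <= g t) ->
  E (fun t => f t + g t) = (E f + E g)%E.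
Proof.
move=> mf mg f0 g0; rewrite -ge0_integralD//.
- exact/measurable_EFinP.
- exact/measurable_EFinP.
Qed.

Lemma nnintZ f (k : R) : measurable_fun D f -> (forall t, D t -> 0 <= f t) -> 0 <= k ->
  E (fun t => k * f t) = (k%:E * E f)%E.
Proof.
move=> mf f0 k0; rewrite -ge0_integralZl_EFin//.
exact/measurable_EFinP.
Qed.

Lemma nnint_Rintegral f : mu.-integrable D (EFin \o f) -> E f = (\int[mu]_(t in D) f t)%:E.
Proof. by move=> If; rewrite /Rintegral fineK//; exact: integrable_fin_num. Qed.

End nonneg_integrals.

Section radii.
Variable R : realType.

(** A sequence of radii, as required by dominated convergence and by [limn_esup]; the shift by 2
    keeps them positive, starting at [1 / 2]. *)
Definition rad (n : nat) : R := 1 - n.+2%:R^-1.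

Lemma rad01 n : 0 < rad n < 1.
Proof.
rewrite /rad subr_gt0 invf_lt1 ?ltr0n// ltr1n /= gtrBl invr_gt0 ltr0n//.
Qed.

Lemma rad_cvg : rad n @[n --> \oo] --> (1 : R).
Proof.
rewrite -[X in _ --> X]subr0; apply: cvgB; first exact: cvg_cst.
by have := @cvg_harmonic R; rewrite -cvg_shiftS.
Qed.

Lemma rad_left : rad n @[n --> \oo] --> 1^'-.
Proof.
move=> A; rewrite /at_left /within /= => HA.
have H : \forall n \near \oo, rad n < 1 -> A (rad n) := rad_cvg HA.
by apply: filterS H => n; apply; case/andP: (rad01 n).
Qed.

Lemma mod_rad n (t : R) : modulus (polar (rad n) t) < 1.
Proof. by have /andP[h0 h1] := rad01 n; rewrite modulus_polar ger0_norm// ltW. Qed.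

End radii.
Arguments rad {R}.
Arguments rad01 {R}.
Arguments rad_cvg {R}.
Arguments rad_left {R}.
Arguments mod_rad {R}.

Section hardy_majorization.
Variable R : realType.
Local Notation C := (cplx R).
Local Notation mu := (@lebesgue_measure R).
Local Notation mod := (@modulus R).
Local Notation I f := (\int[mu]_(x in `[- pi, pi]) f x).
Local Notation E f := (\int[mu]_(t in `[(- pi)%R, pi]) (f t)%:E)%E.
Implicit Types (z w : C).

Lemma circ_measurable (f : R -> R) : (forall t, - pi <= t <= pi -> {for t, continuous f}) ->
  measurable_fun `[- pi, pi] f.
Proof.
move=> cf; have /measurable_int/measurable_EFinP := circ_integ cf; exact.
Qed.

Lemma measurable_sqrt (D : set R) (f : R -> R) : measurable_fun D f ->
  measurable_fun D (fun t => Num.sqrt (f t)).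
Proof.
move=> mf; apply: (@measurableT_comp _ _ _ _ _ _ (@Num.sqrt R)) => //.
by apply: continuous_measurable_fun; exact: sqrt_continuous.
Qed.

Section radial_sequence.
Variables (G : C -> C) (M : R) (b : R -> R) (w : C).
Hypothesis Gd : forall z, mod z < 1 -> cdiff_at G z.
Hypothesis GM : forall r, 0 < r < 1 -> I (fun t => mod (G (polar r t))) <= M.
Hypothesis mb : measurable_fun `[- pi, pi] b.
Hypothesis b0 : forall t, 0 <= b t.
Hypothesis Gb : {ae mu, forall t, t \in `[- pi, pi] -> forall e : R, 0 < e ->
  \forall r \near 1^'-, Num.sqrt (mod (G (polar r t))) <= b t + e}.
Hypothesis w1 : mod w < 1.

Local Notation rn := (@rad R).
Let a n t := Num.sqrt (mod (G (polar (rn n) t))).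
Let P := poisson_ker 1 w.

Let modG_cont n t : {for t, continuous (fun t => mod (G (polar (rn n) t)))}.
Proof.
apply: (@continuous_comp _ _ _ (fun t => G (polar (rn n) t)) mod); last exact: continuous_modulus.
apply: (@continuous_comp _ _ _ (fun t => polar (rn n) t) G).
  by apply: polar_continuous; [exact: cvg_cst|exact: cvg_id].
exact/cdiff_at_continuous/Gd/mod_rad.
Qed.

Let a_cont n t : {for t, continuous (a n)}.
Proof.
apply: (@continuous_comp _ _ _ (fun t => mod (G (polar (rn n) t))) (@Num.sqrt R)); last exact: sqrt_continuous.
exact: modG_cont.
Qed.

Let P_cont t : {for t, continuous P}.
Proof. exact: poisson_ker_continuous. Qed.

Let P0 t : 0 <= P t.
Proof. exact: poisson_ker_ge0. Qed.

Let mP : measurable_fun `[- pi, pi] P.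
Proof. exact: circ_measurable. Qed.

Let ma n : measurable_fun `[- pi, pi] (a n).
Proof. by apply: circ_measurable => t _; exact: a_cont. Qed.

Let sub_a n : 2 * pi * Num.sqrt (mod (G (cr (rn n) * w))) <= I (fun t => P t * a n t).
Proof.
have /andP[h0 h1] := @rad01 R n.
have V1 : 1 < (rn n)^-1 by rewrite invf_gt1.
have gd z : mod z < (rn n)^-1 -> cdiff_at (fun z => G (cr (rn n) * z)) z.
  move=> zr; have [|l D] := Gd (_ : mod (cr (rn n) * z) < 1).
    by rewrite modulusM modulus_real ger0_norm ?(ltW h0)// mulrC -ltr_pdivlMr// div1r.
  have [m D'] : cdiff_at (fun z => cr (rn n) * z) z.
    by apply: cdiff_atM; [exact: cdiff_at_cst|exact: cdiff_at_id].
  by eexists; exact: cdiff_comp D' D.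
apply: le_trans (subpoisson_analytic V1 gd w1) _.
by rewrite le_eqVlt; apply/orP; left; apply/eqP; apply: eq_Rintegral => t _; rewrite /a (polarE (rn n)).
Qed.

(** With [lam] a truncation level, [a n <= b + m n + a n ^+ 2 / lam]. The excess [m n] of the
    truncated function over [b] is bounded and tends to 0 almost everywhere, so its integral tends
    to 0 by dominated convergence; the last term is small because [M] bounds the integral of
    [a n ^+ 2] for every [n]. *)
Lemma hardy_majorization_root :
  ((2 * pi * Num.sqrt (mod (G w)))%R%:E <= E (fun t => P t * b t)%R)%E.
Proof.
have M0 : 0 <= M.
  apply: le_trans (GM (rad01 0)); apply: Rintegral_ge0 => t _; exact: modulus_ge0.
have [K HK] : exists K : R, forall t, - pi <= t <= pi -> P t <= K.
  by apply: continuous_circ_bounded => t _; exact: P_cont.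
have K0 : 0 <= K by apply: le_trans (HK 0 _) => //; rewrite oppr_le0 pi_ge0.
apply/lee_addgt0Pr => e e0; have e30 : 0 < e / 3 by rewrite divr_gt0.
(* Chosen so that [K * M / lam <= e / 3]; the summand 1 keeps [lam] positive when [K * M]
   vanishes. *)
pose lam := (K * M + 1) / (e / 3).
have lam0 : 0 < lam by rewrite divr_gt0// ltr_wpDl// mulr_ge0.
have KMl : K * M / lam <= e / 3.
  by rewrite ler_pdivrMr// /lam mulrCA divff ?gt_eqF// mulr1 lerDl.
pose m n t := Num.max (Num.min (a n t) lam - b t) 0.
have mm n : measurable_fun `[- pi, pi] (m n).
  apply: measurable_maxr => //; apply: measurable_funB => //.
  by apply: measurable_minr.
have m0 n t : 0 <= m n t by rewrite le_max lexx orbT.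
have mlam n t : m n t <= lam.
  by rewrite ge_max (ltW lam0) andbT lerBlDr ge_min lerDl b0 orbT.
have a0 n t : 0 <= a n t by exact: sqrtr_ge0.
have a2 n t : a n t ^+ 2 = mod (G (polar (rn n) t)) by rewrite sqr_sqrtr ?modulus_ge0.
have split_a n t : a n t <= b t + m n t + lam^-1 * a n t ^+ 2.
  have := b0 t; have := m0 n t; have [al|al] := leP (a n t) lam.
    have : a n t - b t <= m n t by rewrite /m min_l// le_max lexx.
    have : 0 <= lam^-1 * a n t ^+ 2 by rewrite mulr_ge0 ?exprn_ge0// invr_ge0 ltW.
    lra.
  have : a n t <= lam^-1 * a n t ^+ 2.
    by rewrite ler_pdivlMl// expr2 ler_wpM2r// ltW.
  lra.
have mulP f : measurable_fun `[- pi, pi] f -> measurable_fun `[- pi, pi] (fun t => P t * f t).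
  by move=> mf; exact: measurable_funM.
have ma2 n : measurable_fun `[- pi, pi] (fun t => a n t ^+ 2) by exact: measurable_funX.
have main n : ((2 * pi * Num.sqrt (mod (G (cr (rn n) * w))))%R%:E <=
    E (fun t => P t * b t)%R + E (fun t => P t * m n t)%R + (e / 3)%R%:E)%E.
  apply: (@le_trans _ _ (E (fun t => P t * a n t)%R)).
    rewrite nnint_Rintegral// ?lee_fin; first exact: sub_a.
    by apply: circ_integ => t _; apply: continuousM; [exact: P_cont|exact: a_cont].
  apply: (@le_trans _ _ (E (fun t => P t * b t + P t * m n t + P t * (lam^-1 * a n t ^+ 2))%R)).
    apply: le_nnint => //; first exact: mulP.
    - apply: measurable_funD; first by apply: measurable_funD; exact: mulP.
      by apply: mulP; apply: measurable_funM.
    - by move=> t _; rewrite mulr_ge0.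
    - by move=> t _; rewrite -!mulrDr ler_wpM2l.
  have l0 : 0 <= lam^-1 by rewrite invr_ge0 ltW.
  have x0 n' t : 0 <= lam^-1 * a n' t ^+ 2 by rewrite mulr_ge0 ?exprn_ge0.
  rewrite nnintD//; first last.
  - by move=> t _; rewrite mulr_ge0.
  - by move=> t _; rewrite addr_ge0// mulr_ge0// ?b0 ?m0.
  - by apply: mulP; apply: measurable_funM.
  - by apply: measurable_funD; exact: mulP.
  apply: leeD.
    rewrite nnintD//; [exact: mulP|exact: mulP| |].
      by move=> t _; rewrite mulr_ge0.
    by move=> t _; rewrite mulr_ge0.
  apply: (@le_trans _ _ (E (fun t => (K / lam) * a n t ^+ 2)%R)).
    apply: le_nnint => //.
    - by apply: mulP; apply: measurable_funM.
    - by apply: measurable_funM.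
    - by move=> t _; rewrite mulr_ge0.
    - move=> t /=; rewrite in_itv /= => tpi; rewrite mulrA ler_wpM2r ?exprn_ge0//.
      by rewrite ler_wpM2r ?HK// invr_ge0 ltW.
  have Ia2 : mu.-integrable `[- pi, pi] (EFin \o (fun t => a n t ^+ 2)).
    by apply: circ_integ => t _; exact: (continuousM (@a_cont n t) (@a_cont n t)).
  rewrite nnintZ//; [|by move=> t _; rewrite exprn_ge0|by rewrite divr_ge0// ltW].
  rewrite nnint_Rintegral// -EFinM lee_fin; apply: le_trans KMl.
  rewrite mulrAC ler_wpM2r ?invr_ge0 ?(ltW lam0)//; apply: ler_wpM2l => //.
  under eq_Rintegral do rewrite a2; exact/GM/rad01.
have lim0 : E (fun t => P t * m n t)%R @[n --> \oo] --> 0%E.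
  have [] := @dominated_convergence _ _ _ mu `[- pi, pi] (measurable_itv _)
    (fun n t => (P t * m n t)%:E) (fun=> 0%E) (fun t => (P t * lam)%:E).
  - by move=> n; apply/measurable_EFinP; exact: mulP.
  - exact: measurable_cst.
  - have FA : Filter (almost_everywhere mu) by exact: ae_filter_ringOfSetsType.
    apply: filterS Gb => t Gbt; rewrite /= in_itv /= => tpi.
    apply/cvg_EFin; first by near=> n.
    apply/cvgrPdist_le => d d0 /=.
    have d10 : 0 < d / (K + 1) by rewrite divr_gt0// ltr_wpDl.
    have := Gbt (_ : t \in `[- pi, pi]); rewrite in_itv /= tpi => /(_ isT _ d10) /rad_left H.
    have {}H : \forall n \near \oo, a n t <= b t + d / (K + 1) := H.
    apply: filterS H => n an.
    rewrite sub0r normrN (ger0_norm (mulr_ge0 (P0 t) (m0 n t))).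
    have mn : m n t <= d / (K + 1).
      rewrite /m ge_max (ltW d10) andbT lerBlDl; apply: le_trans an.
      by rewrite ge_min lexx.
    apply: (@le_trans _ _ ((K + 1) * (d / (K + 1)))).
      by apply: (ler_pM (P0 t) (m0 n t) _ mn); apply: le_trans (HK t tpi) _; rewrite lerDl.
    by rewrite mulrC mulfVK// gt_eqF// ltr_wpDl.
  - by apply: circ_integ => t _; apply: continuousM; [exact: P_cont|exact: cst_continuous].
  - apply: aeW => t n _; rewrite lee_fin (ger0_norm (mulr_ge0 (P0 t) (m0 n t))).
    exact: (ler_wpM2l (P0 t)).
  by move=> _ _; rewrite integral0.
have limG : 2 * pi * Num.sqrt (mod (G (cr (rn n) * w))) @[n --> \oo] --> 2 * pi * Num.sqrt (mod (G w)).
  apply: cvgMr; apply: (@cvg_comp _ _ _ (fun n => mod (G (cr (rn n) * w))) (@Num.sqrt R)); last exact: sqrt_continuous.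
  apply: (@cvg_comp _ _ _ (fun n => G (cr (rn n) * w)) mod); last exact: continuous_modulus.
  apply: (@cvg_comp _ _ _ (fun n => cr (rn n) * w) G); last exact: (cdiff_at_continuous (Gd w1)).
  apply/cvg_modP => d d0; have /cvgrPdist_lt := @rad_cvg R; move=> /(_ _ d0); apply: filterS => n nd.
  rewrite (_ : _ - w = - (cr (1 - rn n) * w)); last first.
    have cr1 : cr 1 = 1 :> C by [].
    by rewrite (crD 1 (- rn n)) (crN (rn n)) cr1 mulrBl mul1r opprB.
  rewrite modulusN modulusM modulus_real; apply: le_lt_trans nd.
  by rewrite ler_piMr// ltW.
have H1 : \forall n \near \oo, 2 * pi * Num.sqrt (mod (G w)) - e / 3 <= 2 * pi * Num.sqrt (mod (G (cr (rn n) * w))).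
  move/cvgrPdist_le : limG => /(_ _ e30); apply: filterS => n; rewrite ler_norml; lra.
have H2 : \forall n \near \oo, (E (fun t => P t * m n t)%R <= (e / 3)%R%:E)%E.
  have H : \forall n \near \oo, (E (fun t => P t * m n t)%R < (e / 3)%R%:E)%E.
    exact: (lim0 _ (@nbhs_open_ereal_lt _ 0 (fun=> e / 3) e30)).
  by apply: filterS H => n; exact: ltW.
have [n [h1 h2]] : exists n, 2 * pi * Num.sqrt (mod (G w)) - e / 3 <= 2 * pi * Num.sqrt (mod (G (cr (rn n) * w))) /\
    (E (fun t => P t * m n t)%R <= (e / 3)%R%:E)%E.
  have [n1 _ h1] := H1; have [n2 _ h2] := H2; exists (maxn n1 n2).
  by split; [apply: h1; exact: leq_maxl|apply: h2; exact: leq_maxr].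
have := main n; move: (E (fun t => (P t * b t)%R)) => B h3.
have h4 : ((2 * pi * Num.sqrt (mod (G w)) - e / 3)%R%:E <= B + (e / 3)%R%:E + (e / 3)%R%:E)%E.
  apply: (le_trans _ (le_trans h3 _)); first by rewrite lee_fin.
  by apply: leeD2r; apply: leeD2l.
have -> : (2 * pi * Num.sqrt (mod (G w)))%R%:E = ((2 * pi * Num.sqrt (mod (G w)) - e / 3)%R%:E + (e / 3)%R%:E)%E.
  by rewrite -EFinD subrK.
apply: le_trans (leeD h4 (lexx (e / 3)%R%:E)) _.
rewrite -!addeA -!EFinD; apply: leeD2l; rewrite lee_fin; lra.
Unshelve. all: by end_near. Qed.

End radial_sequence.

(** For [p = 1] no weak compactness is available: the majorization is first
    proved for [|G|^(1/2)], whose circle restrictions are bounded in [L^2], hence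
    uniformly integrable, and then squared by Cauchy-Schwarz. *)
Theorem hardy_majorization (G : C -> C) (M : R) (beta : R -> R) w :
  (forall z, mod z < 1 -> cdiff_at G z) ->
  (forall r, 0 < r < 1 -> I (fun t => mod (G (polar r t))) <= M) ->
  measurable_fun `[- pi, pi] beta -> (forall t, 0 <= beta t) ->
  {ae mu, forall t, t \in `[- pi, pi] ->
     exists2 L : C, G (polar r t) @[r --> 1^'-] --> L & mod L <= beta t} ->
  mod w < 1 ->
  ((2 * pi * mod (G w))%R%:E <= E (fun t => poisson_ker 1 w t * beta t)%R)%E.
Proof.
move=> Gd GM mbeta beta0 Gb w1.
have P0 t : 0 <= poisson_ker 1 w t by exact: poisson_ker_ge0.
have Pc t : {for t, continuous (poisson_ker 1 w)} by exact: poisson_ker_continuous.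
have mP : measurable_fun `[- pi, pi] (poisson_ker 1 w) by exact: circ_measurable.
have IP : mu.-integrable `[- pi, pi] (EFin \o poisson_ker 1 w) by exact: circ_integ.
have mb : measurable_fun `[- pi, pi] (fun t => Num.sqrt (beta t)) by exact: measurable_sqrt.
have Gb' : {ae mu, forall t, t \in `[- pi, pi] -> forall e : R, 0 < e ->
  \forall r \near 1^'-, Num.sqrt (mod (G (polar r t))) <= Num.sqrt (beta t) + e}.
  have FA : Filter (almost_everywhere mu) by exact: ae_filter_ringOfSetsType.
  apply: filterS Gb => t Gbt tpi e e0; have [L GL Lb] := Gbt tpi.
  have : Num.sqrt (mod (G (polar r t))) @[r --> 1^'-] --> Num.sqrt (mod L).
    apply: (@cvg_comp _ _ _ (fun r => mod (G (polar r t))) (@Num.sqrt R)); last exact: sqrt_continuous.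
    by apply: (@cvg_comp _ _ _ (fun r => G (polar r t)) mod); [exact: GL|exact: continuous_modulus].
  move=> /cvgrPdist_le /(_ _ e0); apply: filterS => r; rewrite ler_norml.
  have := ler_wsqrtr Lb; lra.
have := hardy_majorization_root Gd GM mb (fun t => sqrtr_ge0 _) Gb' w1.
have y0 := sqrtr_ge0 (mod (G w)).
have yE : mod (G w) = Num.sqrt (mod (G w)) ^+ 2 by rewrite sqr_sqrtr ?modulus_ge0.
rewrite [in X in _ -> X]yE; move: y0; set y := Num.sqrt _; rewrite le_eqVlt => /predU1P[<- _|y0 H].
  rewrite expr0n /= mulr0; apply: integral_ge0 => t _.
  by rewrite lee_fin mulr_ge0.
set X := (X in (_ <= X)%E).
(* Cauchy-Schwarz in linear form. Integrated against the kernel, of mass [2 * pi], it gives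
   [2 * pi * y <= pi * y + X / (2 * y)], that is [2 * pi * y ^+ 2 <= X]. Division by [y] is why
   [y = 0] was treated apart. *)
have amgm t : Num.sqrt (beta t) <= y / 2 + (2 * y)^-1 * beta t.
  rewrite -{2}(sqr_sqrtr (beta0 t)); set s := Num.sqrt _.
  rewrite -subr_ge0 (_ : _ - _ = (2 * y)^-1 * (y - s) ^+ 2); last by field; rewrite gt_eqF.
  by rewrite mulr_ge0 ?sqr_ge0// invr_ge0 mulr_ge0 ?ltW.
have Pb0 t : 0 <= poisson_ker 1 w t * beta t := mulr_ge0 (P0 t) (beta0 t).
have yh0 : 0 <= y / 2 by rewrite divr_ge0 ?ltW.
have y20 : 0 <= (2 * y)^-1 by rewrite invr_ge0 mulr_ge0 ?ltW.
have : ((2 * pi * y)%R%:E <= (y / 2 * (2 * pi))%R%:E + ((2 * y)^-1)%R%:E * X)%E.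
  apply: le_trans H _.
  apply: (@le_trans _ _ (E (fun t => y / 2 * poisson_ker 1 w t + (2 * y)^-1 * (poisson_ker 1 w t * beta t))%R)).
    apply: le_nnint => //.
    - exact: measurable_funM.
    - by apply: measurable_funD; apply: measurable_funM => //; exact: measurable_funM.
    - by move=> t _; exact: (mulr_ge0 (P0 t) (sqrtr_ge0 _)).
    - move=> t _; have := ler_wpM2l (P0 t) (amgm t).
      by rewrite mulrDr [in X in _ -> _ <= _ + X]mulrCA [in X in _ -> _ <= X + _]mulrC.
  rewrite nnintD//; first last.
  - by move=> t _; exact: (mulr_ge0 y20 (Pb0 t)).
  - by move=> t _; exact: (mulr_ge0 yh0 (P0 t)).
  - by apply: measurable_funM => //; exact: measurable_funM.
  - exact: measurable_funM.
  rewrite (@nnintZ _ _ _ (poisson_ker 1 w))//.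
  rewrite (@nnintZ _ _ _ (fun t => poisson_ker 1 w t * beta t))//; last exact: measurable_funM.
  by rewrite nnint_Rintegral// poisson_kernel_int// EFinM.
have : (0 <= X)%E by apply: integral_ge0 => t _; rewrite lee_fin Pb0.
case: X => [x||] //= x0; last by rewrite leey.
rewrite -EFinM -EFinD !lee_fin => H'.
have : pi * y <= (2 * y)^-1 * x by move: H'; lra.
rewrite ler_pdivlMl ?mulr_gt0//; lra.
Qed.

End hardy_majorization.

(** * Length of curves *)

Section curves.
Variable R : realType.
Local Notation C := (cplx R).
Local Notation mu := (@lebesgue_measure R).
Local Notation mod := (@modulus R).
Local Notation rint a b f := (\int[mu]_(x in `[a, b]) f x).
Local Notation integ a b f := (mu.-integrable `[a, b] (EFin \o f)).
Implicit Types (gamma : R -> C) (z w : C).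

Lemma within_comp (T U V : topologicalType) (A : set T) (f : T -> U) (g : U -> V) :
  {within A, continuous f} -> (forall x, A x -> {for f x, continuous g}) ->
  {within A, continuous (g \o f)}.
Proof.
move=> cf cg; rewrite continuous_subspace_in => x /set_mem Ax.
exact: (@continuous_comp (subspace A) U V f g x (cf x) (cg x Ax)).
Qed.

Lemma within_dist (f : R -> C) (a b : R) : {within `[a, b], continuous f} ->
  forall s, a <= s <= b -> forall e : R, 0 < e ->
  exists2 d : R, 0 < d & forall t, a <= t <= b -> `|t - s| < d -> mod (f t - f s) < e.
Proof.
move=> cf s sab e e0.
have As : `[a, b]%classic s by rewrite /= in_itv.
have : nbhs_subspace (A := `[a, b]) s [set t | mod (f t - f s) < e].
  exact: ((continuous_modP _ _).1 (cf s) e e0).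
rewrite -(nbhs_subspace_in As) => /nbhs_ballP[d /= d0 H].
by exists d => // t tab td; apply: H; [rewrite /ball /= distrC|rewrite /= in_itv].
Qed.

(** End points affect neither measurability nor the integral. This is needed because [speed] has
    arbitrary values at the breakpoints of a curve. *)
Lemma oo_measurable_integ a b (f g : R -> R) : {in `]a, b[, f =1 g} -> integ a b g -> 
  integ a b f /\ rint a b f = rint a b g.
Proof.
move=> fg Ig.
have mg : measurable_fun `]a, b[ g.
  apply: (measurable_funS (E := `[a, b])) => //; first exact: subset_itv_oo_cc.
  have /measurable_int/measurable_EFinP := Ig; exact.
have mf : measurable_fun `]a, b[ f.
  by apply: (eq_measurable_fun g) => // x /set_mem xab; apply/esym/fg.
split; last by congr fine; exact: eq_integral_itv_bounded.
have mc : measurable_fun `[a, b] f := measurable_fun_itv_cc mf.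
apply/integrableP; split; first exact/measurable_EFinP.
have /integrableP[_] := Ig; apply: le_lt_trans; rewrite le_eqVlt; apply/orP; left; apply/eqP.
apply: (@eq_integral_itv_bounded _ _ _ (fun x => `|g x|) (fun x => `|f x|)).
- exact: measurableT_comp.
- exact: measurableT_comp.
- by move=> x xab; rewrite fg.
Qed.

Lemma integ_glue (a c b : R) (f : R -> R) : a <= c -> c <= b ->
  integ a c f -> integ c b f -> integ a b f.
Proof.
move=> ac cb I1 I2.
have I3 : mu.-integrable `]c, b] (EFin \o f).
  by apply: integrableS I2 => //; apply: subset_itv; rewrite bnd_simp.
have U : `[a, b]%classic = `[a, c] `|` `]c, b] :> set R.
  by rewrite -itv_bndbnd_setU ?bnd_simp.
have dis : [disjoint `[a, c]%classic & `]c, b]%classic].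
  rewrite disj_set2E; apply/eqP; rewrite -subset0 => t [] /=; rewrite !in_itv /=.
  by move=> /andP[_ tc] /andP[ct _]; move: ct; rewrite ltNge tc.
have mf : measurable_fun (`[a, c] `|` `]c, b]) (EFin \o f).
  apply/measurable_funU => //; split; first exact: measurable_int I1.
  exact: measurable_int I3.
have mf' : measurable_fun (`[a, c] `|` `]c, b]) (fun x => `|(EFin \o f) x|)%E.
  exact: measurableT_comp.
have /integrableP[_ f1] := I1; have /integrableP[_ f2] := I3.
rewrite U; apply/integrableP; split => //.
by rewrite ge0_integral_setU// lte_add_pinfty.
Qed.

Definition C1_piece (a b : R) gamma :=
  C1_between a b (re_part gamma) /\ C1_between a b (im_part gamma).

(** Recursive form of the partition in [piecewise_C1], suited to induction, concatenation and
    reversal; the empty list stands for a degenerate interval. *)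
Fixpoint pieces gamma (a : R) (s : seq R) (b : R) : Prop :=
  if s is c :: s' then [/\ a < c, C1_piece a c gamma & pieces gamma c s' b] else a = b.

Lemma piecewise_C1P (a b : R) gamma : piecewise_C1 a b gamma <->
  {within `[a, b], continuous gamma} /\ exists s, pieces gamma a s b.
Proof.
suff H s : (itv_partition a b s /\ forall i, (i < size s)%N ->
      C1_piece (nth b (a :: s) i) (nth b s i) gamma) <-> pieces gamma a s b.
  split=> [[cg [s sp sC]]|[cg [s /H[sp sC]]]]; split => //; exists s => //.
  by apply/H.
elim: s a => [|c s IH] a /=.
  split=> [[/itv_partition_nil]//|->]; split => //; split => //=; exact/eqP.
split=> [[sp sC]|[ac C1 /IH[sp sC]]].
  split; first by case: sp => /= /andP[].
    exact: (sC 0%N).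
  apply/IH; split; first exact: itv_partition_cons sp.
  by move=> i is_; exact: (sC i.+1).
split; first by case: sp => p1 p2; split => //=; rewrite ac.
by case=> [|i] is_ //; exact: sC.
Qed.

Lemma pieces_cat gamma a s c t b :
  pieces gamma a s c -> pieces gamma c t b -> pieces gamma a (s ++ t) b.
Proof. by elim: s a => [|d s IH] a /= => [->//|[ad C1 /IH{}IH /IH]]; split. Qed.

Lemma pieces_le gamma a s b : pieces gamma a s b -> a <= b.
Proof. by elim: s a => [|c s IH] a /= => [->//|[ac _ /IH]]; exact: le_trans (ltW ac). Qed.

Lemma near_oo (a b t : R) (P : R -> Prop) : t \in `]a, b[ ->
  (forall x, x \in `]a, b[ -> P x) -> \forall x \near t, P x.
Proof. by move=> /near_in_itvoo tab H; apply: filterS tab => x; exact: H. Qed.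

Lemma eq_derive1_oo (u v : R -> R) (a b t : R) : {in `]a, b[, u =1 v} -> t \in `]a, b[ ->
  derive1 u t = derive1 v t.
Proof.
by move=> uv tab; rewrite !derive1E; apply: near_eq_derive; exact: near_oo tab _.
Qed.

Lemma C1_between_eq (a b : R) (u v : R -> R) : {in `]a, b[, u =1 v} ->
  C1_between a b u -> C1_between a b v.
Proof.
move=> uv [du [u' [cu' uE]]]; split=> [t tab|].
  by apply: near_eq_derivable (du t tab); exact: near_oo tab _.
by exists u'; split => // t tab; rewrite -(eq_derive1_oo uv tab) uE.
Qed.

Lemma C1_piece_eq (a b : R) (f g : R -> C) : {in `]a, b[, f =1 g} ->
  C1_piece a b f -> C1_piece a b g.
Proof.
move=> fg [cr_ ci]; split; [apply: C1_between_eq cr_|apply: C1_between_eq ci] => t tab;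
  by rewrite /re_part /im_part fg.
Qed.

Lemma pieces_eq (a b : R) (f g : R -> C) s : {in `]a, b[, f =1 g} ->
  pieces f a s b -> pieces g a s b.
Proof.
elim: s a => [|c s IH] a //= fg [ac C1 pcb].
have cb := pieces_le pcb; split => //.
  apply: C1_piece_eq C1 => t; rewrite in_itv /= => /andP[at_ tc].
  by apply: fg; rewrite in_itv /= at_ (lt_le_trans tc).
apply: IH pcb => t; rewrite in_itv /= => /andP[ct tb].
by apply: fg; rewrite in_itv /= tb (lt_trans ac).
Qed.

Lemma speed_eq (a b t : R) (f g : R -> C) : {in `]a, b[, f =1 g} -> t \in `]a, b[ ->
  speed f t = speed g t.
Proof.
move=> fg tab; rewrite /speed; congr (mod (Complex _ _));
  apply: eq_derive1_oo tab => x xab; by rewrite /re_part /im_part fg.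
Qed.

Lemma speed_ge0 gamma t : 0 <= speed gamma t.
Proof. exact: modulus_ge0. Qed.

Section density.
Variables (D : set C) (rho : C -> R).
Hypothesis rhoc : forall z, D z -> {for z, continuous rho}.
Hypothesis rho0 : forall z, D z -> 0 < rho z.

Let dens gamma t := rho (gamma t) * speed gamma t.

Lemma piece_density (a b : R) gamma : a <= b ->
  {within `[a, b], continuous gamma} -> C1_piece a b gamma ->
  (forall t, a <= t <= b -> D (gamma t)) ->
  integ a b (dens gamma) /\
  forall m t1 t2 : R, 0 <= m -> a <= t1 -> t1 <= t2 -> t2 <= b ->
    (forall t, t1 <= t <= t2 -> m <= rho (gamma t)) ->
    m * mod (gamma t2 - gamma t1) <= rint t1 t2 (dens gamma).
Proof.
move=> ab cg [[dx [vx [cvx vxE]]] [dy [vy [cvy vyE]]]] gD.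
have crho : {within `[a, b], continuous (rho \o gamma)}.
  by apply: within_comp cg _ => t; rewrite /= in_itv /= => /gD; exact: rhoc.
have cre : {within `[a, b], continuous (re_part gamma)}.
  by apply: within_comp cg _ => t _; exact: continuous_Re.
have cim : {within `[a, b], continuous (im_part gamma)}.
  by apply: within_comp cg _ => t _; exact: continuous_Im.
pose v t : C := Complex (vx t) (vy t).
have cv : {within `[a, b], continuous (fun t => mod (v t))}.
  have cv : {within `[a, b], continuous v}.
    by move=> t; apply: continuous_Complex; [exact: cvx|exact: cvy].
  by apply: within_comp cv _ => t _; exact: continuous_modulus.
pose k t := rho (gamma t) * mod (v t).
have ck : {within `[a, b], continuous k} by move=> t; exact: (continuousM (crho t) (cv t)).
have densE : {in `]a, b[, dens gamma =1 k}.
  by move=> t tab; rewrite /dens /speed vxE// vyE.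
have Ik := within_continuous_integrable ck.
have [Id _] := oo_measurable_integ densE Ik; split => // m t1 t2 m0 at1 t12 t2b mrho.
have sub : `[t1, t2] `<=` `[a, b] by apply: subset_itv; rewrite bnd_simp.
have subo : {subset `]t1, t2[ <= `]a, b[} by apply: subset_itv; rewrite bnd_simp.
have sW (f : R -> R) : {within `[a, b], continuous f} -> {within `[t1, t2], continuous f}.
  exact: continuous_subspaceW.
have -> : rint t1 t2 (dens gamma) = rint t1 t2 k.
  apply: (oo_measurable_integ _ _).2; last exact: (integrable_subitv at1 t2b Ik).
  by move=> t /subo; exact: densE.
have ftc u du : {within `[a, b], continuous u} -> {within `[a, b], continuous du} ->
    {in `]a, b[, forall t, derivable u t 1} -> {in `]a, b[, forall t, derive1 u t = du t} ->
    u t2 - u t1 = rint t1 t2 du.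
  move=> cu cdu du1 duE; rewrite (@rint_ftc _ t1 t2 du u)//; try exact: sW.
    by move=> t /subo; exact: du1.
  by move=> t /subo; exact: duE.
(* After rotation by [u] the chord is the integral of the real part of [u * v], which is at most
   [mod (v t)]. *)
have [u u1 uE] := unimodular_Re (gamma t2 - gamma t1); rewrite -uE.
have Ivx := within_continuous_integrable (sW _ cvx).
have Ivy := within_continuous_integrable (sW _ cvy).
have -> : m * complex.Re (u * (gamma t2 - gamma t1)) =
    rint t1 t2 (fun t => m * (complex.Re u * vx t - complex.Im u * vy t)).
  rewrite RintegralZl//; last by apply: integB; exact: integZ.
  rewrite RintegralB//; try exact: integZ.
  rewrite !RintegralZl// -(ftc _ _ cre cvx dx vxE) -(ftc _ _ cim cvy dy vyE).
  by rewrite ReM ReD ImD ReN ImN.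
apply: le_Rintegral => //.
- by apply: integZ; apply: integB; exact: integZ.
- exact: (integrable_subitv at1 t2b Ik).
move=> t; rewrite /= in_itv /= => tt; apply: le_trans (_ : m * mod (v t) <= _).
  apply: ler_wpM2l => //; rewrite -[mod (v t)]mul1r -u1 -modulusM.
  by apply: le_trans (Re_le_modulus _); rewrite ReM.
by apply: ler_wpM2r; [exact: modulus_ge0|exact: mrho].
Qed.

Lemma pieces_density (a b : R) gamma s : pieces gamma a s b ->
  {within `[a, b], continuous gamma} ->
  (forall t, a <= t <= b -> D (gamma t)) ->
  integ a b (dens gamma) /\
  forall m t1 t2 : R, 0 <= m -> a <= t1 -> t1 <= t2 -> t2 <= b ->
    (forall t, t1 <= t <= t2 -> m <= rho (gamma t)) ->
    m * mod (gamma t2 - gamma t1) <= rint t1 t2 (dens gamma).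
Proof.
elim: s a => [|c s IH] a /=.
  move=> -> cg gD; split=> [|m t1 t2 m0 at1 t12 t2b _].
    rewrite set_itv1; apply/integrableP; split; first exact: measurable_fun_set1.
    by rewrite integral_set1 ltry.
  have -> : t2 = t1 by apply: le_anti; rewrite t12 andbT (le_trans t2b).
  rewrite subrr modulus0 mulr0 set_itv1 Rintegral_set1//.
move=> [ac C1 pcb] cg gD; have cb := pieces_le pcb.
have subac : `[a, c] `<=` `[a, b] by apply: subset_itv; rewrite bnd_simp.
have subcb : `[c, b] `<=` `[a, b] by apply: subset_itv; rewrite bnd_simp// ltW.
have [I1 L1] := piece_density (ltW ac) (continuous_subspaceW subac cg) C1
  (fun t => fun h => gD t (subac t h)).
have [I2 L2] := IH c pcb (continuous_subspaceW subcb cg)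
  (fun t => fun h => gD t (subcb t h)).
have I : integ a b (dens gamma).
  exact: integ_glue (ltW ac) cb I1 I2.
split => // m t1 t2 m0 at1 t12 t2b mrho.
have [t2c|ct2] := leP t2 c; first exact: L1.
have [ct1|t1c] := leP c t1; first exact: L2.
rewrite (rint_chasles (ltW t1c) (ltW ct2)); last exact: (integrable_subitv at1 t2b I).
apply: le_trans (_ : m * (mod (gamma t2 - gamma c) + mod (gamma c - gamma t1)) <= _).
  by apply: ler_wpM2l => //; exact: modulusB_tri.
rewrite mulrDr addrC; apply: lerD.
  by apply: L1 => //; [exact: ltW|move=> t /andP[h1 h2]; apply: mrho; rewrite h1 (le_trans h2)// ltW].
by apply: L2 => //; [exact: ltW|move=> t /andP[h1 h2]; apply: mrho; rewrite h2 (le_trans _ h1)// ltW].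
Qed.

Lemma joins_density a b gamma z w : joins D a b gamma z w ->
  integ a b (dens gamma) /\
  forall m t1 t2 : R, 0 <= m -> a <= t1 -> t1 <= t2 -> t2 <= b ->
    (forall t, t1 <= t <= t2 -> m <= rho (gamma t)) ->
    m * mod (gamma t2 - gamma t1) <= rint t1 t2 (dens gamma).
Proof.
move=> [ab /piecewise_C1P[cg [s ps]] gD _ _]; apply: (pieces_density ps cg) => t tab.
by apply: gD; rewrite in_itv.
Qed.

Lemma rho_length_ge0 a b gamma z w : joins D a b gamma z w -> 0 <= rho_length rho a b gamma.
Proof.
move=> [_ _ gD _ _]; apply: Rintegral_ge0 => t tab.
by rewrite mulr_ge0 ?speed_ge0//; apply/ltW/rho0/gD.
Qed.

(** A curve from [z] to [w] either stays in the disc of radius [e] about [z], or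
    has already covered the distance [e] at its first exit. *)
Lemma rho_length_exit a b gamma z w (m e : R) : joins D a b gamma z w -> 0 <= m ->
  (forall y, D y -> mod (y - z) < e -> m <= rho y) ->
  m * Num.min e (mod (w - z)) <= rho_length rho a b gamma.
Proof.
move=> J m0 mrho; have [Id L] := joins_density J.
have [ab /piecewise_C1P[cg _] gD ga gb] := J.
have gD' t : a <= t <= b -> D (gamma t) by move=> tab; apply: gD; rewrite in_itv.
have [all_in|] := pselect (forall t, a <= t <= b -> mod (gamma t - z) < e).
  have := L m a b m0 (lexx a) (ltW ab) (lexx b).
  rewrite ga gb => H; apply: le_trans (H _); last first.
    by move=> t tab; apply: mrho; [exact: gD'|exact: all_in].
  by apply: ler_wpM2l => //; rewrite ge_min lexx orbT.
move=> /existsNP[t0 /not_implyP[t0ab /negP]]; rewrite -leNgt => t0e.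
apply: le_trans (_ : m * e <= _); first by apply: ler_wpM2l => //; rewrite ge_min lexx.
pose K := [set t | a <= t <= b /\ e <= mod (gamma t - z)].
have K0 : K !=set0 by exists t0.
have Kinf : has_inf K by split => //; exists a => t [/andP[]].
(* First exit time. The bound [m <= rho] holds in the open disc only, which the curve may have left
   at [T]; the length is therefore estimated up to a time [t < T] close to [T], with slack [h]. *)
pose T := inf K.
have aT : a <= T by apply: lb_le_inf => // t [/andP[]].
have Tt0 : T <= t0 by apply: ge_inf; [case: Kinf|].
have Tb : T <= b by case/andP: t0ab => _; exact: le_trans.
have before t : a <= t -> t < T -> mod (gamma t - z) < e.
  move=> at_ tT; rewrite ltNge; apply/negP => te.
  have : T <= t by apply: ge_inf; [case: Kinf|split => //; rewrite at_ (le_trans (ltW tT))].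
  by rewrite leNgt tT.
apply/ler_addgt0Pr => h h0.
have h10 : 0 < h / (2 * (m + 1)) by rewrite divr_gt0// mulr_gt0// ltr_wpDl.
have Tab : a <= T <= b by rewrite aT Tb.
have [d d0 Hd] := within_dist cg Tab h10.
have Te : e <= mod (gamma T - z) + h / (2 * (m + 1)).
  have [t [tab te] tT] := inf_adherent d0 Kinf.
  have Tt : T <= t by apply: ge_inf; [case: Kinf|].
  have := Hd t tab; rewrite ger0_norm ?subr_ge0// ltrBlDl => /(_ tT) => H.
  apply: le_trans te _; apply: le_trans (modulusB_tri (gamma T) _ _) _.
  by rewrite addrC lerD2l ltW.
(* If the exit time is [a], then [e] itself is within the slack, and nonnegativity of the length is
   enough. *)
have [aT'|Ta] := ltP a T; last first.
  have E : T = a by apply: le_anti; rewrite aT Ta.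
  move: Te; rewrite E ga subrr modulus0 add0r => /(ler_wpM2l m0) Te.
  apply: le_trans Te _; apply: le_trans (_ : h <= _); last by rewrite lerDr; exact: rho_length_ge0 J.
  rewrite mulrA ler_pdivrMr ?mulr_gt0 ?ltr_wpDl// mulrC; apply: ler_wpM2l; first exact: ltW.
  move: m0; lra.
pose t := Num.max a (T - d / 2).
have at_ : a <= t by rewrite le_max lexx.
have tT : t < T by rewrite gt_max aT' /= gtrBl divr_gt0.
have tb : t <= b := le_trans (ltW tT) Tb.
have tab : a <= t <= b by rewrite at_.
have tTd : `|t - T| < d.
  have : T - d / 2 <= t by rewrite le_max lexx orbT.
  rewrite distrC ger0_norm; last by rewrite subr_ge0 ltW.
  move: d0; lra.
have := Hd t tab tTd; rewrite modulusB => tclose.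
have Lt : m * mod (gamma t - z) <= rint a t (dens gamma).
  rewrite -{1}ga; apply: L => // s /andP[as_ st].
  apply: mrho; first by apply: gD'; rewrite as_ (le_trans st).
  by apply: before => //; exact: le_lt_trans tT.
have Ltot : rint a t (dens gamma) <= rho_length rho a b gamma.
  rewrite /rho_length (rint_chasles at_ tb Id) lerDl; apply: Rintegral_ge0 => s.
  rewrite /= in_itv /= => /andP[ts sb]; rewrite mulr_ge0 ?speed_ge0//; apply/ltW/rho0.
  by apply: gD'; rewrite sb (le_trans at_).
have e2 : e <= mod (gamma t - z) + h / (m + 1).
  apply: le_trans Te _.
  have := modulusB_tri (gamma t) (gamma T) z => H.
  rewrite (_ : h / (m + 1) = h / (2 * (m + 1)) + h / (2 * (m + 1))).
    move: H tclose; lra.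
  by field; rewrite gt_eqF// ltr_wpDl.
apply: le_trans (ler_wpM2l m0 e2) _; rewrite mulrDr; apply: lerD.
  exact: le_trans Lt Ltot.
by rewrite mulrA ler_pdivrMr ?ltr_wpDl// mulrC; apply: ler_wpM2l; [exact: ltW|rewrite lerDl].
Qed.

End density.
End curves.

(** * Translation and reflection in integrals *)

Section affine_substitution.
Variable R : realType.
Local Notation mu := (@lebesgue_measure R).
Local Notation rint a b f := (\int[mu]_(x in `[a, b]) f x).
Implicit Types (a b m : R).

Lemma preimage_shift_itv a b m (b0 b1 : bool) :
  (fun x => x + m) @^-1` [set` Interval (BSide b0 a) (BSide b1 b)] =
  [set` Interval (BSide b0 (a - m)) (BSide b1 (b - m))].
Proof.
apply/seteqP; split=> x /=; rewrite !in_itv /=; case: b0 b1 => [] [] /=;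
  rewrite ?lerBlDr ?lerBrDr ?ltrBlDr ?ltrBrDr//.
Qed.

Lemma measurable_shift m : measurable_fun setT (fun x : R => x + m).
Proof. exact: measurable_funD. Qed.

Lemma lebesgue_measure_shift m (A : set R) : measurable A ->
  pushforward mu ((fun x : R => x + m) : _ -> measurableTypeR R) A = mu A.
Proof.
move=> mA; apply/esym/lebesgue_measure_unique => //=; first exact: measurable_shift.
move=> ms _ [[a b]] _ <-.
rewrite /pushforward preimage_shift_itv /= !lebesgue_measure_itv /= !lte_fin.
by rewrite ltrD2r; case: ifP => // _; rewrite -!EFinD; congr EFin; ring.
Qed.

Lemma nnint_shift m (D : set R) (f : R -> \bar R) : measurable D -> measurable_fun D f ->
  (forall x, D x -> 0 <= f x)%E ->
  (\int[mu]_(x in D) f x = \int[mu]_(x in (fun x => x + m)%R @^-1` D) f (x + m)%R)%E.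
Proof.
move=> mD mf f0; have f0' : {in D, forall x, (0 <= f x)%E} by move=> x /set_mem; exact: f0.
have E := @ge0_integral_pushforward _ _ (measurableTypeR R) (measurableTypeR R) R
  (fun x : R => x + m) (measurable_shift m) mu D f mD mf f0'.
transitivity (\int[pushforward mu ((fun x : R => x + m)%R : _ -> measurableTypeR R)]_(x in D) f x)%E; last exact: E.
apply: eq_measure_integral => //=; first exact: measurable_shift.
by move=> ms A mA AS; exact/esym/lebesgue_measure_shift.
Qed.

Lemma nnint_opp (D : set R) (f : R -> \bar R) : measurable D -> measurable_fun D f ->
  (forall x, D x -> 0 <= f x)%E ->
  (\int[mu]_(x in D) f x = \int[mu]_(x in -%R @^-1` D) f (- x)%R)%E.
Proof.
move=> mD mf f0; have f0' : {in D, forall x, (0 <= f x)%E} by move=> x /set_mem; exact: f0.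
have mN : measurable_fun setT (-%R : R -> R) by exact: oppr_measurable.
have E := @ge0_integral_pushforward _ _ (measurableTypeR R) (measurableTypeR R) R
  -%R mN mu D f mD mf f0'.
transitivity (\int[pushforward mu (-%R : _ -> measurableTypeR R)]_(x in D) f x)%E; last exact: E.
by apply: eq_measure_integral => //= A mA AS; exact/esym/lebesgue_measureN.
Qed.

Lemma rint_shift m a b (f : R -> R) : mu.-integrable `[a, b] (EFin \o f) ->
  (forall x, a <= x <= b -> 0 <= f x) ->
  rint a b f = rint (a - m) (b - m) (fun x => f (x + m)).
Proof.
move=> If f0; rewrite /Rintegral (@nnint_shift m)//.
- by rewrite preimage_shift_itv.
- exact: measurable_int If.
Qed.

Lemma rint_opp a b (f : R -> R) : mu.-integrable `[a, b] (EFin \o f) ->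
  (forall x, a <= x <= b -> 0 <= f x) ->
  rint a b f = rint (- b) (- a) (fun x => f (- x)).
Proof.
move=> If f0; rewrite /Rintegral nnint_opp//.
- by rewrite opp_preimage_itvbndbnd.
- exact: measurable_int If.
Qed.

End affine_substitution.

(** * Translation, concatenation and reversal of curves, and segments *)

Section curve_operations.
Variable R : realType.
Local Notation C := (cplx R).
Local Notation mu := (@lebesgue_measure R).
Local Notation mod := (@modulus R).
Local Notation rint a b f := (\int[mu]_(x in `[a, b]) f x).
Local Notation integ a b f := (mu.-integrable `[a, b] (EFin \o f)).
Variables (D : set C) (rho : C -> R).
Hypothesis rhoc : forall z, D z -> {for z, continuous rho}.
Hypothesis rho0 : forall z, D z -> 0 < rho z.
Implicit Types (gamma : R -> C) (z w : C).

Let dens gamma t := rho (gamma t) * speed gamma t.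

Lemma within_precomp (T U V : topologicalType) (A : set T) (B : set U) (phi : T -> U) (f : U -> V) :
  continuous phi -> (forall x, A x -> B (phi x)) ->
  {within B, continuous f} -> {within A, continuous (f \o phi)}.
Proof.
move=> cphi AB cf; rewrite continuous_subspace_in => x /set_mem Ax W /= fW.
have : nbhs_subspace (A := B) (phi x) (f @^-1` W) by exact: (cf (phi x) W fW).
rewrite -(nbhs_subspace_in (AB x Ax)) => H.
have : nbhs_subspace (A := A) x ((f \o phi) @^-1` W).
  rewrite -(nbhs_subspace_in Ax).
  have H' : \forall y \near x, B (phi y) -> W (f (phi y)) := cphi x _ H.
  by apply: filterS H' => y h Ay; apply: h; exact: AB.
by [].
Qed.

Lemma derive1_shift (u : R -> R) (m t : R) : derive1 (fun x => u (x + m)) t = derive1 u (t + m).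
Proof. by rewrite /derive1; under eq_fun do rewrite -addrA. Qed.

Lemma derivable_affine (u : R -> R) (k m t : R) : derivable u (k * t + m) 1 ->
  derivable (fun x => u (k * x + m)) t 1 /\ derive1 (fun x => u (k * x + m)) t = k * derive1 u (k * t + m).
Proof.
move=> du; have da : is_derive t (1 : R) (fun x : R => k * x + m) k.
  by apply: is_derive_eq; rewrite addr0 [k%:A]mulr1.
have du' : is_derive (k * t + m) (1 : R) u (derive1 u (k * t + m)).
  by split => //; rewrite derive1E.
have [d1 d2] := @is_derive1_comp _ u (fun x : R => k * x + m) t _ _ du' da; split => //.
by rewrite derive1E mulrC; exact: d2.
Qed.

(** Serves translation with [k = 1] and reversal with [k = -1]; stating the inclusions of intervals
    as hypotheses avoids a distinction on the sign of [k]. *)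
Lemma C1_between_affine (u : R -> R) (a b k m a' b' : R) :
  (forall t, a' < t < b' -> a < k * t + m < b) ->
  (forall t, a' <= t <= b' -> a <= k * t + m <= b) ->
  C1_between a b u -> C1_between a' b' (fun x => u (k * x + m)).
Proof.
move=> Hoo Hcc [du [v [cv vE]]]; split=> [t|].
  by rewrite in_itv /= => /Hoo tab; apply: (derivable_affine _).1; apply: du; rewrite in_itv.
exists (fun t => k * v (k * t + m)); split.
  have cphi : continuous (fun t : R => k * t + m).
    by move=> t; apply: continuousD; [apply: continuousM; [exact: cvg_cst|exact: cvg_id]|exact: cvg_cst].
  have c1 : {within `[a', b'], continuous (v \o (fun t => k * t + m))}.
    by apply: within_precomp cv => // t; rewrite /= !in_itv /=; exact: Hcc.
  by move=> t; apply: (continuousM _ (c1 t)); exact: cvg_cst.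
move=> t; rewrite in_itv /= => /Hoo tab.
by rewrite (derivable_affine _).2 ?vE ?in_itv//; apply: du; rewrite in_itv.
Qed.

Lemma pieces_shift gamma m a s b : pieces gamma a s b ->
  pieces (fun t => gamma (t + m)) (a - m) [seq x - m | x <- s] (b - m).
Proof.
elim: s a => [|c s IH] a /= => [->//|[ac [Cr Ci] /IH{}IH]].
have Hoo t : a - m < t < c - m -> a < 1 * t + m < c by rewrite mul1r; lra.
have Hcc t : a - m <= t <= c - m -> a <= 1 * t + m <= c by rewrite mul1r; lra.
split => //; first by rewrite ltrD2r.
by split; [have := C1_between_affine Hoo Hcc Cr|have := C1_between_affine Hoo Hcc Ci];
  under eq_fun do rewrite mul1r.
Qed.

Lemma joins_shift gamma m a b z w : joins D a b gamma z w ->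
  joins D (a - m) (b - m) (fun t => gamma (t + m)) z w /\
  rho_length rho (a - m) (b - m) (fun t => gamma (t + m)) = rho_length rho a b gamma.
Proof.
move=> J; have [Id _] := joins_density rhoc J.
have [ab /piecewise_C1P[cg [s ps]] gD ga gb] := J; split.
  split; [by rewrite ltrD2r| | |by rewrite subrK|by rewrite subrK]; last first.
    by move=> t; rewrite in_itv /= => tab; apply: gD; rewrite in_itv /=; lra.
  apply/piecewise_C1P; split; last by exists [seq x - m | x <- s]; exact: pieces_shift.
  have cphi : continuous (fun t : R => t + m).
    by move=> t; apply: continuousD; [exact: cvg_id|exact: cvg_cst].
  apply: (within_precomp cphi _ cg).
  by move=> t; rewrite /= !in_itv /=; lra.
rewrite /rho_length [RHS](rint_shift m Id).
  by apply: eq_Rintegral => t _; rewrite /speed -(derive1_shift (re_part gamma)) -(derive1_shift (im_part gamma)).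
move=> x xab; rewrite mulr_ge0 ?speed_ge0//; apply/ltW/rho0/gD; rewrite in_itv//.
Qed.

Lemma joins_glue f g a b c z w y : joins D a b f z w -> joins D b c g w y ->
  exists h, joins D a c h z y /\
    rho_length rho a c h = rho_length rho a b f + rho_length rho b c g.
Proof.
move=> J1 J2; have [If _] := joins_density rhoc J1.
have [Ig _] := joins_density rhoc J2.
have [ab /piecewise_C1P[cf [s ps]] fD fa fb] := J1.
have [bc /piecewise_C1P[cg [s' ps']] gD gb gc] := J2.
pose h t := if t <= b then f t else g t.
have hf : {in `[a, b], h =1 f} by move=> t; rewrite in_itv /h /= => /andP[_ ->].
have hg : {in `[b, c], h =1 g}.
  move=> t; rewrite in_itv /h /= => /andP[bt _]; case: ifP => // tb.
  have E : t = b by apply/le_anti; rewrite tb bt.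
  by rewrite E fb gb.
have hfo : {in `]a, b[, f =1 h} by move=> t tab; rewrite hf// subset_itv_oo_cc.
have hgo : {in `]b, c[, g =1 h} by move=> t tab; rewrite hg// subset_itv_oo_cc.
have J : joins D a c h z y.
  split.
  - exact: lt_trans bc.
  - apply/piecewise_C1P; split.
      have -> : `[a, c]%classic = `[a, b] `|` `[b, c] :> set R.
        rewrite eqEsubset; split=> t /=; rewrite !in_itv /=; last by case; move: ab bc; lra.
        by move=> /andP[at_ tc]; case: (leP t b) => tb; [left|right]; rewrite ?at_ ?tc ?tb ?(ltW tb).
      apply: withinU_continuous; try exact: interval_closed.
        by apply: (subspace_eq_continuous _ cf) => t /set_mem tab; exact/esym/hf.
      by apply: (subspace_eq_continuous _ cg) => t /set_mem tab; exact/esym/hg.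
    by exists (s ++ s'); apply: pieces_cat; [apply: pieces_eq ps|apply: pieces_eq ps'].
  - move=> t; rewrite in_itv /= => /andP[at_ tc]; have [tb|tb] := leP t b.
      by rewrite hf ?in_itv /= ?at_ ?tb//; apply: fD; rewrite in_itv /= at_.
    by rewrite hg ?in_itv /= ?tc ?(ltW tb)//; apply: gD; rewrite in_itv /= tc ltW.
  - by rewrite hf ?in_itv /= ?lexx ?ltW.
  - by rewrite hg ?in_itv /= ?lexx ?andbT ?ltW.
exists h; split => //; have [Ih _] := joins_density rhoc J.
rewrite /rho_length (rint_chasles (ltW ab) (ltW bc) Ih).
have Ef : {in `]a, b[, dens h =1 dens f}.
  by move=> t tab; rewrite /dens (speed_eq hfo tab) hfo.
have Eg : {in `]b, c[, dens h =1 dens g}.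
  by move=> t tab; rewrite /dens (speed_eq hgo tab) hgo.
by rewrite (oo_measurable_integ Ef If).2 (oo_measurable_integ Eg Ig).2.
Qed.

Lemma joins_cat f a b z w g a' b' y : joins D a b f z w -> joins D a' b' g w y ->
  exists c h, joins D a c h z y /\
    rho_length rho a c h = rho_length rho a b f + rho_length rho a' b' g.
Proof.
move=> J1 /(joins_shift (a' - b)) [J2 <-].
rewrite subKr in J2 *; exists (b' - (a' - b)).
exact: joins_glue J1 J2.
Qed.

Lemma pieces_opp gamma a s b : pieces gamma a s b ->
  exists s', pieces (gamma \o -%R) (- b) s' (- a).
Proof.
elim: s a => [|c s IH] a /= => [->|[ac [Cr Ci] /IH[s' ps']]]; first by exists [::].
exists (s' ++ [:: - a]); apply: pieces_cat ps' _.
have Hoo t : - c < t < - a -> a < (-1) * t + 0 < c by rewrite mulN1r addr0; lra.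
have Hcc t : - c <= t <= - a -> a <= (-1) * t + 0 <= c by rewrite mulN1r addr0; lra.
split => //; first by rewrite ltrN2.
by split; [have := C1_between_affine Hoo Hcc Cr|have := C1_between_affine Hoo Hcc Ci];
  under eq_fun do rewrite mulN1r addr0.
Qed.

Lemma piece_dens_opp gamma a c : C1_piece a c gamma ->
  {in `](- c), (- a)[, dens (gamma \o -%R) =1 (fun t => dens gamma (- t))}.
Proof.
move=> [[dr _] [di _]] t; rewrite in_itv /= => tac.
have tac' : - t \in `]a, c[ by rewrite in_itv /=; lra.
rewrite /dens /speed; congr (_ * _).
have E (u : R -> R) : derivable u (- t) 1 -> derive1 (u \o -%R) t = - derive1 u (- t).
  move=> du; have := @derivable_affine u (-1) 0 t; rewrite mulN1r addr0 => /(_ du)[_].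
  by rewrite mulN1r => <-; congr derive1; apply/funext => x; rewrite mulN1r addr0.
have -> : derive1 (re_part (gamma \o -%R)) t = - derive1 (re_part gamma) (- t).
  exact: E (dr _ tac').
have -> : derive1 (im_part (gamma \o -%R)) t = - derive1 (im_part gamma) (- t).
  exact: E (di _ tac').
exact: (modulusN (Complex _ _)).
Qed.

(** The chain rule for the reversed curve holds where the curve is differentiable, hence inside the
    pieces and not at the breakpoints; the two densities are compared piece by piece. *)
Lemma pieces_length_opp gamma a s b : pieces gamma a s b ->
  (forall t, a <= t <= b -> D (gamma t)) ->
  integ a b (dens gamma) -> integ (- b) (- a) (dens (gamma \o -%R)) ->
  rint (- b) (- a) (dens (gamma \o -%R)) = rint a b (dens gamma).
Proof.
elim: s a => [|c s IH] a /=; first by move=> -> *; rewrite !set_itv1 !Rintegral_set1.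
move=> [ac C1 pcb] gD I1 I2; have cb := pieces_le pcb.
have Hac : - c <= - a by rewrite lerN2 ltW.
have Hcb : - b <= - c by rewrite lerN2.
have S1 := rint_chasles (ltW ac) cb I1; 
have S2 : rint (- b) (- a) (dens (gamma \o -%R)) = rint (- b) (- c) (dens (gamma \o -%R)) + rint (- c) (- a) (dens (gamma \o -%R)).
  by exact: (@rint_chasles R (- b) (- c) (- a) _ Hcb Hac I2).
have Iac : integ a c (dens gamma) := integrable_subitv (lexx a) cb I1.
have d0 x : a <= x <= c -> 0 <= dens gamma x.
  move=> /andP[ax xc]; rewrite mulr_ge0 ?speed_ge0//; apply/ltW/rho0/gD.
  by rewrite ax (le_trans xc).
have Iac' : integ (- c) (- a) (dens (gamma \o -%R)) := integrable_subitv Hcb (lexx _) I2.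
have E1 : rint (- c) (- a) (dens (gamma \o -%R)) = rint a c (dens gamma).
  apply: etrans _ (esym (rint_opp Iac d0)).
  have E : {in `](- c), (- a)[, (fun t => dens gamma (- t)) =1 dens (gamma \o -%R)}.
    by move=> t tca; rewrite (piece_dens_opp C1).
  exact: (esym (oo_measurable_integ E Iac').2).
have E2 : rint (- b) (- c) (dens (gamma \o -%R)) = rint c b (dens gamma).
  have I1' : integ c b (dens gamma) := integrable_subitv (ltW ac) (lexx b) I1.
  have I2' : integ (- b) (- c) (dens (gamma \o -%R)) := integrable_subitv (lexx _) Hac I2.
  apply: (IH c pcb _ I1' I2').
  by move=> t /andP[ct tb]; apply: gD; rewrite tb (le_trans (ltW ac)).
transitivity (rint c b (dens gamma) + rint a c (dens gamma)).
  by rewrite -E1 -E2; exact: S2.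
by rewrite addrC; exact: (esym S1).
Qed.

Lemma joins_opp gamma a b z w : joins D a b gamma z w ->
  joins D (- b) (- a) (gamma \o -%R) w z /\
  rho_length rho (- b) (- a) (gamma \o -%R) = rho_length rho a b gamma.
Proof.
move=> J; have [Id _] := joins_density rhoc J.
have [ab /piecewise_C1P[cg [s ps]] gD ga gb] := J.
have J' : joins D (- b) (- a) (gamma \o -%R) w z.
  split; [by rewrite ltrN2| | |by rewrite /= opprK|by rewrite /= opprK]; last first.
    by move=> t; rewrite in_itv /= => tab; apply: gD; rewrite in_itv /=; lra.
  apply/piecewise_C1P; split; last exact: pieces_opp ps.
  have cphi : continuous (-%R : R -> R) by move=> t; apply: continuousN; exact: cvg_id.
  apply: (within_precomp cphi _ cg).
  by move=> t; rewrite /= !in_itv /=; lra.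
split; first exact: J'.
have [Id' _] := joins_density rhoc J'.
have gD' t : a <= t <= b -> D (gamma t) by move=> tab; apply: gD; rewrite in_itv.
exact: (pieces_length_opp ps gD' Id Id').
Qed.

Lemma joins_segment z w (M : R) : (forall t, 0 <= t <= 1 -> D (z + cr t * (w - z))) ->
  (forall t, 0 <= t <= 1 -> rho (z + cr t * (w - z)) <= M) ->
  exists gamma, joins D 0 1 gamma z w /\ rho_length rho 0 1 gamma <= M * mod (w - z).
Proof.
move=> sD sM; pose gamma t : C := z + cr t * (w - z).
have dre t : is_derive t (1 : R) (re_part gamma) (complex.Re (w - z)).
  rewrite (_ : re_part gamma = fun t => complex.Re (w - z) * t + complex.Re z); last first.
    by apply/funext => x; rewrite /re_part /gamma ReD ReM /=; ring.
  by apply: is_derive_eq; rewrite addr0 [_%:A]mulr1.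
have dim t : is_derive t (1 : R) (im_part gamma) (complex.Im (w - z)).
  rewrite (_ : im_part gamma = fun t => complex.Im (w - z) * t + complex.Im z); last first.
    by apply/funext => x; rewrite /im_part /gamma ImD ImM /=; ring.
  by apply: is_derive_eq; rewrite addr0 [_%:A]mulr1.
have C1 (u : R -> R) (l : R) : (forall t, is_derive t (1 : R) u l) -> C1_between 0 1 u.
  move=> ud; split=> [t _|]; first by case: (ud t).
  exists (fun=> l); split; first by move=> t; exact: cvg_cst.
  by move=> t _; rewrite derive1E; case: (ud t).
have cg : continuous gamma.
  move=> t; rewrite (_ : gamma = fun t => Complex (re_part gamma t) (im_part gamma t)).
    by apply: continuous_Complex; apply: differentiable_continuous; apply/derivable1_diffP; [case: (dre t)|case: (dim t)].
  by apply/funext => x; rewrite /re_part /im_part; case: (gamma x).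
have J : joins D 0 1 gamma z w.
  split => //.
  - apply/piecewise_C1P; split; first exact: continuous_subspaceT.
    by exists [:: 1]; split => //; split; [exact: C1 dre|exact: C1 dim].
  - by rewrite /gamma (_ : cr 0 = 0)// mul0r addr0.
  - by rewrite /gamma (_ : cr 1 = 1)// mul1r subrKC.
exists gamma; split => //; have [Id _] := joins_density rhoc J.
rewrite -[leRHS]mulr1 -[X in _ * X](subr0 1) -rint_cst//; apply: le_Rintegral => //.
  by apply: pointwise_continuous_integrable => t _; exact: cvg_cst.
move=> t; rewrite /= in_itv /= => t01; have -> : speed gamma t = mod (w - z).
  have [_ Er] := dre t; have [_ Ei] := dim t.
  by rewrite /speed !derive1E Er Ei; case: (w - z).
by apply: ler_wpM2r; [exact: modulus_ge0|exact: sM].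
Qed.

End curve_operations.

(** * The distance of a metric *)

Section rho_distance.
Variable R : realType.
Local Notation C := (cplx R).
Local Notation mod := (@modulus R).
Variables (D : set C) (rho : C -> R).
Hypothesis Do : open D.
Hypothesis Dc : connected D.
Hypothesis rhoc : forall z, D z -> {for z, continuous rho}.
Hypothesis rho0 : forall z, D z -> 0 < rho z.
Local Notation d := (rho_dist D rho).
Implicit Types (z w : C).

Lemma disc_convex z w1 w2 (e t : R) : mod (w1 - z) < e -> mod (w2 - z) < e -> 0 <= t <= 1 ->
  mod (w1 + cr t * (w2 - w1) - z) < e.
Proof.
move=> w1e w2e /andP[t0 t1].
have -> : w1 + cr t * (w2 - w1) - z = cr (1 - t) * (w1 - z) + cr t * (w2 - z).
  have -> : cr (1 - t) = 1 - cr t by apply/eqP; rewrite eq_complex /= oppr0 addr0 !eqxx.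
  ring.
apply: le_lt_trans (modulusD _ _) _; rewrite !modulusM !modulus_real ger0_norm ?subr_ge0// ger0_norm//.
have [->|t0'] := eqVneq t 0; first by rewrite mul0r addr0 subr0 mul1r.
have : t * mod (w2 - z) < t * e by rewrite ltr_pM2l// lt_neqAle eq_sym t0'.
have : (1 - t) * mod (w1 - z) <= (1 - t) * e by apply: ler_wpM2l (ltW w1e); rewrite subr_ge0.
lra.
Qed.

Lemma rho_local z (e : R) : D z -> 0 < e ->
  exists2 r : R, 0 < r & forall w, mod (w - z) < r -> D w /\ `|rho w - rho z| < e.
Proof.
move=> Dz e0; have [r1 r10 H1] := (open_modP D).1 Do z Dz.
have /nbhs_modP[r2 r20 H2] : \forall w \near z, `|rho w - rho z| < e.
  have : rho w @[w --> z] --> rho z := rhoc Dz.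
  by move=> /cvgrPdist_lt/(_ e e0); apply: filterS => w; rewrite distrC.
exists (Num.min r1 r2); first by rewrite lt_min r10.
by move=> w; rewrite lt_min => /andP[/H1 ? /H2].
Qed.

Lemma join_local z (e : R) : D z -> 0 < e ->
  exists2 r : R, 0 < r & forall w1 w2, mod (w1 - z) < r -> mod (w2 - z) < r ->
    exists gamma, joins D 0 1 gamma w1 w2 /\
      rho_length rho 0 1 gamma <= (rho z + e) * mod (w2 - w1).
Proof.
move=> Dz e0; have [r r0 H] := rho_local Dz e0; exists r => // w1 w2 w1r w2r.
apply: joins_segment => // t t01.
  by case: (H _ (disc_convex w1r w2r t01)).
have [_] := H _ (disc_convex w1r w2r t01).
by rewrite ltr_norml => /andP[_ h]; rewrite -lerBlDl ltW.
Qed.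

Lemma join_exists z w : D z -> D w -> exists a b gamma, joins D a b gamma z w.
Proof.
move=> Dz; pose J := [set w | D w /\ exists a b gamma, joins D a b gamma z w].
suff E : J = D by move=> Dw; have [_] : J w by rewrite E.
(* [J] is nonempty, open, and relatively closed in [D]: around a point of [D] every nearby point is
   joined to it by a segment, so both [J] and its complement in [D] are open. *)
apply: Dc.
- exists z; split => //; have [r r0 H] := join_local Dz ltr01.
  have zr : mod (z - z) < r by rewrite subrr modulus0.
  by have [gamma [g _]] := H _ _ zr zr; exists 0, 1, gamma.
- exists J; last by apply/seteqP; split=> [y [Dy Jy]|y []].
  apply/open_modP => y [Dy [a [b [g Jg]]]]; have [r r0 H] := join_local Dy ltr01.
  have [r' r'0 H'] := (open_modP D).1 Do y Dy.
  exists (Num.min r r'); first by rewrite lt_min r0.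
  move=> x; rewrite lt_min => /andP[xr xr']; split; first exact: H'.
  have yr : mod (y - y) < r by rewrite subrr modulus0.
  have [g' [Jg' _]] := H _ _ yr xr.
  by have [c [h [Jh _]]] := joins_cat rhoc rho0 Jg Jg'; exists a, c, h.
- exists (~` (D `\` J)).
    apply: open_closedC; apply/open_modP => y [Dy nJ]; have [r r0 H] := join_local Dy ltr01.
    have [r' r'0 H'] := (open_modP D).1 Do y Dy.
    exists (Num.min r r'); first by rewrite lt_min r0.
    move=> x; rewrite lt_min => /andP[xr xr']; split; first exact: H'.
    move=> [Dx [a [b [g Jg]]]]; apply: nJ; split => //.
    have yr : mod (y - y) < r by rewrite subrr modulus0.
    have [g' [Jg' _]] := H _ _ xr yr.
    by have [c [h [Jh _]]] := joins_cat rhoc rho0 Jg Jg'; exists a, c, h.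
  apply/seteqP; split=> [y Jy|y [Dy nn]].
    by split; [case: Jy|case].
  by apply: contrapT => nJ; apply: nn.
Qed.

Let lengths z w := [set L | exists a b gamma,
  joins D a b gamma z w /\ L = rho_length rho a b gamma].

Lemma lengths_lb z w : lbound (lengths z w) 0.
Proof. by move=> _ [a [b [g [J ->]]]]; exact: (rho_length_ge0 rho0 J). Qed.

Lemma has_inf_lengths z w : D z -> D w -> has_inf (lengths z w).
Proof.
move=> Dz Dw; split; last by exists 0; exact: lengths_lb.
by have [a [b [g J]]] := join_exists Dz Dw; exists (rho_length rho a b g), a, b, g.
Qed.

Lemma dist_le_length a b gamma z w : joins D a b gamma z w -> d z w <= rho_length rho a b gamma.
Proof. by move=> J; apply: ge_inf; [exists 0; exact: lengths_lb|exists a, b, gamma]. Qed.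

Lemma dist_ge0 z w : 0 <= d z w.
Proof.
(* For points outside [D] the set of lengths may be empty; its [inf] is then 0. *)
have [L0|/set0P L0] := eqVneq (lengths z w) set0; last first.
  by apply: lb_le_inf => //; exact: lengths_lb.
by rewrite /rho_dist -/(lengths z w) L0 inf0.
Qed.

Lemma le_dist z w (c : R) : D z -> D w ->
  (forall a b gamma, joins D a b gamma z w -> c <= rho_length rho a b gamma) -> c <= d z w.
Proof.
move=> Dz Dw H; apply: lb_le_inf; first by case: (has_inf_lengths Dz Dw).
by move=> _ [a [b [g [J ->]]]]; exact: H J.
Qed.

Lemma dist_tri y z w : D y -> D z -> D w -> d z w <= d z y + d y w.
Proof.
move=> Dy Dz Dw; rewrite -lerBlDr; apply: le_dist => // a b f Jf.
rewrite lerBlDr addrC -lerBlDr; apply: le_dist => // a' b' g Jg.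
rewrite lerBlDr addrC.
have [c [h [Jh <-]]] := joins_cat rhoc rho0 Jf Jg; exact: dist_le_length Jh.
Qed.

Lemma dist_le_sym z w : D z -> D w -> d z w <= d w z.
Proof.
move=> Dz Dw; apply: le_dist => // a b g Jg.
by have [Jo <-] := joins_opp rhoc rho0 Jg; exact: dist_le_length Jo.
Qed.

Lemma dist_sym z w : D z -> D w -> d z w = d w z.
Proof. by move=> Dz Dw; apply/le_anti; rewrite !dist_le_sym. Qed.

Lemma dist_exit z w (m e : R) : D z -> D w -> 0 <= m ->
  (forall y, D y -> mod (y - z) < e -> m <= rho y) ->
  m * Num.min e (mod (w - z)) <= d z w.
Proof.
by move=> Dz Dw m0 mrho; apply: le_dist => // a b g J; exact: (rho_length_exit rhoc rho0 J m0 mrho).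
Qed.

Lemma dist_lower z w (m : R) : D z -> D w -> 0 <= m -> (forall y, D y -> m <= rho y) ->
  m * mod (w - z) <= d z w.
Proof.
move=> Dz Dw m0 mrho; have := @dist_exit z w m (mod (w - z)) Dz Dw m0 (fun y Dy _ => mrho y Dy).
by rewrite minxx.
Qed.

(** The segment gives the upper bound. The lower bound concerns all curves, including those that
    leave the small disc on which [rho] is close to [rho z]; [dist_exit] deals with them. *)
Lemma dist_asymptotic z (e : R) : D z -> 0 < e ->
  exists2 r : R, 0 < r & forall w, mod (w - z) < r ->
    D w /\ `|d z w - rho z * mod (w - z)| <= e * mod (w - z).
Proof.
move=> Dz e0; have [r1 r10 H1] := join_local Dz e0.
have [r2 r20 H2] := rho_local Dz e0.
exists (Num.min r1 r2); first by rewrite lt_min r10.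
move=> w; rewrite lt_min => /andP[wr1 wr2]; have [Dw _] := H2 w wr2; split => //.
have zr : mod (z - z) < r1 by rewrite subrr modulus0.
have [g [Jg Lg]] := H1 _ _ zr wr1.
have up := le_trans (dist_le_length Jg) Lg.
(* [rho z - e] may be negative, while [dist_exit] requires a nonnegative lower bound of the
   density. *)
have m0 : 0 <= Num.max 0 (rho z - e) by rewrite le_max lexx.
have := @dist_exit z w (Num.max 0 (rho z - e)) r2 Dz Dw m0.
rewrite (min_idPr (ltW wr2)) => lo.
have {}lo : (rho z - e) * mod (w - z) <= d z w.
  apply: le_trans (lo _); last first.
    move=> y Dy yr; rewrite ge_max ltW ?rho0//=.
    have [_] := H2 y yr; rewrite ltr_norml => /andP[h _].
    by rewrite lerBlDr -lerBlDl; move: h; lra.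
  by apply: ler_wpM2r; [exact: modulus_ge0|rewrite le_max lexx orbT].
by rewrite ler_norml; move: up lo; rewrite mulrDl mulrBl; lra.
Qed.

Lemma distxx z : D z -> d z z = 0.
Proof.
move=> Dz; have [r r0 H] := dist_asymptotic Dz ltr01.
have zr : mod (z - z) < r by rewrite subrr modulus0.
by have [_] := H z zr; rewrite subrr modulus0 !mulr0 subr0 normr_le0 => /eqP.
Qed.

Lemma dist_near z (e : R) : D z -> 0 < e ->
  exists2 r : R, 0 < r & forall w, mod (w - z) < r -> D w /\ d z w < e.
Proof.
move=> Dz e0; have [r r0 H] := dist_asymptotic Dz ltr01.
have k0 : 0 < rho z + 1 by rewrite addr_gt0// rho0.
exists (Num.min r (e / (rho z + 1))); first by rewrite lt_min r0 divr_gt0.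
move=> w; rewrite lt_min ltr_pdivlMr// => /andP[/H[Dw]]; rewrite ler_norml => /andP[_ h] we.
split => //; apply: le_lt_trans we.
by rewrite mulrC mulrDl; move: h; lra.
Qed.

Lemma dist_quad z w z' w' : D z -> D w -> D z' -> D w' ->
  `|d z' w' - d z w| <= d z z' + d w w'.
Proof.
move=> Dz Dw Dz' Dw'.
have h1 := dist_tri Dz Dz' Dw'; have h2 := dist_tri Dw Dz Dw'.
have h3 := dist_tri Dz' Dz Dw; have h4 := dist_tri Dw' Dz' Dw.
rewrite (dist_sym Dz' Dz) in h1; rewrite (dist_sym Dw' Dw) in h4.
by rewrite ler_norml; lra.
Qed.

Lemma dist_cvg (T : Type) (G : set_system T) {FG : Filter G} (u v : T -> C) z w : D z -> D w ->
  u @ G --> z -> v @ G --> w -> (fun x => d (u x) (v x)) @ G --> d z w.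
Proof.
move=> Dz Dw uz vw; apply/cvgrPdist_lt => e e0.
have e20 : 0 < e / 2 by rewrite divr_gt0.
have [r1 r10 H1] := dist_near Dz e20; have [r2 r20 H2] := dist_near Dw e20.
have U := (cvg_modP (FF := FG) _ _).1 uz r1 r10; have V := (cvg_modP (FF := FG) _ _).1 vw r2 r20.
apply: filterS2 U V => x /H1[Du du] /H2[Dv dv].
rewrite distrC; apply: le_lt_trans (dist_quad Dz Dw Du Dv) _.
by rewrite [ltRHS](splitr e) ltrD.
Qed.

(** The expansion of [d] about [f z] is composed with that of [f] about [z]. Both are inequalities
    without division, so the case [l = 0], or [f w = f z], is not special. *)
Lemma dist_ratio_cvg (f : C -> C) z (l : C) : D (f z) -> cdiff f z l ->
  d (f z) (f w) / mod (z - w) @[w --> z^'] --> rho (f z) * mod l.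
Proof.
move=> Dfz dfz; apply/cvgrPdist_lt => e e0.
have k0 : 0 < rho (f z) + mod l + 1 + 1.
  by rewrite addr_gt0// ltr_wpDl// addr_ge0 ?modulus_ge0// ltW// rho0.
(* [s <= 1] gives [mod (f w - f z) <= (mod l + 1) * mod (w - z)]; the two errors then add up to at
   most [s * (rho (f z) + mod l + 1) * mod (w - z)]. *)
pose s := Num.min 1 (e / 2 / (rho (f z) + mod l + 1 + 1)).
have s0 : 0 < s by rewrite lt_min ltr01 !divr_gt0.
have s1 : s <= 1 by rewrite ge_min lexx.
have se : s * (rho (f z) + mod l + 1 + 1) <= e / 2 by rewrite -ler_pdivlMr// ge_min lexx orbT.
have [r1 r10 H1] := dist_asymptotic Dfz s0.
have [r2 r20 H2] := dfz s s0.
have N1 : \forall w \near z^', mod (w - z) < r2 by apply: cvg_within; exact: near_mod.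
have N2 : \forall w \near z^', mod (f w - f z) < r1.
  apply: cvg_within; exact: ((continuous_modP _ _).1 (cdiff_continuous dfz) r1 r10).
have N3 : \forall w \near z^', w != z by exact: nbhs_dnbhs_neq.
apply: filterS3 N1 N2 N3 => w /H2 h2 /H1[_ h1] wz.
have m0 : 0 < mod (w - z) by rewrite modulus_gt0 subr_eq0.
have h3 : `|mod (f w - f z) - mod l * mod (w - z)| <= s * mod (w - z).
  rewrite -modulusM; apply: le_trans h2; rewrite ler_norml.
  have a1 := modulusB_ge (f w - f z) (l * (w - z)).
  have := modulusB_ge (l * (w - z)) (f w - f z); rewrite (modulusB (l * _)) => a2.
  by move: a1 a2; lra.
rewrite (modulusB z w) distrC -(ltr_pM2r m0) -[X in _ * X < _](gtr0_norm m0) -normrM mulrBl divfK ?gt_eqF//.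
set N := mod (f w - f z) in h1 h3 *; set m := mod (w - z) in m0 h3 *.
have r0 : 0 < rho (f z) := rho0 Dfz; have l0 : 0 <= mod l := modulus_ge0 l.
have N0 : 0 <= N := modulus_ge0 _.
have Nm : N <= (mod l + 1) * m.
  move: h3; rewrite ler_norml => /andP[_ h3]; have := ler_wpM2r (ltW m0) s1; rewrite mulrDl; lra.
apply: le_lt_trans (_ : s * N + rho (f z) * (s * m) < _).
  have -> : d (f z) (f w) - rho (f z) * mod l * m =
    (d (f z) (f w) - rho (f z) * N) + rho (f z) * (N - mod l * m) by ring.
  apply: le_trans (ler_normD _ _) _; apply: lerD => //.
  by rewrite normrM (gtr0_norm r0); apply: ler_wpM2l => //; exact: ltW.
apply: le_lt_trans (_ : (e / 2) * m < _); last by rewrite ltr_pM2r//; move: e0; lra.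
apply: le_trans (ler_wpM2r (ltW m0) se).
have := ler_wpM2l (ltW s0) Nm; have := mulr_ge0 (ltW s0) (ltW m0); lra.
Qed.

End rho_distance.

Section metric_continuity.
Variable R : realType.
Local Notation C := (cplx R).
Local Notation mod := (@modulus R).

Lemma metric_continuous (D : set C) (rho : C -> R) : open D -> {within D, continuous rho} ->
  forall z, D z -> {for z, continuous rho}.
Proof. by move=> Do; rewrite (continuous_open_subspace _ Do) => cr_ z Dz; apply: cr_; exact/mem_set. Qed.

End metric_continuity.

(** * Integrals of periodic functions and real inequalities *)

Section joint_measurability.
Variable R : realType.

(** Measurability in [R * R] refers to the product sigma-algebra; an open set belongs to it as a
    countable union of rational boxes. Joint measurability of the boundary distance rests on
    this. *)
Lemma open_measurable2 (U : set (R * R)) : open U -> measurable U.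
Proof.
move=> Uo; pose box (q : rat * rat * (rat * rat)) : set (R * R) :=
  `]ratr q.1.1, ratr q.1.2[%classic `*` `]ratr q.2.1, ratr q.2.2[%classic.
pose F q := [set x : R * R | box q x /\ box q `<=` U].
suff -> : U = \bigcup_q F q.
  apply: countable_bigcupT_measurable => [|q]; first exact: countableP.
  have [bU|nbU] := pselect (box q `<=` U); last first.
    by rewrite (_ : F q = set0)//; apply/seteqP; split=> x // [].
  rewrite (_ : F q = box q); last by apply/seteqP; split=> x [].
  by apply: measurableX; exact: measurable_itv.
apply/seteqP; split=> [[x y] Uxy|x [q _ [qx qU]]]; last exact: qU.
have /nbhs_ballP[e /= e0 eU] : nbhs (x, y) U by exact: open_nbhs_nbhs.
have rat_lt (u v : R) : u < v -> {q : rat | u < ratr q < v}.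
  move=> uv; apply: cid; have [q] := rat_in_itvoo uv.
  by rewrite in_itv => quv; exists q.
have lo u : u - e < u by rewrite gtrBl.
have hi u : u < u + e by rewrite ltrDl.
have [a /andP[a1 a2]] := rat_lt _ _ (lo x); have [b /andP[b1 b2]] := rat_lt _ _ (hi x).
have [c /andP[c1 c2]] := rat_lt _ _ (lo y); have [d /andP[d1 d2]] := rat_lt _ _ (hi y).
exists ((a, b), (c, d)) => //; split; first by split; rewrite /= in_itv /= ?a2 ?b1 ?c2 ?d1.
move=> [u v] [/=]; rewrite !in_itv /= => /andP[ua ub] /andP[vc vd]; apply: eU.
by split; rewrite /ball /= ltr_norml; lra.
Qed.

Lemma continuous_measurable_fun2 (f : R * R -> R) : continuous f -> measurable_fun setT f.
Proof.
move=> /continuousP cf; apply: (measurability _ (RGenOpens.measurableE R)).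
move=> _ [_ [a [b ->] <-]]; rewrite setTI; apply: open_measurable2.
exact/cf/interval_open.
Qed.

End joint_measurability.

Section periodic_integrals.
Variable R : realType.
Local Notation mu := (@lebesgue_measure R).

Lemma nnint_itv_split (a c b : R) (g : R -> \bar R) : a <= c -> c <= b ->
  measurable_fun setT g -> (forall x, 0 <= g x)%E ->
  (\int[mu]_(x in `[a, b]) g x = \int[mu]_(x in `[a, c]) g x + \int[mu]_(x in `[c, b]) g x)%E.
Proof.
move=> ac cb mg g0.
have m D : measurable_fun D g by exact: measurable_funTS.
have -> : `[a, b]%classic = `[a, c] `|` `]c, b] :> set R.
  by rewrite -itv_bndbnd_setU ?bnd_simp.
rewrite ge0_integral_setU//; [by rewrite integral_itv_obnd_cbnd|exact: m|].
rewrite disj_set2E; apply/eqP; rewrite -subset0 => t [] /=; rewrite !in_itv /=.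
by move=> /andP[_ tc] /andP[ct _]; move: ct; rewrite ltNge tc.
Qed.

Lemma nnint_itv_shift (a b m : R) (g : R -> \bar R) :
  measurable_fun setT g -> (forall x, 0 <= g x)%E ->
  (\int[mu]_(x in `[a, b]) g (x + m)%R = \int[mu]_(x in `[(a + m)%R, (b + m)%R]) g x)%E.
Proof.
move=> mg g0; rewrite [RHS](@nnint_shift _ m)//; last exact: measurable_funTS.
congr integral; apply/seteqP; split=> x /=; rewrite !in_itv /= !lerD2r//.
Qed.

Lemma nnint_periodic (T a b : R) (g : R -> \bar R) : 0 <= T ->
  measurable_fun setT g -> (forall x, 0 <= g x)%E -> (forall x, g (x + T)%R = g x) ->
  a <= b <= a + T ->
  (\int[mu]_(x in `[a, (a + T)%R]) g x = \int[mu]_(x in `[b, (b + T)%R]) g x)%E.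
Proof.
move=> T0 mg g0 gT /andP[ab bT].
rewrite (nnint_itv_split ab bT)// (@nnint_itv_split b (a + T) (b + T))//; last by rewrite lerD2r.
rewrite -(nnint_itv_shift a b T mg g0) addeC; congr (_ + _)%E.
by apply: eq_integral => x _; rewrite gT.
Qed.

End periodic_integrals.

Section real_inequalities.
Variable R : realType.
Implicit Types p x y l : R.

(** The graph of the [p]-th power lies above its tangent at [l], an inequality solved here for [x];
    equivalently, Young's inequality for [x / l] and 1. *)
Lemma powR_tangent p x l : 1 <= p -> 0 <= x -> 0 < l ->
  x <= l * (1 - p^-1) + powR l (1 - p) / p * powR x p.
Proof.
move=> p1 x0 l0; have p0 : 0 < p by lra.
(* At [p = 1] the conjugate exponent is infinite. *)
have [->|pn1] := eqVneq p 1.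
  by rewrite invr1 !subrr mulr0 add0r powRr0 mulr1 mul1r powRr1.
have p1' : 1 < p by rewrite lt_neqAle eq_sym pn1.
have q0 : 0 < (1 - p^-1)^-1 by rewrite invr_gt0 subr_gt0 invf_lt1.
have y0 : 0 <= x / l by rewrite divr_ge0// ltW.
have hq : p^-1 + (1 - p^-1)^-1^-1 = 1 by rewrite invrK addrC subrK.
have := conjugate_powR y0 ler01 p0 q0 hq; rewrite mulr1 powR1 mul1r => h.
have {h} : x / l <= powR (x / l) p / p + (1 - p^-1) by apply: le_trans h _; rewrite invrK.
rewrite ler_pdivrMr// mulrDl addrC => h; apply: le_trans h _.
rewrite mulrC lerD2l powRM// ?invr_ge0 ?(ltW l0)//.
have -> : powR l (1 - p) = l * powR l^-1 p.
  rewrite -powR_inv1 ?ltW// -powRrM mulN1r -{2}(powRr1 (ltW l0)) -powRD//.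
  by rewrite (gt_eqF l0) implybT.
by rewrite le_eqVlt; apply/orP; left; apply/eqP; ring.
Qed.

Lemma powRD_le p x y : 0 <= p -> 0 <= x -> 0 <= y ->
  powR (x + y) p <= powR 2 p * (powR x p + powR y p).
Proof.
move=> p0; wlog xy : x y / x <= y.
  move=> H x0 y0; have [xy|yx] := leP x y; first exact: H.
  by rewrite addrC (addrC (powR x p)); apply: H => //; exact: ltW.
move=> x0 y0; apply: le_trans (_ : powR (2 * y) p <= _).
  by apply: ge0_ler_powR; rewrite ?nnegrE ?addr_ge0 ?mulr_ge0//; move: xy; lra.
by rewrite powRM// ler_wpM2l ?powR_ge0// lerDr powR_ge0.
Qed.

Lemma sin_ge_mul_cos x : 0 <= x -> x <= pi -> x * cos x <= sin x.
Proof.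
move=> x0 xpi; pose k (t : R) := sin t - t * cos t.
suff : k 0 <= k x by rewrite /k sin0 mul0r subr0 subr_ge0.
have dk t : is_derive t (1 : R) k (t * sin t).
  by rewrite /k; apply: is_derive_eq; rewrite /GRing.scale /=; ring.
apply: (@ger0_derive1_ndecr _ k 0 pi) => //.
- move=> t; rewrite in_itv /= => /andP[t0 tpi]; rewrite derive1E; have [_ ->] := dk t.
  by rewrite mulr_ge0 ?(ltW t0)// ltW// sin_gt0_pi// t0.
- by apply: derivable_within_continuous => t _; case: (dk t).
Qed.

(** [sin x = 2 * sin (x / 2) * cos (x / 2)] is at least [x * cos (x / 2) ^+ 2], and
    [cos (x / 2) ^+ 2 >= 1 / 2] because [cos x >= 0]. *)
Lemma sin_ge_half x : 0 <= x -> x <= pi / 2 -> x / 2 <= sin x.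
Proof.
move=> x0 xpi; have pi0 := pi_gt0 R.
have hx : 0 <= x / 2 by lra.
have cx : 0 <= cos x by apply: cos_ge0_pihalf; apply/andP; split; move: x0 xpi pi0; lra.
have E : x / 2 + x / 2 = x by lra.
have c2 : 0 <= cos (x / 2) by apply: cos_ge0_pihalf; apply/andP; split; move: x0 xpi pi0; lra.
have S : sin x = 2 * sin (x / 2) * cos (x / 2) by rewrite -{1}E sinD; ring.
have Cc : cos x = 2 * cos (x / 2) ^+ 2 - 1 by rewrite -{1}E cosD; have := cos2Dsin2 (x / 2); rewrite !expr2; lra.
rewrite S; have := @sin_ge_mul_cos (x / 2) hx.
have hpi : x / 2 <= pi by move: x0 xpi pi0; lra.
move=> /(_ hpi) h; have := ler_wpM2r c2 h.
have : x * cos (x / 2) ^+ 2 >= x / 2.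
  have : cos (x / 2) ^+ 2 >= 1 / 2 by move: cx; rewrite Cc; lra.
  by move=> /(ler_wpM2l x0); lra.
by rewrite expr2; lra.
Qed.

(** The squared chord is [(1 - r) ^+ 2 + 4 * r * sin (s / 2) ^+ 2], which for [r >= 1 / 2] is at
    least [s ^+ 2 / 8] by [sin_ge_half]; and 8 is less than [3 ^+ 2]. *)
Lemma chord_ge (s r : R) : - pi <= s -> s <= pi -> 1 / 2 <= r ->
  `|s| <= 3 * modulus (polar 1 s - polar r 0).
Proof.
move=> s1 s2 r2; rewrite -(ler_pXn2r (n:=2)) ?nnegrE ?mulr_ge0 ?modulus_ge0//.
rewrite exprMn modulus2 ReD ImD ReN ImN /polar /= cos0 sin0 mulr1 mulr0 !mul1r subr0.
set x := `|s| / 2.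
have s_pi : `|s| <= pi by rewrite ler_norml s1.
have x0 : 0 <= x by rewrite divr_ge0.
have hx : x <= pi / 2 by rewrite /x; move: s_pi; lra.
have h := sin_ge_half x0 hx.
have Cs : cos s = 1 - 2 * sin x ^+ 2.
  have -> : cos s = cos (x + x).
    rewrite /x -splitr; have [s0|s0] := leP 0 s; first by rewrite ger0_norm.
    by rewrite ltr0_norm// cosN.
  by rewrite cosD; have := cos2Dsin2 x; rewrite !expr2; lra.
have h2 : (x / 2) ^+ 2 <= sin x ^+ 2 by rewrite ler_pXn2r// nnegrE; lra.
have sx : `|s| = 2 * x by rewrite /x mulrC divfK.
rewrite sx; have := cos2Dsin2 s => cs.
have -> : (cos s - r) ^+ 2 + sin s ^+ 2 = (1 - r) ^+ 2 + 2 * r * (1 - cos s).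
  by move: cs; rewrite !expr2; lra.
have : 0 <= sin x ^+ 2 * (2 * r - 1) by rewrite mulr_ge0 ?sqr_ge0//; lra.
have := sqr_ge0 (1 - r); move: h2; rewrite Cs; move: (sin x ^+ 2) => S.
rewrite !expr2; nra.
Qed.

End real_inequalities.

(** * Distance of boundary values *)

Section ae_integrals.
Variable R : realType.
Local Notation mu := (@lebesgue_measure R).

(** Read off the definition of the integral as a supremum over simple functions, and thus valid for
    functions that may fail to be measurable. *)
Lemma ge0_le_nnint (f g : R -> \bar R) : (forall x, 0 <= f x)%E -> (forall x, f x <= g x)%E ->
  (\int[mu]_x f x <= \int[mu]_x g x)%E.
Proof.
move=> f0 fg; have g0 x : (0 <= g x)%E := le_trans (f0 x) (fg x).
rewrite !ge0_integralTE//; apply: le_ereal_sup => _ [h hf <-]; exists h => // x.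
exact: le_trans (hf x) (fg x).
Qed.

Lemma ge0_le_nnint_on (D : set R) (f g : R -> \bar R) : (forall x, 0 <= f x)%E ->
  (forall x, D x -> f x <= g x)%E -> (\int[mu]_(x in D) f x <= \int[mu]_(x in D) g x)%E.
Proof.
move=> f0 fg; rewrite integral_mkcond [leRHS]integral_mkcond; apply: ge0_le_nnint => x; rewrite /patch.
  by case: ifP.
by case: ifPn => //; rewrite inE; exact: fg.
Qed.

(** [g] is not assumed measurable: the integrand of the Lipschitz condition is only
    almost everywhere equal to a measurable function. *)
Lemma ae_le_nnint (D : set R) (f g : R -> \bar R) : measurable D -> measurable_fun D f ->
  (forall x, 0 <= f x)%E -> (forall x, 0 <= g x)%E ->
  {ae mu, forall x, D x -> (f x <= g x)%E} ->
  (\int[mu]_(x in D) f x <= \int[mu]_(x in D) g x)%E.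
Proof.
move=> mD mf f0 g0 [N [mN N0 NE]].
rewrite (ge0_negligible_integral mN)//.
rewrite integral_mkcond [leRHS]integral_mkcond; apply: ge0_le_nnint => x; rewrite /patch.
  by case: ifP.
case: ifPn => [|_]; last by case: ifP.
rewrite inE => -[Dx Nx]; rewrite mem_set//.
by apply: contrapT => fg; apply: Nx; apply: NE => /(_ Dx).
Qed.

Lemma ae_shift (P : R -> Prop) (s : R) :
  {ae mu, forall t, P t} -> {ae mu, forall t, P (t + s)}.
Proof.
move=> [N [mN N0 NE]]; exists ((fun t => t + s) @^-1` N); split.
- by rewrite -[X in measurable X]setTI; exact: measurable_shift.
- by rewrite -[RHS]N0 -(lebesgue_measure_shift s mN).
- by move=> t /= nP; apply: NE.
Qed.

End ae_integrals.

Section poweR_lemmas.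
Variable R : realType.

Lemma le_poweR_inv (I : \bar R) (p y : R) : (0 <= I)%E -> 0 < p ->
  (poweR I p^-1 <= y%:E)%E -> (I <= (powR y p)%:E)%E.
Proof.
move=> I0 p0; have pi0 : p^-1 != 0 by rewrite gt_eqF// invr_gt0.
case: I I0 => [x|_|//]; last by rewrite poweRyr// leye_eq.
rewrite poweR_EFin !lee_fin => x0 h.
have : powR (powR x p^-1) p <= powR y p.
  by apply: ge0_ler_powR; rewrite ?nnegrE ?powR_ge0 ?(ltW p0)// (le_trans _ h) ?powR_ge0.
by rewrite -powRrM mulVf ?gt_eqF// powRr1.
Qed.

Lemma poweR_inv_le (I : \bar R) (p y : R) : (0 <= I)%E -> 0 < p -> 0 <= y ->
  (I <= (powR y p)%:E)%E -> (poweR I p^-1 <= y%:E)%E.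
Proof.
move=> I0 p0 y0; case: I I0 => [x||//]; last by rewrite leye_eq.
rewrite poweR_EFin !lee_fin => x0 h.
have : powR x p^-1 <= powR (powR y p) p^-1.
  by apply: ge0_ler_powR; rewrite ?nnegrE ?powR_ge0 ?invr_ge0 ?(ltW p0).
by rewrite -powRrM mulfV ?gt_eqF// powRr1.
Qed.

End poweR_lemmas.

Section boundary_distance.
Variable R : realType.
Local Notation C := (cplx R).
Local Notation mod := (@modulus R).
Local Notation mu := (@lebesgue_measure R).
Variables (D : set C) (rho : C -> R).
Hypothesis Do : open D.
Hypothesis Dc : connected D.
Hypothesis rhoc : forall z, D z -> {for z, continuous rho}.
Hypothesis rho0 : forall z, D z -> 0 < rho z.
Local Notation d := (rho_dist D rho).
Variable f : C -> C.
Hypothesis fc : forall z, mod z < 1 -> {for z, continuous f}.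
Hypothesis fD : forall z, mod z < 1 -> D (f z).

Local Notation rn := (@rad R).

Definition bdist_approx n (x : R * R) : R :=
  d (f (polar (rn n) x.1)) (f (polar (rn n) x.2)).

(** The distance [d (f_b t) (f_b s)] of the boundary values, as a function that is
    everywhere defined and jointly measurable. *)
Definition bdist (t s : R) : R := `|fine (limn_esup (fun n => (bdist_approx n (t, s))%:E))|.

Lemma bdist_ge0 t s : 0 <= bdist t s.
Proof. exact: normr_ge0. Qed.

Lemma bdist_sym t s : bdist t s = bdist s t.
Proof.
rewrite /bdist; congr `|fine (limn_esup _)|; apply/funext => n.
by rewrite /bdist_approx dist_sym//; exact: fD (mod_rad _ _).
Qed.

Lemma bdistxx t : bdist t t = 0.
Proof.
rewrite /bdist (_ : (fun n => _) = fun=> 0%E); last first.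
  by apply/funext => n; rewrite /bdist_approx distxx//; exact: fD (mod_rad _ _).
by rewrite (cvg_limn_einf_sup (cvg_cst 0%E)).2 normr0.
Qed.

Lemma bdist_periodl t s : bdist (t + 2 * pi) s = bdist t s.
Proof. by rewrite /bdist /bdist_approx /=; under eq_fun do rewrite polarD2pi. Qed.

Lemma bdist_periodr t s : bdist t (s + 2 * pi) = bdist t s.
Proof. by rewrite bdist_sym bdist_periodl bdist_sym. Qed.

Lemma measurable_bdist : measurable_fun setT (fun x : R * R => bdist x.1 x.2).
Proof.
apply: measurableT_comp => //; apply: (measurableT_comp (fine_measurable measurableT)).
apply: measurable_fun_limn_esup => n; apply/measurable_EFinP.
apply: continuous_measurable_fun2 => x.
have cf t : {for t, continuous (fun t => f (polar (rn n) t))}.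
  apply: (@continuous_comp _ _ _ (polar (rn n)) f).
    by apply: polar_continuous; [exact: cvg_cst|exact: cvg_id].
  exact: fc (mod_rad _ _).
apply: (dist_cvg Do Dc rhoc rho0); try exact: fD (mod_rad _ _).
  apply: (@continuous_comp _ _ _ fst (fun t => f (polar (rn n) t))); first exact: cvg_fst.
  exact: cf.
apply: (@continuous_comp _ _ _ snd (fun t => f (polar (rn n) t))); first exact: cvg_snd.
exact: cf.
Qed.

Definition regular (t : R) : Prop := radial_dom f t /\ D (radial_lim f t).

Lemma regular_cvg t : regular t -> f (polar r t) @[r --> 1^'-] --> radial_lim f t.
Proof. by case. Qed.

(** At regular angles both boundary values lie in [D], where [d] is continuous, so the limit
    superior is a limit. *)
Lemma bdistE t s : regular t -> regular s -> bdist t s = d (radial_lim f t) (radial_lim f s).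
Proof.
move=> gt_ gs.
have H u : regular u -> f (polar (rn n) u) @[n --> \oo] --> radial_lim f u.
  by move=> gu; apply: (@cvg_comp _ _ _ rn (fun r => f (polar r u)) _ _ _ rad_left); exact: regular_cvg.
have E : bdist_approx n (t, s) @[n --> \oo] --> d (radial_lim f t) (radial_lim f s).
  by apply: (dist_cvg Do Dc rhoc rho0); [case: gt_|case: gs|exact: H|exact: H].
have E' : (bdist_approx n (t, s))%:E @[n --> \oo] --> (d (radial_lim f t) (radial_lim f s))%:E.
  by apply: (cvg_EFin _ E); apply: nearW.
by rewrite /bdist (cvg_limn_einf_sup E').2 /= ger0_norm//; exact: dist_ge0.
Qed.

Lemma bdist_tri t s u : regular t -> regular s -> regular u -> bdist t u <= bdist t s + bdist s u.
Proof.
move=> gt_ gs gu; rewrite !bdistE//.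
by apply: (dist_tri Do Dc rhoc rho0); [case: gs|case: gt_|case: gu].
Qed.

End boundary_distance.

Section integral_modulus.
Variable R : realType.
Local Notation mu := (@lebesgue_measure R).
Variables (dl : R -> R -> R) (regular : R -> Prop) (p : R).
Hypothesis dl_ge0 : forall t s, 0 <= dl t s.
Hypothesis dl_sym : forall t s, dl t s = dl s t.
Hypothesis dlxx : forall t, dl t t = 0.
Hypothesis dl_periodic : forall t s, dl (t + 2 * pi) s = dl t s.
Hypothesis dl_meas : measurable_fun setT (fun x : R * R => dl x.1 x.2).
Hypothesis dl_tri : forall t s u, regular t -> regular s -> regular u -> dl t u <= dl t s + dl s u.
Hypothesis ae_regular : {ae mu, forall t, regular t}.
Hypothesis p0 : 0 < p.

(** The [p]-th power of an [L^p] modulus of continuity. It is extended-valued because finiteness is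
    known at first for small shifts only. *)
Definition shift_int (s : R) : \bar R :=
  (\int[mu]_(t in `[(- pi)%R, pi]) (powR (dl (t + s) t) p)%:E)%E.

Lemma measurable_dl (u v : R -> R) : measurable_fun setT u -> measurable_fun setT v ->
  measurable_fun setT (fun t => powR (dl (u t) (v t)) p).
Proof.
move=> mu_ mv; apply: (measurableT_comp (measurable_powR p)).
exact: (measurableT_comp dl_meas (measurable_fun_pair mu_ mv)).
Qed.

Lemma dl_window (u v : R -> R) (s : R) : measurable_fun setT u -> measurable_fun setT v ->
  (forall t, u (t + 2 * pi) = u t + 2 * pi) -> (forall t, v (t + 2 * pi) = v t + 2 * pi) ->
  0 <= s <= 2 * pi ->
  (\int[mu]_(t in `[(- pi)%R, pi]) (powR (dl (u (t + s)) (v (t + s))) p)%:E =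
   \int[mu]_(t in `[(- pi)%R, pi]) (powR (dl (u t) (v t)) p)%:E)%E.
Proof.
move=> mu_ mv uT vT /andP[s0 s1]; pose g t := (powR (dl (u t) (v t)) p)%:E.
have mg : measurable_fun setT g by apply/measurable_EFinP; exact: measurable_dl.
have g0 t : (0 <= g t)%E by rewrite lee_fin powR_ge0.
rewrite (@nnint_itv_shift R (- pi) pi s g)//.
have := @nnint_periodic R (2 * pi) (- pi) (- pi + s) g _ mg g0.
rewrite (_ : - pi + 2 * pi = pi); last by ring.
rewrite (_ : - pi + s + 2 * pi = pi + s); last by ring.
move=> ->//; first by rewrite mulr_ge0// pi_ge0.
  by move=> t; rewrite /g uT vT dl_periodic dl_sym dl_periodic dl_sym.
by rewrite lerDl s0 /=; move: s1; lra.
Qed.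

Let m_id : measurable_fun setT (fun t : R => t).
Proof. exact: measurable_id. Qed.

Lemma shift_int_opp s : 0 <= s <= 2 * pi -> shift_int (- s) = shift_int s.
Proof.
move=> s01; rewrite /shift_int.
rewrite -(@dl_window (fun t => t - s) (fun t => t) s (measurable_shift (- s)) m_id)//.
  by apply: eq_integral => t _; rewrite addrK dl_sym.
by move=> t; ring.
Qed.

(** The triangle inequality through the angle [t + s], at almost every [t]; by periodicity both
    terms have the same integral, [shift_int s]. *)
Lemma shift_int_double s : 0 <= s <= 2 * pi ->
  (shift_int (s + s) <= (2 * powR 2 p)%:E * shift_int s)%E.
Proof.
move=> s01; pose F t := powR (dl (t + (s + s)) t) p.
pose G t := powR (dl (t + s) t) p.
pose H t := powR (dl (t + s + s) (t + s)) p.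
have mG : measurable_fun setT G by exact: measurable_dl (measurable_shift s) m_id.
have mH : measurable_fun setT H.
  apply: measurable_dl; last exact: measurable_shift.
  by under eq_fun do rewrite -addrA; exact: measurable_shift.
have mF : measurable_fun setT F by exact: measurable_dl (measurable_shift _) m_id.
have le1 : (shift_int (s + s) <=
    \int[mu]_(t in `[(- pi)%R, pi]) (powR 2 p * (H t + G t))%:E)%E.
  apply: ae_le_nnint => //.
  - by apply/measurable_EFinP; exact: measurable_funTS.
  - by move=> t; rewrite lee_fin powR_ge0.
  - by move=> t; rewrite lee_fin mulr_ge0 ?addr_ge0 ?powR_ge0.
  have FA : Filter (almost_everywhere mu) by exact: ae_filter_ringOfSetsType.
  have g1 := ae_shift s ae_regular; have g2 := ae_shift (s + s) ae_regular.
  apply: filterS3 ae_regular g1 g2 => t gt_ g1 g2 _; rewrite lee_fin.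
  apply: le_trans (powRD_le (ltW p0) (dl_ge0 _ _) (dl_ge0 _ _)).
  by apply: ge0_ler_powR; rewrite ?nnegrE ?addr_ge0 ?(ltW p0)// -addrA dl_tri.
apply: le_trans le1 _.
have mpi : measurable (`[(- pi)%R, pi] : set R) by [].
have mG' := measurable_funTS (D := `[- pi, pi]%classic) mG.
have mH' := measurable_funTS (D := `[- pi, pi]%classic) mH.
rewrite nnintZ ?powR_ge0//; [|exact: measurable_funD|by move=> t _; rewrite addr_ge0 ?powR_ge0].
rewrite nnintD//; try by move=> t _; exact: powR_ge0.
have -> : (\int[mu]_(t in `[(- pi)%R, pi]) (H t)%:E = shift_int s)%E.
  apply: (@dl_window (fun t => t + s) (fun t => t) s (measurable_shift s) m_id) => //.
  by move=> t; ring.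
have -> : (\int[mu]_(t in `[(- pi)%R, pi]) (G t)%:E = shift_int s)%E by [].
by rewrite -mule2n -mule_natl muleA -EFinM mulrC.
Qed.

Lemma shift_int0 : shift_int 0 = 0%E.
Proof.
rewrite /shift_int; under eq_integral do rewrite addr0 dlxx powR0 ?gt_eqF//.
by rewrite integral0.
Qed.

(** The Lipschitz condition controls small shifts only. Halving a shift [n] times makes it small,
    and each doubling back costs the factor [K], the gain [2 ^ (- beta)] being given up. Negative
    shifts follow from symmetry and periodicity. *)
Lemma shift_int_bound (beta B h : R) : 0 < beta -> 0 <= B -> 0 < h ->
  (forall s, 0 < s < h -> (shift_int s <= (B * powR s beta)%:E)%E) ->
  exists2 B' : R, 0 <= B' &
    forall s, - pi <= s <= pi -> (shift_int s <= (B' * powR `|s| beta)%:E)%E.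
Proof.
move=> b0 B0 h0 H; pose K := 2 * powR 2 p; have K0 : 0 <= K by rewrite mulr_ge0 ?powR_ge0.
have iter n s : 0 < s <= pi -> s / 2 ^+ n < h -> (shift_int s <= (B * K ^+ n * powR s beta)%:E)%E.
  elim: n s => [|n IH] s /andP[s0 spi].
    by rewrite expr0 divr1 mulr1 => sh; apply: H; rewrite s0.
  rewrite exprS invfM mulrA => sh.
  have s20 : 0 < s / 2 by rewrite divr_gt0.
  have s2 : 0 < s / 2 <= pi by rewrite s20 /=; move: s0 spi; lra.
  have s2' : 0 <= s / 2 <= 2 * pi by move: s0 spi (pi_gt0 R); lra.
  have := shift_int_double s2'; rewrite -splitr => /le_trans; apply.
  apply: le_trans (lee_wpmul2l _ (IH _ s2 sh)) _; first by rewrite lee_fin.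
  rewrite -EFinM lee_fin exprS.
  have -> : K * (B * K ^+ n * powR (s / 2) beta) = B * (K * K ^+ n) * powR (s / 2) beta by ring.
  apply: ler_wpM2l; first by rewrite !mulr_ge0// exprn_ge0.
  by apply: ge0_ler_powR; rewrite ?nnegrE ?(ltW b0) ?(ltW s0) ?(ltW s20)//; move: s0; lra.
have [n Hn] : exists n, pi / 2 ^+ n < h.
  exists (Num.Def.archi_bound (pi / h)).
  rewrite ltr_pdivrMr ?exprn_gt0// -ltr_pdivrMl// mulrC.
  apply: lt_trans (archi_boundP _) _; first by rewrite divr_ge0 ?pi_ge0// ltW.
  by rewrite -natrX ltr_nat ltn_expl.
have half s : 0 < s <= pi -> (shift_int s <= (B * K ^+ n * powR s beta)%:E)%E.
  move=> /andP[s0 spi]; apply: iter; first by rewrite s0.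
  by apply: le_lt_trans Hn; rewrite ler_pM2r// invr_gt0 exprn_gt0.
exists (B * K ^+ n); first by rewrite mulr_ge0// exprn_ge0.
move=> s /andP[s1 s2]; have pi0 := pi_gt0 R; case: (ltgtP 0 s) => [s0|s0|<-].
- by rewrite gtr0_norm//; apply: half; rewrite s0.
- rewrite ltr0_norm// -{1}(opprK s) shift_int_opp.
    by apply: half; rewrite oppr_gt0 s0 /=; move: s1; lra.
  by rewrite oppr_ge0 ltW//=; move: s1 pi0; lra.
- by rewrite shift_int0 normr0 powR0 ?gt_eqF// mulr0.
Qed.

End integral_modulus.

(** * The mean of order p of the kernel *)

Section weighted_jensen.
Variable R : realType.
Local Notation mu := (@lebesgue_measure R).

(** Integrating the tangent line of [y ^ p] at [l] against the weight [k] and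
    optimizing over [l]. *)
Lemma weighted_jensen (D : set R) (k y : R -> R) (p m x : R) : measurable D ->
  measurable_fun D k -> measurable_fun D y -> (forall t, 0 <= k t) -> (forall t, 0 <= y t) ->
  1 <= p -> 1 <= m -> (\int[mu]_(t in D) (k t)%:E <= m%:E)%E -> 0 <= x ->
  (x%:E <= \int[mu]_(t in D) (k t * y t)%:E)%E ->
  ((powR x p)%:E <= (powR m p)%:E * \int[mu]_(t in D) (k t * powR (y t) p)%:E)%E.
Proof.
move=> mD mk my k0 y0 p1 m1 km x0 xI; have p0 : 0 < p by lra.
have myp : measurable_fun D (fun t => powR (y t) p).
  exact: (measurableT_comp (measurable_powR p) my).
have mkyp := measurable_funM mk myp.
have kyp0 t : 0 <= k t * powR (y t) p by rewrite mulr_ge0 ?powR_ge0.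
have J0 : (0 <= \int[mu]_(t in D) (k t * powR (y t) p)%:E)%E.
  by apply: integral_ge0 => t _; rewrite lee_fin.
have mp0 : 0 < powR m p by rewrite powR_gt0//; lra.
case E : (\int[mu]_(t in D) (k t * powR (y t) p)%:E)%E J0 => [j||//]; last first.
  by move=> _; rewrite gt0_muley ?lte_fin// leey.
rewrite lee_fin => j0; rewrite -EFinM lee_fin.
(* The optimal tangent point is the [p]-th root of [j], which may be 0; any [i > j] gives a positive
   point [l], and [i] then tends to [j]. *)
suff H i : j < i -> powR x p <= powR m p * i.
  apply/ler_addgt0Pr => e e0; have := H (j + e / powR m p); rewrite mulrDr mulrCA divff ?gt_eqF// mulr1.
  by apply; rewrite ltrDl divr_gt0.
move=> ji; have i0 : 0 < i := le_lt_trans j0 ji.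
pose l := powR i p^-1; have l0 : 0 < l by rewrite powR_gt0.
have lp : powR l p = i by rewrite -powRrM mulVf ?gt_eqF// powRr1 ?ltW.
have lp1 : powR l (1 - p) * i = l.
  by rewrite -{1}lp -powRD ?subrK ?powRr1 ?(ltW l0)// (gt_eqF l0) implybT.
pose a := l * (1 - p^-1); pose b := powR l (1 - p) / p.
have pi1 : p^-1 <= 1 by rewrite invf_le1.
have pi0 : 0 < p^-1 by rewrite invr_gt0.
have a0 : 0 <= a by rewrite mulr_ge0 ?subr_ge0// ltW.
have b0 : 0 <= b by rewrite divr_ge0 ?powR_ge0// ltW.
have xle : x <= a * m + b * j.
  rewrite -lee_fin; apply: le_trans xI _.
  apply: le_trans (_ : \int[mu]_(t in D) (a * k t + b * (k t * powR (y t) p))%:E <= _)%E.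
    apply: le_nnint => //.
    - exact: measurable_funM.
    - by apply: measurable_funD; exact: measurable_funM.
    - by move=> t _; exact: mulr_ge0.
    move=> t _; have := ler_wpM2l (k0 t) (powR_tangent p1 (y0 t) l0).
    by rewrite -/a -/b; lra.
  rewrite nnintD//; [|exact: measurable_funM|exact: measurable_funM|by move=> t _; exact: mulr_ge0|by move=> t _; exact: mulr_ge0].
  rewrite !nnintZ// E EFinD; apply: leeD => //.
  by rewrite (EFinM a m); apply: lee_wpmul2l; rewrite ?lee_fin.
have {}xle : x <= m * l.
  have h1 : b * j <= p^-1 * l.
    have -> : p^-1 * l = b * i by rewrite /b mulrAC lp1 mulrC.
    by apply: ler_wpM2l => //; exact: ltW.
  have h2 : p^-1 * l <= p^-1 * l * m by apply: ler_peMr => //; apply: mulr_ge0; exact: ltW.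
  by move: xle h1 h2; rewrite /a; lra.
apply: le_trans (_ : powR (m * l) p <= _).
  apply: ge0_ler_powR; rewrite ?nnegrE ?mulr_ge0 ?(ltW l0) ?(ltW p0)//; lra.
by rewrite powRM ?lp ?(ltW l0)//; lra.
Qed.

End weighted_jensen.

Section tonelli.
Variable R : realType.
Local Notation mu := (@lebesgue_measure R).

Lemma tonelli_on (D : set R) (F : R * R -> \bar R) : measurable D ->
  measurable_fun setT F -> (forall x, 0 <= F x)%E ->
  (\int[mu]_(x in D) \int[mu]_(y in D) F (x, y) =
   \int[mu]_(y in D) \int[mu]_(x in D) F (x, y))%E.
Proof.
move=> mD mF F0; pose G := F \_ (D `*` D).
have mG : measurable_fun setT G.
  apply/(measurable_restrictT _ _).1; first exact: measurableX.
  exact: measurable_funTS.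
have G0 x : (0 <= G x)%E by rewrite /G /patch; case: ifP.
have GE x y : G (x, y) = if x \in D then (if y \in D then F (x, y) else 0%E) else 0%E.
  by rewrite /G /patch in_setX /=; case: (x \in D); case: (y \in D).
have := fubini_tonelli (m1 := mu) (m2 := mu) G mG G0.
move=> H; rewrite integral_mkcond; transitivity (\int[mu]_x \int[mu]_y G (x, y))%E.
  apply: eq_integral => x _; rewrite /patch; case: ifP => xD.
    by rewrite integral_mkcond; apply: eq_integral => y _; rewrite GE xD.
  by apply/esym/integral0_eq => y _; rewrite GE xD.
rewrite H [RHS]integral_mkcond; apply: eq_integral => y _; rewrite /patch; case: ifP => yD.
  by rewrite [RHS]integral_mkcond; apply: eq_integral => x _; rewrite GE yD.
by apply: integral0_eq => x _; rewrite GE yD; case: ifP.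
Qed.

End tonelli.

Section Lp_estimate.
Variable R : realType.
Local Notation mu := (@lebesgue_measure R).
Local Notation mod := (@modulus R).
Variables (dl : R -> R -> R) (p alpha B : R).
Hypothesis dl_ge0 : forall t s, 0 <= dl t s.
Hypothesis dl_periodic : forall t s, dl (t + 2 * pi) s = dl t s.
Hypothesis dl_meas : measurable_fun setT (fun x : R * R => dl x.1 x.2).
Hypothesis p1 : 1 <= p.
Hypothesis alpha0 : 0 < alpha.
Hypothesis alpha1 : alpha <= 1.
Hypothesis B0 : 0 <= B.
Hypothesis dlB : forall s, - pi <= s <= pi ->
  (shift_int dl p s <= (B * powR `|s| (alpha * p))%:E)%E.

Lemma nnint_window (m : R) (g : R -> \bar R) : `|m| <= 2 * pi ->
  measurable_fun setT g -> (forall x, 0 <= g x)%E -> (forall x, g (x + 2 * pi)%R = g x) ->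
  (\int[mu]_(x in `[(- pi)%R, pi]) g (x + m)%R = \int[mu]_(x in `[(- pi)%R, pi]) g x)%E.
Proof.
move=> m2 mg g0 gT; rewrite nnint_itv_shift//.
have T0 : 0 <= 2 * pi :> R by rewrite mulr_ge0// pi_ge0.
have := @nnint_periodic R (2 * pi) (- pi) (- pi + m) g T0 mg g0 gT.
have := @nnint_periodic R (2 * pi) (- pi + m) (- pi) g T0 mg g0 gT.
rewrite (_ : - pi + 2 * pi = pi); last by ring.
rewrite (_ : - pi + m + 2 * pi = pi + m); last by ring.
move: m2; rewrite ler_norml => /andP[h1 h2] H1 H2.
have [m0|m0] := leP 0 m; first by rewrite -H2//; lra.
by rewrite H1//; move: m0 h1; lra.
Qed.

Section fixed_radius.
Variable r : R.
Hypothesis r2 : 1 / 2 <= r.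
Hypothesis r1 : r < 1.

Let e (s : R) : R := mod (polar 1 s - polar r 0).
Let kap (s : R) : R := (1 - r) / e s ^+ 2.

Let e_ge s : 1 - r <= e s.
Proof.
apply: le_trans (modulusB_ge _ _); rewrite !modulus_polar normr1 ger0_norm//.
by move: r2; lra.
Qed.

Let e_gt0 s : 0 < e s.
Proof. by apply: lt_le_trans (e_ge s); rewrite subr_gt0. Qed.

Let e_cont (t : R) : {for t, continuous e}.
Proof.
apply: (@continuous_comp _ _ _ (fun t => polar 1 t - polar r 0) mod); last exact: continuous_modulus.
apply: (@continuous_comp _ _ _ (fun t => polar 1 t) (fun z => z - polar r 0)).
  by apply: polar_continuous; [exact: cvg_cst|exact: cvg_id].
by apply: cdiff_at_continuous; apply: cdiff_atB; [exact: cdiff_at_id|exact: cdiff_at_cst].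
Qed.

Let kap_ge0 s : 0 <= kap s.
Proof. by rewrite divr_ge0 ?exprn_ge0 ?(ltW (e_gt0 s))// subr_ge0 ltW. Qed.

Let kap_cont (t : R) : {for t, continuous kap}.
Proof.
have c2 : {for t, continuous (fun s => (e s ^+ 2)^-1)}.
  apply: continuousV; first by rewrite expf_neq0// gt_eqF.
  exact: (continuousM (@e_cont t) (@e_cont t)).
have c1 : {for t, continuous (fun _ : R => 1 - r)} by exact: cvg_cst.
exact: (continuousM c1 c2).
Qed.

Let m_kap : measurable_fun setT kap.
Proof. exact: continuous_measurable_fun. Qed.

(** As [1 - r <= 1 - r ^+ 2], the weight is dominated by the Poisson kernel at the point [r], whose
    mass is [2 * pi]. *)
Let kap_int : (\int[mu]_(t in `[(- pi)%R, pi]) (kap t)%:E <= (2 * pi)%:E)%E.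
Proof.
have r0 : 0 < r by move: r2; lra.
have rm : mod (polar r 0) < 1 by rewrite modulus_polar gtr0_norm.
have cP t : {for t, continuous (poisson_ker 1 (polar r 0))} by exact: poisson_ker_continuous.
have IP : mu.-integrable `[- pi, pi] (EFin \o poisson_ker 1 (polar r 0)).
  by apply: pointwise_continuous_integrable => t _.
rewrite -(poisson_kernel_int ltr01 rm) -nnint_Rintegral//.
apply: le_nnint => //.
- exact: measurable_funTS.
- apply: measurable_funTS; exact: continuous_measurable_fun.
move=> t _; rewrite /poisson_ker; apply: ler_wpM2r.
  by rewrite invr_ge0 exprn_ge0// modulus_ge0.
by rewrite modulus_polar gtr0_norm// expr1n expr2; have := mulr_gt0 r0 (_ : 0 < 1 - r); rewrite subr_gt0 => /(_ r1); lra.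
Qed.

(** The rotation by [th] makes the kernel independent of [th]. Two of the three powers of the chord
    form the weight [kap]; the third goes with the distance, which is then raised to the power
    [p]. *)
Let kernel_chord th t :
  (1 - r) * dl (t + th) th / mod (polar 1 (t + th) - polar r th) ^+ 3 =
  kap t * (dl (t + th) th / e t).
Proof.
have -> : polar 1 (t + th) - polar r th = polar 1 th * (polar 1 t - polar r 0).
  by rewrite mulrBr !polarM !mul1r addr0 (addrC th).
rewrite modulusM modulus_polar normr1 mul1r /kap -/(e t).
by field; rewrite gt_eqF.
Qed.

Lemma Lp_kernel_estimate (c : R) (u : R -> R) : 0 < c -> measurable_fun `[- pi, pi] u ->
  (forall th, 0 <= u th) ->
  {ae mu, forall th, th \in `[(- pi), pi] -> ((u th)%:E <= c%:E *
    \int[mu]_(t in `[(- pi)%R, pi])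
      ((1 - r) * dl t th / mod (polar 1 t - polar r th) ^+ 3)%R%:E)%E} ->
  (Lp_norm_on (- pi) pi p u <=
    (2 * pi * c * powR (2 * pi * B * powR 3 (alpha * p)) p^-1 * powR (1 - r) (alpha - 1))%:E)%E.
Proof.
move=> c0 mu_ u0 H; have p0 : 0 < p by move: p1; lra.
have pi2 : 1 <= 2 * pi :> R by have := pi_ge2 R; lra.
have pi0 : 0 <= 2 * pi :> R by move: pi2; lra.
have y0 (th t : R) : 0 <= dl (t + th) th / e t by rewrite divr_ge0// ltW.
have mei : measurable_fun setT (fun t => (e t)^-1).
  by apply: continuous_measurable_fun => t; apply: continuousV; [rewrite gt_eqF|exact: e_cont].
have my (th : R) : measurable_fun setT (fun t : R => dl (t + th) th / e t).
  apply: measurable_funM mei.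
  exact: (measurableT_comp dl_meas (measurable_fun_pair (measurable_shift th) (measurable_cst th))).
(* Jensen's inequality is applied to [u th / c] with mass at most [2 * pi]; both constants come out
   to the power [p]. *)
set K := powR c p * powR (2 * pi) p; have K0 : 0 <= K by rewrite mulr_ge0 ?powR_ge0.
pose F (x : R * R) : \bar R := (K * (kap x.2 * powR (dl (x.2 + x.1) x.1 / e x.2) p))%:E.
have mF : measurable_fun setT F.
  apply/measurable_EFinP; apply: measurable_funM => //; apply: measurable_funM.
    exact: (measurableT_comp m_kap measurable_snd).
  apply: (measurableT_comp (measurable_powR p)); apply: measurable_funM.
    have m1 : measurable_fun setT (fun x : R * R => x.2 + x.1).
      exact: measurable_funD measurable_snd measurable_fst.
    exact: (measurableT_comp dl_meas (measurable_fun_pair m1 measurable_fst)).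
  exact: (measurableT_comp mei measurable_snd).
have F0 x : (0 <= F x)%E.
  by rewrite lee_fin; exact: mulr_ge0 K0 (mulr_ge0 (kap_ge0 _) (powR_ge0 _ _)).
have mpi : measurable (`[(- pi)%R, pi] : set R) by [].
have myp (th : R) : measurable_fun setT (fun t => kap t * powR (dl (t + th) th / e t) p).
  by apply: measurable_funM m_kap _; exact: (measurableT_comp (measurable_powR p) (my th)).
have up : {ae mu, forall th, th \in `[(- pi), pi] -> ((powR (u th) p)%:E <=
    \int[mu]_(t in `[(- pi)%R, pi]) F (th, t))%E}.
  have FA : Filter (almost_everywhere mu) by exact: ae_filter_ringOfSetsType.
  apply: filterS H => th h thpi; have {h} := h thpi.
  have -> : (\int[mu]_(t in `[(- pi)%R, pi])
      ((1 - r) * dl t th / mod (polar 1 t - polar r th) ^+ 3)%R%:E =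
    \int[mu]_(t in `[(- pi)%R, pi]) (kap t * (dl (t + th) th / e t))%:E)%E.
    pose g t : \bar R := ((1 - r) * dl t th / mod (polar 1 t - polar r th) ^+ 3)%:E.
    have gE t : g (t + th) = (kap t * (dl (t + th) th / e t))%:E by rewrite /g kernel_chord.
    rewrite -[LHS](@nnint_window th g).
    - by apply: eq_integral => t _; rewrite gE.
    - by move: thpi; rewrite in_itv /= ler_norml => /andP[h1 h2]; have := pi_gt0 R; lra.
    - have -> : g = (fun t => (kap t * (dl (t + th) th / e t))%:E) \o (fun t => t - th).
        by apply/funext => t; rewrite /= -gE subrK.
      apply: (measurableT_comp _ (measurable_shift (- th))); apply/measurable_EFinP.
      exact: measurable_funM m_kap (my th).
    - by move=> t; rewrite lee_fin divr_ge0 ?exprn_ge0 ?modulus_ge0// mulr_ge0// subr_ge0 ltW.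
    - by move=> t; rewrite /g dl_periodic polarD2pi.
  move=> h; have uc : 0 <= u th / c by rewrite divr_ge0// ltW.
  have hc : ((u th / c)%:E <= \int[mu]_(t in `[(- pi)%R, pi]) (kap t * (dl (t + th) th / e t))%:E)%E.
    by rewrite EFinM muleC lee_pdivrMl.
  have := @weighted_jensen R `[- pi, pi]%classic kap (fun t => dl (t + th) th / e t) p (2 * pi) (u th / c)
    mpi (measurable_funTS m_kap) (measurable_funTS (my th)) kap_ge0 (y0 th) p1 pi2 kap_int uc hc.
  have cp0 : (0 <= (powR c p)%:E)%E by rewrite lee_fin powR_ge0.
  move=> /(lee_wpmul2l cp0); rewrite muleA -!EFinM -powRM ?(ltW c0)// mulrC divfK ?gt_eqF// -/K.
  by rewrite -nnintZ//; [exact: measurable_funTS|move=> t _; rewrite mulr_ge0 ?powR_ge0].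
rewrite /Lp_norm_on; apply: poweR_inv_le => //.
- by apply: integral_ge0 => t _; rewrite lee_fin powR_ge0.
- by rewrite !mulr_ge0 ?powR_ge0 ?pi_ge0// ltW.
apply: le_trans (_ : (\int[mu]_(th in `[(- pi)%R, pi])
  \int[mu]_(t in `[(- pi)%R, pi]) F (th, t) <= _)%E).
  apply: ae_le_nnint => //.
  - by apply/measurable_EFinP; exact: (measurableT_comp (measurable_powR p) mu_).
  - by move=> t; rewrite lee_fin powR_ge0.
  - by move=> t; apply: integral_ge0.
rewrite (@tonelli_on R `[- pi, pi]%classic F)//.
(* [W] bounds [|s| ^ (alpha * p) / e s ^ p]: the chord inequality replaces [|s|] by [3 * e s], and
   the remaining power [(alpha - 1) * p] of [e s] is not positive, so [e s >= 1 - r] applies. This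
   is where [alpha <= 1] enters. *)
pose W := powR 3 (alpha * p) * powR (1 - r) ((alpha - 1) * p).
have W0 : 0 <= W by rewrite mulr_ge0 ?powR_ge0.
have d0 : 0 < 1 - r by rewrite subr_gt0.
have inner s : s \in `[(- pi), pi] ->
    (\int[mu]_(th in `[(- pi)%R, pi]) F (th, s) <= (K * (B * W) * kap s)%:E)%E.
  move=> spi; have c1 := mulr_ge0 (mulr_ge0 K0 (kap_ge0 s)) (powR_ge0 (e s)^-1 p).
  have c2 := mulr_ge0 (mulr_ge0 K0 B0) (kap_ge0 s).
  have spi' : - pi <= s <= pi by move: spi; rewrite in_itv.
  have -> : (\int[mu]_(th in `[(- pi)%R, pi]) F (th, s) =
      (K * kap s * powR (e s)^-1 p)%:E * shift_int dl p s)%E.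
    rewrite /shift_int -nnintZ//.
    - apply: eq_integral => th _; rewrite /F /= powRM ?invr_ge0 ?(ltW (e_gt0 s))// (addrC s).
      by congr (_%:E); ring.
    - apply: measurable_funTS; apply: (measurableT_comp (measurable_powR p)).
      have mid : measurable_fun setT (fun t : R => t) by exact: measurable_id.
      exact: (measurableT_comp dl_meas (measurable_fun_pair (measurable_shift s) mid)).
    - by move=> t _; exact: powR_ge0.
  apply: le_trans (lee_wpmul2l _ (dlB spi')) _; first by rewrite lee_fin; exact: c1.
  rewrite -EFinM lee_fin.
  have -> : K * kap s * powR (e s)^-1 p * (B * powR `|s| (alpha * p)) =
    K * B * kap s * (powR (e s)^-1 p * powR `|s| (alpha * p)) by ring.
  have -> : K * (B * W) * kap s = K * B * kap s * W by ring.
  apply: ler_wpM2l; first exact: c2.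
  have sE : powR `|s| (alpha * p) <= powR 3 (alpha * p) * powR (e s) (alpha * p).
    rewrite -powRM// ?(ltW (e_gt0 s))//; apply: ge0_ler_powR.
    - by rewrite mulr_ge0// ltW.
    - by rewrite nnegrE.
    - by rewrite nnegrE mulr_ge0// ltW.
    - by case/andP: spi' => h1 h2; exact: chord_ge.
  apply: le_trans (ler_wpM2l (powR_ge0 _ _) sE) _.
  rewrite mulrCA; apply: ler_wpM2l; first exact: powR_ge0.
  have powRN1 x a : 0 < x -> powR x^-1 a = powR x (- a).
    by move=> x0; rewrite -powR_inv1 ?(ltW x0)// -powRrM mulN1r.
  rewrite powRN1// -powRD; last by rewrite (gt_eqF (e_gt0 s)) implybT.
  have -> : - p + alpha * p = - ((1 - alpha) * p) by ring.
  have -> : (alpha - 1) * p = - ((1 - alpha) * p) by ring.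
  rewrite -!powRN1//; apply: ge0_ler_powR; rewrite ?nnegrE ?invr_ge0 ?(ltW d0) ?(ltW (e_gt0 s))//.
    by rewrite mulr_ge0 ?subr_ge0// ltW.
  by rewrite lef_pV2 ?posrE.
apply: le_trans (ge0_le_nnint_on (g := fun s => (K * (B * W) * kap s)%:E) _ _) _.
- by move=> s; apply: integral_ge0.
- by move=> s /= spi; exact: inner.
have KBW : 0 <= K * (B * W) := mulr_ge0 K0 (mulr_ge0 B0 W0).
rewrite nnintZ//; last exact: measurable_funTS.
apply: le_trans (lee_wpmul2l _ kap_int) _; first by rewrite lee_fin.
rewrite -EFinM lee_fin le_eqVlt; apply/orP; left; apply/eqP.
pose X := 2 * pi * B * powR 3 (alpha * p).
have X0 : 0 <= X by rewrite !mulr_ge0 ?powR_ge0 ?pi_ge0.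
have Xp : powR (powR X p^-1) p = X by rewrite -powRrM mulVf ?gt_eqF// powRr1.
have c2 : 0 <= 2 * pi * c := mulr_ge0 pi0 (ltW c0).
rewrite -/X (powRM _ (mulr_ge0 c2 (powR_ge0 X p^-1)) (powR_ge0 _ _)) (powRM _ c2 (powR_ge0 _ _)).
rewrite (powRM _ pi0 (ltW c0)) Xp -powRrM /K /W /X; ring.
Qed.

End fixed_radius.
End Lp_estimate.

(** * The pointwise estimate *)

Section pointwise_estimate.
Variable R : realType.
Local Notation C := (cplx R).
Local Notation mu := (@lebesgue_measure R).
Local Notation mod := (@modulus R).
Local Notation I f := (\int[mu]_(x in `[- pi, pi]) f x).
Implicit Types (z w a : C).

Lemma one_sub_conj_ge a z : mod a < 1 -> mod z <= 1 -> 1 - mod a <= mod (1 - cj a * z).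
Proof.
move=> a1 z1; apply: le_trans (modulusB_ge _ _); rewrite modulus1 modulusM modulus_conj lerD2l lerN2.
by rewrite ler_piMr// modulus_ge0.
Qed.

Lemma one_sub_conj_circle a t : mod (1 - cj a * polar 1 t) = mod (polar 1 t - a).
Proof.
have -> : 1 - cj a * polar 1 t = polar 1 t * cj (polar 1 t - a).
  rewrite conjB mulrBr mul_conj modulus_polar normr1 expr1n (_ : cr 1 = 1)//.
  by rewrite (mulrC (cj a)).
by rewrite modulusM modulus_polar normr1 mul1r modulus_conj.
Qed.

Variables (D : set C) (rho : C -> R) (f : C -> C) (m : R).
Hypothesis Do : open D.
Hypothesis Dc : connected D.
Hypothesis rhoc : forall z, D z -> {for z, continuous rho}.
Hypothesis m0 : 0 < m.
Hypothesis rhom : forall z, D z -> m <= rho z.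
Hypothesis fd : forall z, mod z < 1 -> cdiff_at f z.
Hypothesis fD : forall z, mod z < 1 -> D (f z).
Local Notation d := (rho_dist D rho).

Let rho0 z : D z -> 0 < rho z.
Proof. by move=> Dz; apply: lt_le_trans m0 (rhom Dz). Qed.

Let fc z : mod z < 1 -> {for z, continuous f}.
Proof. by move=> /fd/cdiff_at_continuous. Qed.

Let mod_le_dist z w : D z -> D w -> mod (w - z) <= d z w / m.
Proof.
move=> Dz Dw; rewrite ler_pdivlMr// mulrC.
exact: (dist_lower Do Dc rhoc rho0 Dz Dw (ltW m0) rhom).
Qed.

Variable M : R.
Hypothesis fM : forall r, 0 < r < 1 -> I (fun t => d (f (polar r t)) (f 0)) <= M.
Hypothesis ae_regular : {ae mu, forall t, regular D f t}.

Section isometry.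
Variable phi : C -> C.
Hypothesis phid : forall z, D z -> cdiff_at phi z.
Hypothesis phiD : forall z, D z -> D (phi z).
Hypothesis phi_iso : forall z w, D z -> D w -> d (phi z) (phi w) = d z w.
Variables (r th : R).
Hypothesis r2 : 1 / 2 <= r.
Hypothesis r1 : r < 1.
Hypothesis th_regular : regular D f th.

Let z := polar r th.
Let c := phi (radial_lim f th).
Let g w := phi (f w).
(** The denominator has no zero in the closed disc; at [polar 1 t] its modulus is [e t], and near
    [z] it is of order [1 - r]. It thus adds a third power of the chord to the squared one of the
    Poisson kernel. With the square alone, the integral of [(1 - r) * |s| / |e^(i s) - r| ^ 2] would
    cost a logarithm at [alpha = 1]. *)
Let G w := (g w - c) / (1 - cj z * w).
Let e t := mod (polar 1 t - z).

Let r0 : 0 < r. Proof. by move: r2; lra. Qed.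
Let d0 : 0 < 1 - r. Proof. by rewrite subr_gt0. Qed.
Let mz : mod z = r. Proof. by rewrite modulus_polar gtr0_norm. Qed.
Let z1 : mod z < 1. Proof. by rewrite mz. Qed.

Let gd w : mod w < 1 -> cdiff_at g w.
Proof.
move=> w1; have [l fl] := fd w1; have [k pk] := phid (fD w1).
by eexists; exact: (cdiff_comp fl pk).
Qed.

Let den_ge w : mod w <= 1 -> 1 - r <= mod (1 - cj z * w).
Proof. by move=> w1; rewrite -{1}mz; exact: one_sub_conj_ge. Qed.

Let den_neq0 w : mod w <= 1 -> 1 - cj z * w != 0.
Proof. by move=> w1; rewrite -modulus_gt0; apply: lt_le_trans (den_ge w1). Qed.

Let Gd w : mod w < 1 -> cdiff_at G w.
Proof.
move=> w1; apply: cdiff_atM; first by apply: cdiff_atB; [exact: gd|exact: cdiff_at_cst].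
apply: (@cdiff_atV _ (fun w => 1 - cj z * w)); last exact: den_neq0 (ltW w1).
by apply: cdiff_atB; [exact: cdiff_at_cst|apply: cdiff_atM; [exact: cdiff_at_cst|exact: cdiff_at_id]].
Qed.

Let mod0 : mod (0 : C) < 1. Proof. by rewrite modulus0. Qed.

Let G_le w : mod w < 1 ->
  mod (G w) <= (1 - r)^-1 * (m^-1 * d (f w) (f 0) + mod (g 0 - c)).
Proof.
move=> w1; rewrite modulusM modulusV mulrC; apply: ler_pM.
- by rewrite invr_ge0 modulus_ge0.
- exact: modulus_ge0.
- rewrite lef_pV2 ?posrE//; first exact: den_ge (ltW w1).
  by apply: lt_le_trans (den_ge (ltW w1)).
apply: le_trans (modulusB_tri (g 0) _ _) _; apply: lerD => //.
rewrite modulusB mulrC -(phi_iso (fD w1) (fD mod0)).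
exact: (mod_le_dist (phiD (fD w1)) (phiD (fD mod0))).
Qed.

Let polar_lt (s t : R) : 0 < s < 1 -> mod (polar s t) < 1.
Proof. by move=> /andP[s0 s1]; rewrite modulus_polar gtr0_norm. Qed.

(** This places [G] in [H^1]. The bound depends on [r] and on [phi], which is harmless: it does not
    occur in the conclusion of [hardy_majorization]. *)
Let G_mean s : 0 < s < 1 ->
  I (fun t => mod (G (polar s t))) <= (1 - r)^-1 * (m^-1 * M + mod (g 0 - c) * (2 * pi)).
Proof.
move=> s01; have cp (t : R) : {for t, continuous (fun t => polar s t)}.
  by apply: polar_continuous; [exact: cvg_cst|exact: cvg_id].
have cd (t : R) : {for t, continuous (fun t => d (f (polar s t)) (f 0))}.
  apply: (dist_cvg Do Dc rhoc rho0); [exact/fD/polar_lt|exact: fD| |exact: cvg_cst].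
  by apply: (@continuous_comp _ _ _ (fun t => polar s t) f); [exact: cp|exact/fc/polar_lt].
have I1 : mu.-integrable `[- pi, pi] (EFin \o (fun t => d (f (polar s t)) (f 0))).
  by apply: pointwise_continuous_integrable => t _; exact: cd.
have I2 : mu.-integrable `[- pi, pi] (EFin \o (fun _ : R => mod (g 0 - c))).
  by apply: pointwise_continuous_integrable => t _; exact: cvg_cst.
have I3 : mu.-integrable `[- pi, pi] (EFin \o (fun t => mod (G (polar s t)))).
  apply: pointwise_continuous_integrable => t _.
  apply: (@continuous_comp _ _ _ (fun t => G (polar s t)) mod); last exact: continuous_modulus.
  apply: (@continuous_comp _ _ _ (fun t => polar s t) G); first exact: cp.
  by apply: cdiff_at_continuous; apply: Gd; exact: polar_lt.
have I4 := integD (integZ m^-1 I1) I2.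
apply: le_trans (_ : I (fun t => (1 - r)^-1 * (m^-1 * d (f (polar s t)) (f 0) + mod (g 0 - c))) <= _).
  apply: le_Rintegral => //; first exact: integZ.
  by move=> t _; exact/G_le/polar_lt.
rewrite RintegralZl//; apply: ler_wpM2l; first by rewrite invr_ge0 ltW.
rewrite RintegralD//; last exact: integZ.
rewrite RintegralZl// rint_cst; last exact: oppi_lepi.
rewrite (_ : pi - - pi = 2 * pi); last by ring.
by rewrite lerD2r; apply: ler_wpM2l; [rewrite invr_ge0 ltW|exact: fM].
Qed.

Let e_ge t : 1 - r <= e t.
Proof. by rewrite /e -one_sub_conj_circle; apply: den_ge; rewrite modulus_polar normr1. Qed.

Let e_gt0 t : 0 < e t.
Proof. exact: lt_le_trans (e_ge t). Qed.

Let e_cont (t : R) : {for t, continuous e}.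
Proof.
apply: (@continuous_comp _ _ _ (fun t => polar 1 t - z) mod); last exact: continuous_modulus.
apply: (@continuous_comp _ _ _ (fun t => polar 1 t) (fun w => w - z)).
  by apply: polar_continuous; [exact: cvg_cst|exact: cvg_id].
by apply: cdiff_at_continuous; apply: cdiff_atB; [exact: cdiff_at_id|exact: cdiff_at_cst].
Qed.

Let beta t := bdist D rho f t th / (m * e t).

Let beta_ge0 t : 0 <= beta t.
Proof. by rewrite /beta divr_ge0 ?bdist_ge0// mulr_ge0// ltW. Qed.

Let measurable_bdistl : measurable_fun setT (fun t => bdist D rho f t th).
Proof.
have mid : measurable_fun setT (fun t : R => t) by exact: measurable_id.
exact: (measurableT_comp (measurable_bdist Do Dc rhoc rho0 fc fD) (measurable_fun_pair mid (measurable_cst th))).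
Qed.

Let measurable_einv (k : R) (n : nat) : 0 < k -> measurable_fun setT (fun t => (k * e t ^+ n)^-1).
Proof.
move=> k0; suff H (t : R) : {for t, continuous (fun t => (k * e t ^+ n)^-1)}.
  by apply: continuous_measurable_fun => t; exact: H.
apply: continuousV; first by rewrite gt_eqF// mulr_gt0// exprn_gt0.
have c1 : {for t, continuous (fun _ : R => k)} by exact: cvg_cst.
have c2 : {for t, continuous (fun t => e t ^+ n)}.
  by apply: (@continuous_comp _ _ _ e (fun x => x ^+ n)); [exact: e_cont|exact: exprn_continuous].
exact: (continuousM c1 c2).
Qed.

Let measurable_beta : measurable_fun setT beta.
Proof.
apply: measurable_funM => //.
by have := @measurable_einv m 1 m0.
Qed.

(** At a regular angle the radial limit of [f] lies in [D], where [phi] is continuous, so it passes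
    through [phi]. The isometry then turns [|g_b t - c|] into a distance of boundary values of
    [f]. *)
Let G_boundary : {ae mu, forall t, t \in `[- pi, pi] ->
     exists2 L : C, G (polar s t) @[s --> 1^'-] --> L & mod L <= beta t}.
Proof.
have FA : Filter (almost_everywhere mu) by exact: ae_filter_ringOfSetsType.
apply: filterS ae_regular => t tg _.
exists ((phi (radial_lim f t) - c) / (1 - cj z * polar 1 t)).
  have cphi : {for radial_lim f t, continuous phi}.
    by apply: cdiff_at_continuous; apply: phid; case: tg.
  have gl : g (polar s t) @[s --> 1^'-] --> phi (radial_lim f t).
    apply: (@cvg_comp _ _ _ (fun s => f (polar s t)) phi _ _ _ (regular_cvg tg)).
    exact: cphi.
  have cp : {for (1 : R), continuous (fun s => polar s t)}.
    by apply: polar_continuous; [exact: cvg_id|exact: cvg_cst].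
  have pl : polar s t @[s --> 1^'-] --> polar 1 t.
    by apply: cvg_within_filter; exact: cp.
  have h1 : {for polar 1 t, continuous (fun w => (1 - cj z * w)^-1)}.
    apply: cdiff_at_continuous; apply: (@cdiff_atV _ (fun w => 1 - cj z * w)).
      by apply: cdiff_atB; [exact: cdiff_at_cst|apply: cdiff_atM; [exact: cdiff_at_cst|exact: cdiff_at_id]].
    by apply: den_neq0; rewrite modulus_polar normr1.
  have dl : (1 - cj z * polar s t)^-1 @[s --> 1^'-] --> (1 - cj z * polar 1 t)^-1.
    exact: (@cvg_comp _ _ _ (fun s => polar s t) (fun w => (1 - cj z * w)^-1) _ _ _ pl h1).
  apply: cvgM dl; apply: cvgB gl _; exact: cvg_cst.
rewrite modulusM modulusV one_sub_conj_circle -/(e t) /beta invfM mulrA.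
apply: ler_wpM2r; first by rewrite invr_ge0 ltW.
have [_ Dt] := tg; have [_ Dth] := th_regular.
rewrite modulusB; apply: le_trans (mod_le_dist (phiD Dt) (phiD Dth)) _.
by rewrite phi_iso// (bdistE Do Dc rhoc rho0).
Qed.

Let J := (\int[mu]_(t in `[(- pi)%R, pi]) ((1 - r) * bdist D rho f t th / e t ^+ 3)%R%:E)%E.

Let g_near w (j : R) : J = j%:E -> mod (w - z) <= (1 - r) / 2 ->
  mod (g w - c) <= 18 * (1 - r) * j / (pi * m).
Proof.
move=> Jj wz; have pi0 := pi_gt0 R; have w1r : mod w <= r + (1 - r) / 2.
  have := modulusD (w - z) z; rewrite subrK mz; move: wz; lra.
have w1 : mod w < 1 by move: w1r d0; lra.
have := hardy_majorization Gd G_mean (measurable_funTS measurable_beta) beta_ge0 G_boundary w1.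
(* [12 = 3 * 2 ^+ 2]: for [w] within [(1 - r) / 2] of [z], one has [1 - mod w ^+ 2 <= 3 * (1 - r)]
   and [mod (polar 1 t - w) >= e t / 2]. *)
move=> H; have {H} : ((2 * pi * mod (G w))%:E <= (12 / m * j)%:E)%E.
  apply: le_trans H _; rewrite EFinM -Jj /J -nnintZ//; first last.
  - by rewrite divr_ge0// ltW.
  - by move=> t _; rewrite divr_ge0 ?exprn_ge0 ?mulr_ge0 ?bdist_ge0// ltW.
  - apply: measurable_funTS; apply: measurable_funM; first exact: measurable_funM.
    by have := @measurable_einv 1 3 ltr01; under eq_fun do rewrite mul1r.
  apply: ge0_le_nnint_on => t; first by rewrite lee_fin mulr_ge0// poisson_ker_ge0.
  move=> _; rewrite lee_fin /beta.
  have -> : 12 / m * ((1 - r) * bdist D rho f t th / e t ^+ 3) =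
     (12 * (1 - r) / e t ^+ 2) * (bdist D rho f t th / (m * e t)).
    by field; rewrite !gt_eqF.
  apply: ler_wpM2r (beta_ge0 t) _ _ _.
  have we : e t / 2 <= mod (polar 1 t - w).
    have := modulusB_tri w (polar 1 t) z; rewrite -/(e t).
    by have := e_ge t; move: wz; lra.
  rewrite /poisson_ker expr1n.
  apply: le_trans (_ : (3 * (1 - r)) / (e t / 2) ^+ 2 <= _); last first.
    by rewrite le_eqVlt; apply/orP; left; apply/eqP; field; rewrite gt_eqF.
  apply: ler_pM.
  - by rewrite subr_ge0 exprn_ile1 ?modulus_ge0// ltW.
  - by rewrite invr_ge0 exprn_ge0 ?modulus_ge0.
  - have := modulusD w (z - w); rewrite subrKC mz (modulusB z) => zl.
    by have := sqr_ge0 (1 - mod w); rewrite sqrrB expr1n; move: zl wz; lra.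
  - rewrite lef_pV2 ?posrE ?exprn_gt0 ?divr_gt0//; last by apply: lt_le_trans we; rewrite divr_gt0.
    by rewrite ler_pXn2r ?nnegrE ?modulus_ge0// divr_ge0// ltW.
rewrite lee_fin => H.
have -> : g w - c = G w * (1 - cj z * w) by rewrite /G divfK// den_neq0// ltW.
rewrite modulusM.
(* The bound just obtained is [6 * j / (pi * m)] for [G w]; the factor 3 of the denominator makes it
   18. *)
have den_le : mod (1 - cj z * w) <= 3 * (1 - r).
  have -> : 1 - cj z * w = cr (1 - r ^+ 2) - cj z * (w - z).
    by rewrite mulrBr (mulrC (cj z) z) mul_conj mz (crD 1) (crN (r ^+ 2)) (_ : cr 1 = 1)//; ring.
  apply: le_trans (modulusD _ _) _; rewrite modulusN modulusM modulus_conj mz modulus_real ger0_norm; last first.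
    by rewrite subr_ge0 exprn_ile1// ltW.
  have := ler_wpM2l (ltW r0) wz; have := mulr_gt0 r0 d0; rewrite expr2; nra.
apply: le_trans (ler_wpM2l (modulus_ge0 _) den_le) _.
have -> : 18 * (1 - r) * j / (pi * m) = 6 * j / (pi * m) * (3 * (1 - r)) by ring.
apply: ler_wpM2r; first by rewrite mulr_ge0// ltW.
rewrite ler_pdivlMr ?mulr_gt0//.
have := ler_wpM2r (ltW m0) H; rewrite (mulrAC _ j) divfK ?gt_eqF//; lra.
Qed.

(** The difference quotients of [d_rho] are the same for [f] and [g], so the limit may be computed
    for [g], where the density factor is [rho (g z) <= k]. What remains is Cauchy's estimate for
    [g']. *)
Lemma rho_derivative_le (k : R) : rho (phi (f z)) <= k ->
  ((rho_derivative D rho f z)%:E <= (k * (72 / (pi * m)))%:E * J)%E.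
Proof.
move=> rk; have [l gl] := gd z1; have pi0 := pi_gt0 R.
have Dg : D (g z) by exact/phiD/fD.
have k0 : 0 < k := lt_le_trans (rho0 Dg) rk.
have c0 : 0 < k * (72 / (pi * m)) by rewrite mulr_gt0// divr_gt0// mulr_gt0.
have -> : rho_derivative D rho f z = rho (g z) * mod l.
  rewrite /rho_derivative; apply: cvg_lim => //.
  apply: cvg_trans (dist_ratio_cvg Do Dc rhoc rho0 Dg gl).
  apply: near_eq_cvg; apply: cvg_within; apply: filterS (near_mod z d0) => w wz.
  have w1 : mod w < 1 by have := modulusD (w - z) z; rewrite subrK mz; move: wz; lra.
  by rewrite /g phi_iso//; exact: fD.
have J0 : (0 <= J)%E.
  apply: integral_ge0 => t _; rewrite lee_fin.
  by rewrite divr_ge0 ?exprn_ge0 ?mulr_ge0 ?bdist_ge0// ltW.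
case E : J J0 => [j||//]; last by move=> _; rewrite gt0_muley ?lte_fin// leey.
rewrite lee_fin => j0; rewrite -EFinM lee_fin -mulrA.
apply: ler_pM => //; [exact/ltW/rho0|exact: modulus_ge0|].
have B t : mod (g (z + polar ((1 - r) / 2) t) - g z) <= 2 * (18 * (1 - r) * j / (pi * m)).
  rewrite mulr_natl mulr2n; apply: le_trans (modulusB_tri c _ _) _; apply: lerD.
    apply: g_near => //; rewrite addrAC subrr add0r modulus_polar ger0_norm//.
    by rewrite divr_ge0// ltW.
  by rewrite modulusB; apply: g_near => //; rewrite subrr modulus0 divr_ge0// ltW.
have h : 0 < (1 - r) / 2 < 1 - r by rewrite divr_gt0//=; move: d0; lra.
have [h1 h2] := andP h.
have gdz y : mod (y - z) < 1 - r -> cdiff_at g y.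
  move=> yz; apply: gd; have := modulusD (y - z) z; rewrite subrK mz; move: yz; lra.
(* [72 = 2 * 2 * 18]: one factor 2 from comparing with [g z] through [c], one from the radius
   [(1 - r) / 2], which also cancels the factor [1 - r]. *)
have := cauchy_estimate h1 h2 gdz gl B.
rewrite -ler_pdivlMl// => /le_trans; apply.
have pm0 : 0 < pi * m by rewrite mulr_gt0.
move: (pi * m) pm0 => P pm0; rewrite le_eqVlt; apply/orP; left; apply/eqP; field.
by rewrite !gt_eqF.

Qed.

End isometry.
End pointwise_estimate.

(** * Measurability of the rho-derivative, and integral bounds from the Hardy and Lipschitz
    conditions *)

Section hardy_lipschitz_hypotheses.
Variable R : realType.
Local Notation C := (cplx R).
Local Notation mu := (@lebesgue_measure R).
Local Notation mod := (@modulus R).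
Local Notation I f := (\int[mu]_(x in `[- pi, pi]) f x).
Variables (D : set C) (rho : C -> R) (f : C -> C).
Hypothesis Do : open D.
Hypothesis Dc : connected D.
Hypothesis rhoc : forall z, D z -> {for z, continuous rho}.
Hypothesis rho0 : forall z, D z -> 0 < rho z.
Hypothesis fd : forall z, mod z < 1 -> cdiff_at f z.
Hypothesis fD : forall z, mod z < 1 -> D (f z).
Local Notation d := (rho_dist D rho).

Let fc z : mod z < 1 -> {for z, continuous f}.
Proof. by move=> /fd/cdiff_at_continuous. Qed.

Lemma rho_derivativeE z : mod z < 1 -> exists2 l : C, cdiff f z l &
  rho_derivative D rho f z = rho (f z) * mod l.
Proof.
move=> z1; have [l fl] := fd z1; exists l => //.
by apply: cvg_lim => //; exact: (dist_ratio_cvg Do Dc rhoc rho0 (fD z1) fl).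
Qed.

Lemma rho_derivative_ge0 z : mod z < 1 -> 0 <= rho_derivative D rho f z.
Proof.
move=> z1; have [l _ ->] := rho_derivativeE z1.
by rewrite mulr_ge0 ?modulus_ge0// ltW// rho0//; exact: fD.
Qed.

(** A pointwise limit of continuous difference quotients along the real increments [eta n]; these
    are smaller than [1 - r], so that the second point stays in the disc. *)
Lemma measurable_rho_derivative r : 0 < r < 1 ->
  measurable_fun setT (fun t => rho_derivative D rho f (polar r t)).
Proof.
move=> /andP[r0 r1]; have d0 : 0 < 1 - r by rewrite subr_gt0.
pose eta (n : nat) : R := (1 - r) / n.+2%:R.
have eta0 n : 0 < eta n by rewrite divr_gt0// ltr0n.
have eta1 n : eta n < 1 - r by rewrite ltr_pdivrMr ?ltr0n// ltr_pMr// ltr1n.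
have pr t : mod (polar r t) < 1 by rewrite modulus_polar gtr0_norm.
have pe n t : mod (polar r t + cr (eta n)) < 1.
  apply: le_lt_trans (modulusD _ _) _; rewrite modulus_polar modulus_real !gtr0_norm//.
  by have := eta1 n; lra.
pose h (n : nat) (t : R) := d (f (polar r t)) (f (polar r t + cr (eta n))) / eta n.
apply: (@measurable_fun_cvg _ _ _ _ h) => [n|t _].
  apply: measurable_funM => //; apply: continuous_measurable_fun => t.
  have cp : {for t, continuous (fun t => polar r t)}.
    by apply: polar_continuous; [exact: cvg_cst|exact: cvg_id].
  apply: (dist_cvg Do Dc rhoc rho0); try exact: fD.
    by apply: (@continuous_comp _ _ _ (fun t => polar r t) f); [exact: cp|exact: fc].
  apply: (@continuous_comp _ _ _ (fun t => polar r t) (fun w => f (w + cr (eta n)))); first exact: cp.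
  apply: (@continuous_comp _ _ _ (fun w => w + cr (eta n)) f); last exact: fc.
  by apply: cdiff_at_continuous; apply: cdiff_atD; [exact: cdiff_at_id|exact: cdiff_at_cst].
have [l fl ->] := rho_derivativeE (pr t).
have ratio := dist_ratio_cvg Do Dc rhoc rho0 (fD (pr t)) fl.
have etac : polar r t + cr (eta n) @[n --> \oo] --> (polar r t)^'.
  have c0 : eta n @[n --> \oo] --> (0 : R).
    rewrite -[X in _ --> X](mulr0 (1 - r)); apply: cvgM; first exact: cvg_cst.
    by have := @cvg_harmonic R; rewrite -cvg_shiftS.
  move=> A /nbhs_modP[e e0 eA]; move/cvgrPdist_lt : c0 => /(_ e e0).
  apply: filterS => n; rewrite sub0r normrN => en; apply: eA.
    by rewrite addrAC subrr add0r modulus_real.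
  by rewrite /= -subr_eq0 addrAC subrr add0r -modulus_gt0 modulus_real gtr0_norm.
rewrite (_ : (fun n => h n t) = (fun w => d (f (polar r t)) (f w) / mod (polar r t - w)) \o
    (fun n => polar r t + cr (eta n))); first exact: cvg_comp etac ratio.
apply/funext => n.
rewrite -[RHS]/(d (f (polar r t)) (f (polar r t + cr (eta n))) /
  mod (polar r t - (polar r t + cr (eta n)))); congr (_ / _).
by rewrite modulusB addrAC subrr add0r modulus_real gtr0_norm.
Qed.

(** A bound in [L^p] on circles becomes one in [L^1] through [x <= 1 + x ^ p], the case [l = 1] of
    [powR_tangent]; this avoids Hoelder's inequality. *)
Lemma rhoH_mean_bound (p : R) : 1 <= p -> rhoH D rho p f ->
  exists M : R, forall r, 0 < r < 1 -> I (fun t => d (f (polar r t)) (f 0)) <= M.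
Proof.
pose m r := mean_p p r (fun z => d (f z) (f 0)).
move=> p1 [_ supm]; have p0 : 0 < p by lra.
have [s sE] : exists s : R, forall r, 0 < r < 1 -> (m r <= s%:E)%E.
  exists (fine (ereal_sup (m @` `]0%R, 1%R[))) => r r01; have {}supm : (ereal_sup (m @` `]0%R, 1%R[) < +oo)%E by [].
  have ms : (m r <= ereal_sup (m @` `]0%R, 1%R[))%E.
    by apply: ereal_sup_ubound; exists r => //=; rewrite in_itv.
  rewrite fineK//; rewrite ge0_fin_numE//; apply: le_trans ms; exact: poweR_ge0.
exists (2 * pi + powR s p) => r r01; have /andP[r0 r1] := r01.
have f0 : mod (0 : C) < 1 by rewrite modulus0.
have pr t : mod (polar r t) < 1 by rewrite modulus_polar gtr0_norm.
have cd (t : R) : {for t, continuous (fun t => d (f (polar r t)) (f 0))}.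
  apply: (dist_cvg Do Dc rhoc rho0); [exact: fD|exact: fD| |exact: cvg_cst].
  apply: (@continuous_comp _ _ _ (fun t => polar r t) f); last exact: fc.
  by apply: polar_continuous; [exact: cvg_cst|exact: cvg_id].
have I1 : mu.-integrable `[- pi, pi] (EFin \o (fun t => d (f (polar r t)) (f 0))).
  by apply: pointwise_continuous_integrable => t _; exact: cd.
have md : measurable_fun setT (fun t => d (f (polar r t)) (f 0)).
  by apply: continuous_measurable_fun => t; exact: cd.
have d0 t : 0 <= d (f (polar r t)) (f 0) by exact: dist_ge0.
rewrite -lee_fin -nnint_Rintegral// EFinD.
have mdp : measurable_fun setT (fun t => powR (d (f (polar r t)) (f 0)) p).
  exact: (measurableT_comp (measurable_powR p) md).
apply: le_trans (_ : \int[mu]_(t in `[(- pi)%R, pi]) (1 + powR (d (f (polar r t)) (f 0)) p)%:E <= _)%E.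
  apply: ge0_le_nnint_on => t; first by rewrite lee_fin.
  move=> _; rewrite lee_fin; apply: le_trans (powR_tangent p1 (d0 t) ltr01) _.
  rewrite powR1 mul1r; have pi0 : 0 < p^-1 by rewrite invr_gt0.
  have pi1 : p^-1 <= 1 by rewrite invf_le1.
  apply: lerD; first by lra.
  by rewrite ler_piMl// powR_ge0.
rewrite nnintD//; [|exact: measurable_funTS|by move=> t _; exact: powR_ge0].
apply: leeD; last first.
  apply: le_poweR_inv => //; last exact: sE.
  by apply: integral_ge0 => t _; rewrite lee_fin powR_ge0.
rewrite integral_cst//= lebesgue_measure_itv /= lte_fin gtrN ?pi_gt0// mul1e -EFinB lee_fin.
by rewrite opprK; have := pi_gt0 R; lra.
Qed.

Lemma rhoLambda_modulus (p alpha : R) : 1 <= p -> 0 < alpha ->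
  rhoLambda D rho p alpha (radial_dom f) (radial_lim f) ->
  exists B h : R, [/\ 0 <= B, 0 < h & forall s, 0 < s < h ->
    (shift_int (bdist D rho f) p s <= (B * powR s (alpha * p))%:E)%E].
Proof.
move=> p1 a0 [aeg _ _ [M]].
pose m s := Lp_norm_on 0 (2 * pi) p (fun t => d (radial_lim f (t + s)) (radial_lim f t)).
have p0 : 0 < p by lra.
move=> /nbhs_ballP[h /= h0 hM].
(* The supremum runs over shifts strictly below its bound, so [s] is placed in the interval up to
   [s + s]; this halves [h] and costs [2 ^ (alpha * p)]. The absolute value is taken because [M] may
   be negative. *)
exists (powR `|M| p * powR 2 (alpha * p)), (h / 2); split.
- by rewrite mulr_ge0 ?powR_ge0.
- by rewrite divr_gt0.
move=> s /andP[s0 sh]; have s20 : 0 < s + s by rewrite addr_gt0.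
have sup : (ereal_sup (m @` `]0%R, (s + s)%R[) <= (M * powR (s + s) alpha)%:E)%E.
  apply: (hM (s + s)); last by [].
  by rewrite /ball /= sub0r normrN gtr0_norm//; move: sh; lra.
have ms : (m s <= (`|M| * powR (s + s) alpha)%:E)%E.
  apply: le_trans (_ : (M * powR (s + s) alpha)%:E <= _)%E; last first.
    by rewrite lee_fin ler_wpM2r ?powR_ge0// ler_norm.
  apply: le_trans sup; apply: ereal_sup_ubound; exists s => //=.
  by rewrite in_itv /= s0 /=; lra.
have I0 : (0 <= \int[mu]_(t in `[0%R, (2 * pi)%R])
    (powR (d (radial_lim f (t + s)) (radial_lim f t)) p)%:E)%E.
  by apply: integral_ge0 => t _; rewrite lee_fin powR_ge0.
have := le_poweR_inv I0 p0 ms.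
have -> : powR (`|M| * powR (s + s) alpha) p = powR `|M| p * powR 2 (alpha * p) * powR s (alpha * p).
  rewrite powRM ?powR_ge0// -powRrM -mulrA; congr (_ * _).
  by rewrite -powRM ?(ltW s0)//; congr powR; ring.
apply: le_trans.
(* The two integrals differ in their windows, [[0, 2 * pi]] and [[- pi, pi]], which periodicity
   reconciles, and in their integrands, which agree almost everywhere. *)
pose g (t : R) : \bar R := (powR (bdist D rho f (t + s) t) p)%:E.
have mid : measurable_fun setT (fun t : R => t) by exact: measurable_id.
have mg : measurable_fun setT g.
  apply/measurable_EFinP; apply: (measurableT_comp (measurable_powR p)).
  exact: (measurableT_comp (measurable_bdist Do Dc rhoc rho0 fc fD) (measurable_fun_pair (measurable_shift s) mid)).
have g0 t : (0 <= g t)%E by rewrite lee_fin powR_ge0.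
have pi0 := pi_gt0 R; have T0 : 0 <= 2 * pi :> R by lra.
have gT t : g (t + 2 * pi) = g t.
  rewrite /g addrAC bdist_periodl (bdist_periodr Do Dc rhoc rho0)//.
have -> : shift_int (bdist D rho f) p s = (\int[mu]_(t in `[0%R, (2 * pi)%R]) g t)%E.
  have := @nnint_periodic R (2 * pi) (- pi) 0 g T0 mg g0 gT.
  rewrite (_ : - pi + 2 * pi = pi); last by ring.
  by rewrite add0r; apply; apply/andP; split; move: pi0; lra.
apply: ae_le_nnint => //; first exact: measurable_funTS.
  by move=> t; rewrite lee_fin powR_ge0.
have FA : Filter (almost_everywhere mu) by exact: ae_filter_ringOfSetsType.
apply: filterS2 aeg (ae_shift s aeg) => t tg tsg _.
by rewrite /g (bdistE Do Dc rhoc rho0).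
Qed.

End hardy_lipschitz_hypotheses.

Theorem theorem5p3 (R : realType) (D : set (cplx R)) (rho : cplx R -> R)
    (F : set (cplx R -> cplx R)) (p alpha : R) (f : cplx R -> cplx R)
    (hD : domain D) (hrho : is_metric D rho)
    (h1 : 0 < inf [set rho z | z in D])
    (h2 : dist_blowup D rho)
    (hF : F `<=` Aut D)
    (hFtrans : transitive_domain F D)
    (hFinv : invariant_metric F D rho)
    (hp : 1 <= p)
    (halpha0 : 0 < alpha) (halpha1 : alpha <= 1)
    (hf : analytic_map D f)
    (hfH : rhoH D rho p f)
    (hfb : rhoLambda D rho p alpha (radial_dom f) (radial_lim f)) :
  exists M : R, \forall r \near 1^'-,
    (mean_p p r (rho_derivative D rho f) <= (M * powR (1 - r) (alpha - 1))%:E)%E.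
Proof.
move: hD hrho => [_ Do Dc] [rhow rho0].
have rhoc := metric_continuous Do rhow.
pose m := inf [set rho z | z in D].
have rhom z : D z -> m <= rho z.
  by move=> Dz; apply: ge_inf; [exists 0 => _ [y Dy <-]; exact/ltW/rho0|exists z].
have fD z : modulus z < 1 -> D (f z) by move=> z1; apply: hf.2.
have fd z : modulus z < 1 -> cdiff_at f z by move=> z1; apply: derivable_cdiff; exact: hf.1.
have fc z : modulus z < 1 -> {for z, continuous f} by move=> /fd/cdiff_at_continuous.
have [K [Kc KD] Ktrans] := hFtrans.
(* Transitivity enters through compactness: [rho] is bounded on [K], although it need not be on
   [D]. *)
have [k k0 rhok] : exists2 k : R, 0 < k & forall z, K z -> rho z <= k.
  have /compact_bounded[N [_ rhoN]] : compact (rho @` K).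
    by apply: continuous_compact Kc; exact: continuous_subspaceW KD rhow.
  exists (`|N| + 1); first by rewrite ltr_wpDl.
  move=> z Kz; apply: le_trans (ler_norm _) _; apply: rhoN; last by exists z.
  by rewrite (le_lt_trans (ler_norm _))// ltrDl.
have [M fM] := rhoH_mean_bound Do Dc rhoc rho0 fd fD hp hfH.
have [B0 [h [B00 h0 fB0]]] := rhoLambda_modulus Do Dc rhoc rho0 fd fD hp halpha0 hfb.
have p0 : 0 < p by lra.
have ap0 : 0 < alpha * p by rewrite mulr_gt0.
have ae_regular : {ae @lebesgue_measure R, forall t, regular D f t} by case: hfb.
have bsym := bdist_sym Do Dc rhoc rho0 fD.
have bmeas := measurable_bdist Do Dc rhoc rho0 fc fD.
have bper := bdist_periodl D rho f.
have [B B_ge0 fB] : exists2 B : R, 0 <= B & forall s, - pi <= s <= pi ->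
    (shift_int (bdist D rho f) p s <= (B * powR `|s| (alpha * p))%:E)%E.
  have btri t s u := @bdist_tri R D rho Do Dc rhoc rho0 f t s u.
  have bxx := bdistxx Do Dc rhoc rho0 fD.
  exact: (shift_int_bound (bdist_ge0 D rho f) bsym bxx bper bmeas btri ae_regular p0 ap0 B00 h0 fB0).
(* The map [phi] is chosen anew for each point [polar r t], but [c] depends only on [k] and [m],
   hence neither on [t] nor on [r]. *)
pose c := k * (72 / (pi * m)).
have c0 : 0 < c by rewrite mulr_gt0// divr_gt0// mulr_gt0// pi_gt0.
exists (2 * pi * c * powR (2 * pi * B * powR 3 (alpha * p)) p^-1).
have near_half : \forall r \near (1 : R)^'-, 1 / 2 <= r by apply: nbhs_left_ge; lra.
have near_lt : \forall r \near (1 : R)^'-, r < 1 by exact: nbhs_left_lt.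
apply: filterS2 near_half near_lt => r r2 r1.
have r01 : 0 < r < 1 by apply/andP; split => //; lra.
have [r0 _] := andP r01.
have pr t : modulus (polar r t) < 1 by rewrite modulus_polar gtr0_norm.
have mu_ := measurable_funTS (D := `[- pi, pi]%classic)
  (measurable_rho_derivative Do Dc rhoc rho0 fd fD r01).
have u0 t := rho_derivative_ge0 Do Dc rhoc rho0 fd fD (pr t).
apply: (Lp_kernel_estimate (bdist_ge0 D rho f) bper bmeas hp halpha0 halpha1 B_ge0 fB r2 r1 c0 mu_ u0).
have FA : Filter (almost_everywhere (@lebesgue_measure R)) by exact: ae_filter_ringOfSetsType.
apply: (filterS _ ae_regular) => t tg _.
have [phi Fphi Kphi] := Ktrans _ (fD _ (pr t)).
have [phih [phiD _]] := hF _ Fphi.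
have phid z : D z -> cdiff_at phi z by move=> Dz; apply: derivable_cdiff; exact: phih.
have phi_iso z w := hFinv _ Fphi z w.
exact: (rho_derivative_le Do Dc rhoc h1 rhom fd fD fM ae_regular phid phiD phi_iso r2 r1 tg (rhok _ Kphi)).
Qed.
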